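(* Let $0<q<1$, let $\eta=\tfrac12(q^{1/4}+q^{-1/4})$, and let $\omega,\omega'$ satisfy the boundary condition $S(\eta;\omega)=S(\eta;\omega')=0$. Put $$w(\theta)=\frac{(e^{2i\theta},e^{-2i\theta};q)_\infty}{(q^{1/2}e^{2i\theta},q^{1/2}e^{-2i\theta};q)_\infty}.$$ Then: (i) $$\int_0^\pi C(\cos\theta;\omega)\,C(\cos\theta;\omega')\,w(\theta)\,d\theta=\begin{cases}0 & \text{if }\omega\neq\omega',\\[4pt] \pi\,\dfrac{(q^{1/2};q)_\infty^2}{(q;q)_\infty^2}\,C(\eta;\omega)\,\dfrac{\partial}{\partial\omega}S(\eta;\omega) & \text{if }\omega=\omega';\end{cases}$$ (ii) $$\int_0^\pi S(\cos\theta;\omega)\,S(\cos\theta;\omega')\,w(\theta)\,d\theta=\begin{cases}0 & \text{if }\omega\neq\omega',\\[4pt] \pi\,\dfrac{(q^{1/2};q)_\infty^2}{(q;q)_\infty^2}\,C(\eta;\omega)\,\dfrac{\partial}{\partial\omega}S(\eta;\omega) & \text{if }\omega=\omega';\end{cases}$$ (iii) $$\int_0^\pi C(\cos\theta;\omega)\,S(\cos\theta;\omega')\,w(\theta)\,d\theta=0.$$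
   Context: Notation: $(a;q)_0=1$, $(a;q)_n=\prod_{k=0}^{n-1}(1-aq^k)$ for $n=1,2,\dots$ or $n=\infty$, $(a_1,\dots,a_m;q)_n=\prod_{l}(a_l;q)_n$, and ${}_2\varphi_1(a,b;c;q,t)=\sum_{n\ge0}\frac{(a,b;q)_n}{(q,c;q)_n}t^n$. For $x=\cos\theta$ ($\theta\in\mathbb C$) and $|\omega|<1$ the basic cosine and sine functions are $$C(x;\omega)=\frac{(-\omega^2;q^2)_\infty}{(-q\omega^2;q^2)_\infty}\,{}_2\varphi_1(-qe^{2i\theta},-qe^{-2i\theta};q;q^2,-\omega^2),$$ $$S(x;\omega)=\frac{(-\omega^2;q^2)_\infty}{(-q\omega^2;q^2)_\infty}\,\frac{2q^{1/4}\omega}{1-q}\cos\theta\;{}_2\varphi_1(-q^2e^{2i\theta},-q^2e^{-2i\theta};q^3;q^2,-\omega^2).$$ For fixed $x$, the functions $(-q\omega^2;q^2)_\infty C(x;\omega)$ and $(-q\omega^2;q^2)_\infty S(x;\omega)$ extend to entire functions of $\omega$; $C(x;\omega)$ and $S(x;\omega)$ denote the resulting meromorphic continuations in $\omega$. The point $x=\eta$ corresponds to $e^{i\theta}=q^{1/4}$.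
   Formalization: In (i) and (ii) the extra assumption ω+ω′≠0 is made: for ω′=−ω≠0 the integrals are ± the nonzero norm rather than 0, and for ω=ω′=0 integral (ii) is 0 and (i) is twice the stated value, so the printed formulas fail there. *)

(* Defs.v *)
From Stdlib Require Import Reals ClassicalEpsilon.
From Coquelicot Require Import Coquelicot.

Open Scope C_scope.

(* Limit of a complex sequence, taken componentwise; unspecified if the
   sequence diverges. *)
Definition Clim_seq (u : nat -> C) : C :=
  (real (Lim_seq (fun n => Re (u n))), real (Lim_seq (fun n => Im (u n)))).

Fixpoint qpoch (a q : C) (n : nat) : C :=
  match n with
  | O => 1
  | S m => qpoch a q m * (1 - a * q ^ m)
  end.

Definition qpoch_inf (a q : C) : C := Clim_seq (qpoch a q).

Definition phi21 (a b c q t : C) : C :=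
  Clim_seq (sum_n (fun n : nat =>
    qpoch a q n * qpoch b q n / (qpoch q q n * qpoch c q n) * t ^ n)).

(* Entire functions, as sums of everywhere convergent power series. *)
Definition entire (g : C -> C) : Prop :=
  exists a : nat -> C, forall v : C, is_pseries a v (g v).

(* The entire function that agrees with f on the open unit disc; it is unique
   when it exists. *)
Definition entire_extension (f : C -> C) : C -> C :=
  epsilon (inhabits f)
    (fun g => entire g /\ forall v : C, (Cmod v < 1)%R -> g v = f v).

(* A value z = e^{i theta} with x = cos theta = (z + 1/z)/2.  It is determined
   by x up to z <-> 1/z, under which the definitions below are invariant. *)
Definition exp_itheta (x : C) : C :=
  epsilon (inhabits (RtoC 1)) (fun z => z <> 0 /\ x = (z + / z) / 2).

Definition cos_disc (q : R) (x w : C) : C :=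
  let z := exp_itheta x in
  qpoch_inf (- w ^ 2) (q ^ 2) / qpoch_inf (- (q * w ^ 2)) (q ^ 2)
  * phi21 (- (q * z ^ 2)) (- (q * (/ z) ^ 2)) q (q ^ 2) (- w ^ 2).

Definition sin_disc (q : R) (x w : C) : C :=
  let z := exp_itheta x in
  qpoch_inf (- w ^ 2) (q ^ 2) / qpoch_inf (- (q * w ^ 2)) (q ^ 2)
  * (2 * Rpower q (1 / 4) * w / (1 - q)) * x
  * phi21 (- (q ^ 2 * z ^ 2)) (- (q ^ 2 * (/ z) ^ 2)) (q ^ 3) (q ^ 2) (- w ^ 2).

(* The basic cosine C(x;w) and sine S(x;w), for all w: the functions above are
   the formulas for |w| < 1, and the continuation is meromorphic in w with
   possible poles at the zeros of (-q w^2; q^2)_oo. *)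
Definition basic_cos (q : R) (x w : C) : C :=
  entire_extension
    (fun v => qpoch_inf (- (q * v ^ 2)) (q ^ 2) * cos_disc q x v) w
  / qpoch_inf (- (q * w ^ 2)) (q ^ 2).

Definition basic_sin (q : R) (x w : C) : C :=
  entire_extension
    (fun v => qpoch_inf (- (q * v ^ 2)) (q ^ 2) * sin_disc q x v) w
  / qpoch_inf (- (q * w ^ 2)) (q ^ 2).

Definition eta (q : R) : R := ((Rpower q (1 / 4) + Rpower q (- (1 / 4))) / 2)%R.

(* S(eta;w) = 0.  The first conjunct says that w is not a pole: there the total
   division makes basic_sin take the value 0. *)
Definition boundary_condition (q : R) (w : C) : Prop :=
  qpoch_inf (- (q * w ^ 2)) (q ^ 2) <> 0 /\ basic_sin q (eta q) w = 0.

Definition expi (t : R) : C := (cos t, sin t).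

Definition weight (q t : R) : C :=
  qpoch_inf (expi (2 * t)) q * qpoch_inf (expi (- (2 * t))) q
  / (qpoch_inf (Rpower q (1 / 2) * expi (2 * t)) q
     * qpoch_inf (Rpower q (1 / 2) * expi (- (2 * t))) q).

Definition norm_sq (q : R) (w : C) : C :=
  PI * (qpoch_inf (Rpower q (1 / 2)) q ^ 2 / qpoch_inf q q ^ 2)
  * basic_cos q (eta q) w * C_derive (basic_sin q (eta q)) w.

(* f is Riemann integrable over [0, pi], with integral l. *)
Definition is_integral_0_pi (f : R -> C) (l : C) : Prop :=
  @is_RInt C_R_NormedModule f 0%R PI l.

(* Main.v *)
Require Import Defs.
From Stdlib Require Import Reals ZArith Classical ClassicalEpsilon Lra Lia.
From Coquelicot Require Import Coquelicot.

Open Scope C_scope.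

(** Write z = e^(i theta), and let h_n = H_n(x|q) / (q;q)_n be the normalised
    continuous q-Hermite polynomials.  Multiplied by (-q v^2; q^2)_oo, the functions
    C(x;v) and S(x;v) become the entire series
      sum_n (-1)^n q^(n^2) h_(2n)(x) v^(2n)   and
      sum_n (-1)^n q^(n^2 + n + 1/4) h_(2n+1)(x) v^(2n+1)
    ([phi21_expansion], [basic_cos_series], [basic_sin_series]).  The difference
    f(q^(1/2) z) - f(q^(-1/2) z) sends h_n to q^(-n/2) (1/z - z) h_(n-1)
    ([herm_shift_diff]), so it exchanges the two series up to a factor
    - or + v q^(-1/4) (1/z - z).

    The weight is (z - 1/z) u(z), where u(z) = z^(-1) (z^2, q/z^2; q)_oo /
    (q^(1/2) z^2, q^(1/2)/z^2; q)_oo is invariant under z -> q^(1/2) z and has its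
    poles at z = +- q^(1/4 + k/2).  On the unit circle this invariance says that the
    Fourier coefficient of u at an odd index s is a constant over
    q^(s/4) - q^(-s/4) ([integral_wU]); it is proved from the q-binomial series of
    the two factors of u.  Since the denominator is the one that the difference
    operator produces, there is an integration by parts whose boundary term
    is evaluated at z = q^(1/4), that is at x = eta ([q_integration_by_parts]).
    Applied to the partial sums of the two series it gives in the limit, for the
    entire functions C_v and S_v,
      v' <C_v, C_v'> - v <S_v, S_v'> = 2 pi k C_v(eta) S_v'(eta),
      k = (q^(1/2);q)_oo^2 / (q;q)_oo^2
    ([inner_identity]).  If S_w(eta) = S_w'(eta) = 0, this identity and the one
    with w and w' exchanged are a homogeneous linear system of determinant
    +- (w^2 - w'^2) ([inner_orthogonal]).  If only S_w(eta) = 0, they give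
    (u^2 - w^2) <C_w, C_u> = 2 pi k u C_w(eta) S_u(eta), and division by u - w
    and u -> w yield the norm ([norm_sq_inner]).  The mixed integrals vanish because
    C is even and S is odd in x.

    Throughout, r = q^(1/4). *)

(** * Complex sequences and series *)

Lemma is_lim_seq_eq (u : nat -> R) (x y : R) : is_lim_seq u x -> x = y -> is_lim_seq u y.
Proof. now intros H <-. Qed.

Definition clim (u : nat -> C) (l : C) : Prop :=
  is_lim_seq (fun n => Cmod (u n - l)) 0%R.

Lemma clim_squeeze (u : nat -> C) (l : C) (e : nat -> R) :
  (forall n, Cmod (u n - l) <= e n)%R -> is_lim_seq e 0%R -> clim u l.
Proof.
  intros H He. unfold clim.
  apply (is_lim_seq_le_le (fun _ => 0%R) _ e); [ | apply is_lim_seq_const | exact He].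
  intros n; split; [apply Cmod_ge_0 | apply H].
Qed.

Lemma clim_ext (u v : nat -> C) (l : C) :
  (forall n, u n = v n) -> clim u l -> clim v l.
Proof.
  intros H Hu. apply (is_lim_seq_ext (fun n => Cmod (u n - l))); [ | exact Hu].
  intros n; now rewrite H.
Qed.

Lemma clim_const (l : C) : clim (fun _ => l) l.
Proof.
  apply (is_lim_seq_ext (fun _ => 0%R)); [ | apply is_lim_seq_const].
  intros n. replace (l - l) with (RtoC 0) by ring. now rewrite Cmod_0.
Qed.

Lemma clim_plus (u v : nat -> C) (l m : C) :
  clim u l -> clim v m -> clim (fun n => u n + v n) (l + m).
Proof.
  intros Hu Hv.
  apply (clim_squeeze _ _ (fun n => Cmod (u n - l) + Cmod (v n - m))%R).
  - intros n. replace (u n + v n - (l + m)) with ((u n - l) + (v n - m)) by ring.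
    apply Cmod_triangle.
  - eapply is_lim_seq_eq; [apply is_lim_seq_plus'; eassumption | ring].
Qed.

Lemma clim_Cmod (u : nat -> C) (l : C) :
  clim u l -> is_lim_seq (fun n => Cmod (u n)) (Cmod l).
Proof.
  intros Hu.
  apply (is_lim_seq_le_le (fun n => Cmod l - Cmod (u n - l))%R _
           (fun n => Cmod l + Cmod (u n - l))%R).
  - intros n. split.
    + assert (H := Cmod_triangle (u n) (- (u n - l))).
      rewrite Cmod_opp in H. replace (u n + - (u n - l)) with l in H by ring. lra.
    + assert (H := Cmod_triangle l (u n - l)).
      replace (l + (u n - l)) with (u n) in H by ring. lra.
  - eapply is_lim_seq_eq.
    + apply is_lim_seq_minus'; [apply is_lim_seq_const | exact Hu].
    + ring.
  - eapply is_lim_seq_eq.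
    + apply is_lim_seq_plus'; [apply is_lim_seq_const | exact Hu].
    + ring.
Qed.

Lemma clim_bound (u : nat -> C) (l : C) (M : R) :
  clim u l -> (forall n, Cmod (u n) <= M)%R -> (Cmod l <= M)%R.
Proof.
  intros Hu H.
  assert (L := is_lim_seq_le _ (fun _ => M) (Cmod l) M H (clim_Cmod _ _ Hu) (is_lim_seq_const M)).
  exact L.
Qed.

Lemma clim_mult (u v : nat -> C) (l m : C) :
  clim u l -> clim v m -> clim (fun n => u n * v n) (l * m).
Proof.
  intros Hu Hv.
  apply (clim_squeeze _ _
           (fun n => Cmod (u n) * Cmod (v n - m) + Cmod (u n - l) * Cmod m)%R).
  - intros n.
    replace (u n * v n - l * m) with (u n * (v n - m) + (u n - l) * m) by ring.
    rewrite <- !Cmod_mult. apply Cmod_triangle.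
  - apply (is_lim_seq_eq _ (Cmod l * 0 + 0 * Cmod m)%R); [ | ring].
    apply is_lim_seq_plus'; apply is_lim_seq_mult';
      try exact Hu; try exact Hv; try apply is_lim_seq_const.
    now apply clim_Cmod.
Qed.

Lemma clim_scal (c : C) (u : nat -> C) (l : C) :
  clim u l -> clim (fun n => c * u n) (c * l).
Proof. intros Hu. apply clim_mult; [apply clim_const | exact Hu]. Qed.

Lemma clim_minus (u v : nat -> C) (l m : C) :
  clim u l -> clim v m -> clim (fun n => u n - v n) (l - m).
Proof.
  intros Hu Hv.
  apply (clim_ext (fun n => u n + (-(1)) * v n)); [intros; ring | ].
  replace (l - m) with (l + (-(1)) * m) by ring.
  apply clim_plus; [exact Hu | now apply clim_scal].
Qed.

Lemma clim_unique (u : nat -> C) (l m : C) : clim u l -> clim u m -> l = m.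
Proof.
  intros Hl Hm.
  assert (H := clim_minus _ _ _ _ Hl Hm).
  assert (B : (Cmod (l - m) <= 0)%R).
  { apply (clim_bound _ _ _ H). intros n.
    replace (u n - u n) with (RtoC 0) by ring. rewrite Cmod_0. lra. }
  assert (E : l - m = 0) by (apply Cmod_eq_0; generalize (Cmod_ge_0 (l - m)); lra).
  replace l with ((l - m) + m) by ring. rewrite E. ring.
Qed.

Lemma clim_incr_1 (u : nat -> C) (l : C) : clim u l <-> clim (fun n => u (S n)) l.
Proof. apply (is_lim_seq_incr_1 (fun n => Cmod (u n - l))). Qed.

Lemma clim_subseq (u : nat -> C) (l : C) (phi : nat -> nat) :
  (forall n, (n <= phi n)%nat) -> clim u l -> clim (fun n => u (phi n)) l.
Proof.
  intros H Hu. apply (is_lim_seq_subseq (fun n => Cmod (u n - l)) 0 phi); [ | exact Hu].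
  intros P [N HN]. exists N. intros n Hn. apply HN. specialize (H n). lia.
Qed.

Lemma clim_components (u : nat -> C) (l : C) :
  (is_lim_seq (fun n => Re (u n)) (Re l) /\ is_lim_seq (fun n => Im (u n)) (Im l))
  <-> clim u l.
Proof.
  split.
  - intros [H1 H2].
    apply (clim_squeeze _ _
      (fun n => Rabs (Re (u n) - Re l) + Rabs (Im (u n) - Im l))%R).
    + intros n.
      replace (u n - l) with
        (RtoC (Re (u n) - Re l) + Ci * RtoC (Im (u n) - Im l)).
      2:{ destruct (u n), l. unfold Re, Im. simpl.
          apply injective_projections; simpl; ring. }
      eapply Rle_trans; [apply Cmod_triangle | ].
      rewrite Cmod_mult, Cmod_Ci, !Cmod_R. lra.
    + apply (is_lim_seq_eq _ (Rabs (Re l - Re l) + Rabs (Im l - Im l))%R);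
        [ | rewrite !Rminus_diag, Rabs_R0; ring].
      apply is_lim_seq_plus'.
      * apply (is_lim_seq_abs (fun n => Re (u n) - Re l)%R (Re l - Re l)%R).
        apply is_lim_seq_minus'; [exact H1 | apply is_lim_seq_const].
      * apply (is_lim_seq_abs (fun n => Im (u n) - Im l)%R (Im l - Im l)%R).
        apply is_lim_seq_minus'; [exact H2 | apply is_lim_seq_const].
  - intros H.
    assert (A : forall x : nat -> R, forall y : R,
               (forall n, Rabs (x n - y) <= Cmod (u n - l))%R -> is_lim_seq x y).
    { intros x y Hx.
      apply (is_lim_seq_ext (fun n => (x n - y) + y)%R); [intros; ring | ].
      apply (is_lim_seq_eq _ (0 + y)%R); [ | ring].
      apply is_lim_seq_plus'; [ | apply is_lim_seq_const].
      apply is_lim_seq_abs_0.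
      apply (is_lim_seq_le_le (fun _ => 0%R) _ (fun n => Cmod (u n - l)));
        [ | apply is_lim_seq_const | exact H].
      intros n; split; [apply Rabs_pos | apply Hx]. }
    split; apply A; intros n; (eapply Rle_trans; [ | apply Rmax_Cmod]);
      destruct (u n), l; simpl; [apply Rmax_l | apply Rmax_r].
Qed.

Lemma clim_Clim_seq (u : nat -> C) (l : C) : clim u l -> Clim_seq u = l.
Proof.
  intros H. apply clim_components in H. destruct H as [H1 H2].
  unfold Clim_seq. rewrite (is_lim_seq_unique _ _ H1), (is_lim_seq_unique _ _ H2).
  now destruct l.
Qed.

(** The sum starts empty, so that telescoping identities have no
    separate first term. *)
Fixpoint csum (a : nat -> C) (n : nat) : C :=
  match n with
  | O => 0
  | S m => csum a m + a m
  end.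

Definition has_sum (a : nat -> C) (l : C) : Prop := clim (csum a) l.

Lemma csum_ext (a b : nat -> C) (n : nat) :
  (forall k, (k < n)%nat -> a k = b k) -> csum a n = csum b n.
Proof.
  induction n; intros H; simpl; [reflexivity | ].
  rewrite IHn, H; [reflexivity | lia | intros; apply H; lia].
Qed.

Lemma csum_plus (a b : nat -> C) (n : nat) :
  csum (fun k => a k + b k) n = csum a n + csum b n.
Proof. induction n; simpl; [ring | rewrite IHn; ring]. Qed.

Lemma csum_scal (c : C) (a : nat -> C) (n : nat) :
  csum (fun k => c * a k) n = c * csum a n.
Proof. induction n; simpl; [ring | rewrite IHn; ring]. Qed.

Lemma csum_first (a : nat -> C) (n : nat) :
  csum a (S n) = a O + csum (fun k => a (S k)) n.
Proof. induction n; [simpl; ring | simpl in *; rewrite IHn; ring]. Qed.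

Lemma csum_add (a : nat -> C) (n m : nat) :
  csum a (n + m) = csum a n + csum (fun k => a (n + k)%nat) m.
Proof.
  induction m; [rewrite Nat.add_0_r; simpl; ring | ].
  rewrite Nat.add_succ_r. simpl. rewrite IHm. ring.
Qed.

Lemma sum_n_csum (a : nat -> C) (n : nat) : sum_n a n = csum a (S n).
Proof.
  induction n; [rewrite sum_O; simpl; ring | ].
  rewrite sum_Sn, IHn. reflexivity.
Qed.

Lemma has_sum_Clim_seq (a : nat -> C) (l : C) :
  has_sum a l -> Clim_seq (sum_n a) = l.
Proof.
  intros H. apply clim_Clim_seq. apply clim_incr_1 in H.
  refine (clim_ext _ _ _ _ H). intros n; now rewrite sum_n_csum.
Qed.

Lemma has_sum_ext (a b : nat -> C) (l : C) :
  (forall n, a n = b n) -> has_sum a l -> has_sum b l.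
Proof. intros H. apply clim_ext. intros n. apply csum_ext. intros; apply H. Qed.

Lemma has_sum_scal (c : C) (a : nat -> C) (l : C) :
  has_sum a l -> has_sum (fun n => c * a n) (c * l).
Proof.
  intros H. apply (clim_ext (fun n => c * csum a n)); [intros; now rewrite csum_scal | ].
  now apply clim_scal.
Qed.

Lemma has_sum_plus (a b : nat -> C) (l m : C) :
  has_sum a l -> has_sum b m -> has_sum (fun n => a n + b n) (l + m).
Proof.
  intros Ha Hb.
  apply (clim_ext (fun n => csum a n + csum b n)); [intros; now rewrite csum_plus | ].
  now apply clim_plus.
Qed.

Lemma has_sum_unique (a : nat -> C) (l m : C) : has_sum a l -> has_sum a m -> l = m.
Proof. apply clim_unique. Qed.

Lemma is_lim_seq_Cmod_filterlim (u : nat -> C) (l : C) :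
  filterlim u eventually (@locally C_UniformSpace l) <-> clim u l.
Proof.
  split; intros H.
  - apply clim_components. split.
    + apply (filterlim_comp _ _ _ u (fun z : C => fst z) eventually (@locally C_UniformSpace l)); [exact H | ].
      intros P [e He]. exists e. intros y Hy. apply He. apply Hy.
    + apply (filterlim_comp _ _ _ u (fun z : C => snd z) eventually (@locally C_UniformSpace l)); [exact H | ].
      intros P [e He]. exists e. intros y Hy. apply He. apply Hy.
  - apply clim_components in H. destruct H as [H1 H2].
    apply filterlim_locally. intros e.
    apply (filterlim_locally (fun n => Re (u n)) (Re l)) with (eps := e) in H1.
    apply (filterlim_locally (fun n => Im (u n)) (Im l)) with (eps := e) in H2.
    generalize (filter_and _ _ H1 H2). apply filter_imp.
    intros n [A B]. split; assumption.
Qed.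

Lemma is_series_has_sum (a : nat -> C) (l : C) :
  @is_series C_AbsRing C_NormedModule a l <-> has_sum a l.
Proof.
  unfold is_series, has_sum. rewrite clim_incr_1.
  etransitivity; [apply is_lim_seq_Cmod_filterlim | ].
  split; apply clim_ext; intros n; now rewrite sum_n_csum.
Qed.

(** * Domination *)

Definition tail (M : nat -> R) (N : nat) : R := Series (fun k => M (N + k)%nat).

Lemma ex_series_shift (M : nat -> R) (N : nat) :
  ex_series M -> ex_series (fun k => M (N + k)%nat).
Proof. intros H. now apply ex_series_incr_n. Qed.

Lemma tail_split (M : nat -> R) (N n : nat) :
  ex_series M -> (0 < n)%nat ->
  tail M N = (sum_n (fun k => M (N + k)%nat) (pred n) + tail M (N + n))%R.
Proof.
  intros H Hn. unfold tail.
  rewrite (Series_incr_n (fun k => M (N + k)%nat) n Hn); [ | now apply ex_series_shift].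
  rewrite sum_n_Reals. f_equal.
  apply Series_ext. intros k. f_equal. lia.
Qed.

Lemma tail_lim (M : nat -> R) : ex_series M -> is_lim_seq (tail M) 0%R.
Proof.
  intros H. apply is_lim_seq_incr_1.
  apply (is_lim_seq_ext (fun n => Series M - sum_n M n)%R).
  - intros n. unfold tail.
    rewrite (Series_incr_n M (S n) ltac:(lia) H). simpl. rewrite sum_n_Reals. ring.
  - apply (is_lim_seq_eq _ (Series M - Series M)%R); [ | ring].
    apply is_lim_seq_minus'; [apply is_lim_seq_const | ].
    apply Series_correct in H. exact H.
Qed.

Lemma csum_le_tail (a : nat -> C) (M : nat -> R) (N n : nat) :
  (forall k, Cmod (a k) <= M k)%R -> ex_series M ->
  (Cmod (csum (fun k => a (N + k)%nat) n) <= tail M N - tail M (N + n))%R.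
Proof.
  intros Ha HM. induction n.
  - simpl. rewrite Nat.add_0_r, Cmod_0. lra.
  - simpl. eapply Rle_trans; [apply Cmod_triangle | ].
    assert (E : tail M (N + n) = (M (N + n)%nat + tail M (N + S n))%R).
    { rewrite (tail_split M (N + n) 1 HM ltac:(lia)). simpl pred. rewrite sum_O.
      rewrite Nat.add_0_r. replace (N + n + 1)%nat with (N + S n)%nat by lia. reflexivity. }
    specialize (Ha (N + n)%nat). lra.
Qed.

(** The error of a partial sum is at most the tail of a dominating series, which
    makes domination independent of a parameter a form of uniform convergence. *)
Lemma has_sum_tail (a : nat -> C) (M : nat -> R) (l : C) (N : nat) :
  has_sum a l -> (forall k, Cmod (a k) <= M k)%R -> ex_series M ->
  (Cmod (csum a N - l) <= tail M N)%R.
Proof.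
  intros H Ha HM.
  assert (M0 : forall k, (0 <= M k)%R)
    by (intros k; eapply Rle_trans; [apply Cmod_ge_0 | apply Ha]).
  assert (T0 : forall k, (0 <= tail M k)%R).
  { intros k. unfold tail. replace 0%R with (Series (fun _ => 0%R)).
    - apply Series_le; [intros; split; [lra | apply M0] | now apply ex_series_shift].
    - rewrite (Series_ext _ (fun _ => (0 * 0)%R)); [ | intros; ring].
      rewrite Series_scal_l. ring. }
  replace (csum a N - l) with (- (l - csum a N)) by ring. rewrite Cmod_opp.
  apply (clim_bound (fun n => csum a (N + n) - csum a N)).
  - apply clim_minus; [ | apply clim_const].
    apply (clim_subseq (csum a) l (fun n => (N + n)%nat)); [intros; lia | exact H].
  - intros n. rewrite csum_add.
    replace (csum a N + csum (fun k => a (N + k)%nat) n - csum a N)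
      with (csum (fun k => a (N + k)%nat) n) by ring.
    generalize (csum_le_tail a M N n Ha HM) (T0 (N + n)%nat). lra.
Qed.

Lemma has_sum_bound (a : nat -> C) (M : nat -> R) (l : C) :
  has_sum a l -> (forall k, Cmod (a k) <= M k)%R -> ex_series M ->
  (Cmod l <= Series M)%R.
Proof.
  intros H Ha HM. generalize (has_sum_tail a M l 0 H Ha HM). simpl.
  replace (0 - l) with (- l) by ring. now rewrite Cmod_opp.
Qed.

Lemma ex_has_sum (a : nat -> C) (M : nat -> R) :
  (forall k, Cmod (a k) <= M k)%R -> ex_series M -> exists l, has_sum a l.
Proof.
  intros Ha HM.
  destruct (@ex_series_le C_AbsRing C_CompleteNormedModule a M Ha HM) as [l Hl].
  exists l. now apply is_series_has_sum.
Qed.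

Lemma ex_series_geom_scal (c x : R) :
  (0 <= x < 1)%R -> ex_series (fun n => c * x ^ n)%R.
Proof.
  intros H. apply (ex_series_scal c (fun n => x ^ n)%R). exists (/ (1 - x))%R.
  apply is_series_geom. rewrite Rabs_pos_eq; lra.
Qed.

Lemma Series_geom_scal (c x : R) :
  (0 <= x < 1)%R -> Series (fun n => c * x ^ n)%R = (c / (1 - x))%R.
Proof.
  intros H. rewrite Series_scal_l, Series_geom; [reflexivity | ].
  rewrite Rabs_pos_eq; lra.
Qed.

(** * Infinite q-shifted factorials *)

Lemma pow_lim_0 (q : R) : (0 < q < 1)%R -> is_lim_seq (fun n => q ^ n)%R 0%R.
Proof. intros H. apply is_lim_seq_geom. rewrite Rabs_pos_eq; lra. Qed.

Lemma pow_in_01 (q : R) (n : nat) : (0 < q < 1)%R -> (0 < q ^ n <= 1)%R.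
Proof.
  intros H. split; [apply pow_lt; lra | ].
  rewrite <- (pow1 n). apply pow_incr. lra.
Qed.

Lemma Cmod_one_minus (a : C) (x : R) :
  (0 <= x)%R -> (Cmod (1 - a * x) <= 1 + Cmod a * x)%R.
Proof.
  intros H. eapply Rle_trans; [apply (Cmod_triangle 1 (- (a * x))) | ].
  rewrite Cmod_opp, Cmod_mult, Cmod_1, Cmod_R, (Rabs_pos_eq x H). lra.
Qed.

Lemma qpoch_growth (q A : R) (a : C) (n : nat) :
  (0 < q < 1)%R -> (Cmod a <= A)%R ->
  (Cmod (qpoch a q n) <= exp (A * ((1 - q ^ n) / (1 - q))))%R.
Proof.
  intros Hq Ha. induction n.
  - simpl. rewrite Cmod_1. replace (A * ((1 - 1) / (1 - q)))%R with 0%R by (field; lra).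
    rewrite exp_0. lra.
  - simpl qpoch. rewrite Cmod_mult.
    replace (A * ((1 - q ^ S n) / (1 - q)))%R
      with (A * ((1 - q ^ n) / (1 - q)) + A * q ^ n)%R by (simpl; field; lra).
    rewrite exp_plus. apply Rmult_le_compat; try apply Cmod_ge_0; [exact IHn | ].
    destruct (pow_in_01 q n Hq) as [P _].
    rewrite <- RtoC_pow. eapply Rle_trans; [apply Cmod_one_minus; lra | ].
    eapply Rle_trans; [ | apply exp_ineq1_le].
    apply Rplus_le_compat_l. apply Rmult_le_compat_r; lra.
Qed.

Lemma qpoch_growth_inf (q A : R) (n : nat) :
  (0 < q < 1)%R -> (0 <= A)%R ->
  (exp (A * ((1 - q ^ n) / (1 - q))) <= exp (A / (1 - q)))%R.
Proof.
  intros Hq HA. destruct (pow_in_01 q n Hq) as [P _].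
  assert (A * ((1 - q ^ n) / (1 - q)) <= A / (1 - q))%R.
  { unfold Rdiv. apply Rmult_le_compat_l; [exact HA | ].
    rewrite <- (Rmult_1_l (/ (1 - q))) at 2.
    apply Rmult_le_compat_r; [ | lra]. left. apply Rinv_0_lt_compat. lra. }
  destruct H as [H | H]; [left; now apply exp_increasing | rewrite H; lra].
Qed.

Lemma qpoch_bound (q A : R) (a : C) (n : nat) :
  (0 < q < 1)%R -> (Cmod a <= A)%R -> (Cmod (qpoch a q n) <= exp (A / (1 - q)))%R.
Proof.
  intros Hq Ha. eapply Rle_trans; [exact (qpoch_growth q A a n Hq Ha) | ].
  apply qpoch_growth_inf; [exact Hq | ]. generalize (Cmod_ge_0 a); lra.
Qed.

(** The differences of consecutive partial products are dominated by a geometric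
    series. *)
Lemma qpoch_inf_lim (q : R) (a : C) :
  (0 < q < 1)%R -> clim (qpoch a q) (qpoch_inf a q).
Proof.
  intros Hq.
  destruct (ex_has_sum (fun k => qpoch a q k * (- a * q ^ k))
              (fun k => (exp (Cmod a / (1 - q)) * Cmod a) * q ^ k)%R) as [l Hl].
  - intros k. rewrite Cmod_mult, Cmod_mult, Cmod_opp, <- RtoC_pow, Cmod_R, Rabs_pos_eq.
    2: left; apply pow_lt; lra.
    rewrite Rmult_assoc. apply Rmult_le_compat_r.
    + apply Rmult_le_pos; [apply Cmod_ge_0 | left; apply pow_lt; lra].
    + apply qpoch_bound; [exact Hq | lra].
  - apply ex_series_geom_scal; lra.
  - assert (H : clim (qpoch a q) (1 + l)).
    { apply (clim_ext (fun n => 1 + csum (fun k => qpoch a q k * (- a * q ^ k)) n)).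
      - intros n. induction n; simpl; [ring | ]. rewrite <- IHn. ring.
      - apply clim_plus; [apply clim_const | exact Hl]. }
    unfold qpoch_inf. now rewrite (clim_Clim_seq _ _ H).
Qed.

(** Changing one factor at a time: each replacement costs at most
    |a - b| q^k times a bound on the other factors. *)
Lemma qpoch_inf_lipschitz (q A : R) (a b : C) :
  (0 < q < 1)%R -> (Cmod a <= A)%R -> (Cmod b <= A)%R ->
  (Cmod (qpoch_inf a q - qpoch_inf b q)
     <= exp (A / (1 - q)) / (1 - q) * Cmod (a - b))%R.
Proof.
  intros Hq Ha Hb.
  assert (A0 : (0 <= A)%R) by (generalize (Cmod_ge_0 a); lra).
  apply (clim_bound (fun n => qpoch a q n - qpoch b q n)).
  { apply clim_minus; now apply qpoch_inf_lim. }
  intros n.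
  apply Rle_trans with
    (exp (A * ((1 - q ^ n) / (1 - q))) * ((1 - q ^ n) / (1 - q)) * Cmod (a - b))%R.
  - induction n.
    + simpl. replace (1 - 1) with (RtoC 0) by ring. rewrite Cmod_0.
      right. field. lra.
    + simpl qpoch.
      replace (qpoch a q n * (1 - a * q ^ n) - qpoch b q n * (1 - b * q ^ n)) with
        ((qpoch a q n - qpoch b q n) * (1 - a * q ^ n)
         + qpoch b q n * ((b - a) * q ^ n)) by ring.
      eapply Rle_trans; [apply Cmod_triangle | ].
      destruct (pow_in_01 q n Hq) as [P P1].
      rewrite !Cmod_mult, <- !RtoC_pow, Cmod_R, (Rabs_pos_eq (q ^ n)) by lra.
      replace (b - a) with (- (a - b)) by ring. rewrite Cmod_opp.
      set (d := Cmod (a - b)) in *. assert (D : (0 <= d)%R) by apply Cmod_ge_0.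
      set (x := (A * ((1 - q ^ n) / (1 - q)))%R) in *.
      replace (A * ((1 - q ^ S n) / (1 - q)))%R with (x + A * q ^ n)%R
        by (unfold x; simpl; field; lra).
      replace ((1 - q ^ S n) / (1 - q))%R with ((1 - q ^ n) / (1 - q) + q ^ n)%R
        by (simpl; field; lra).
      set (s := ((1 - q ^ n) / (1 - q))%R) in *.
      assert (S0 : (0 <= s)%R).
      { apply Rmult_le_pos; [lra | left; apply Rinv_0_lt_compat; lra]. }
      rewrite exp_plus.
      assert (E1 : (Cmod (1 - a * (q ^ n)%R) <= exp (A * q ^ n))%R).
      { eapply Rle_trans; [apply Cmod_one_minus; lra | ].
        eapply Rle_trans; [ | apply exp_ineq1_le].
        apply Rplus_le_compat_l, Rmult_le_compat_r; lra. }
      assert (E2 : (Cmod (qpoch b q n) <= exp x)%R) by (apply qpoch_growth; assumption).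
      assert (X : (0 < exp x)%R) by apply exp_pos.
      assert (E3 : (1 <= exp (A * q ^ n))%R).
      { rewrite <- exp_0. assert (0 <= A * q ^ n)%R by (apply Rmult_le_pos; lra).
        destruct H as [H | H]; [left; now apply exp_increasing | rewrite <- H; lra]. }
      set (y := exp (A * q ^ n)) in *.
      replace (exp x * y * (s + q ^ n) * d)%R
        with (exp x * s * d * y + exp x * (d * q ^ n) * y)%R by ring.
      apply Rplus_le_compat.
      * apply Rmult_le_compat; try apply Cmod_ge_0; assumption.
      * apply Rle_trans with (exp x * (d * q ^ n))%R.
        -- apply Rmult_le_compat_r; [apply Rmult_le_pos; lra | exact E2].
        -- rewrite <- (Rmult_1_r (exp x * (d * q ^ n))) at 1.
           apply Rmult_le_compat_l; [ | exact E3].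
           apply Rmult_le_pos; [lra | apply Rmult_le_pos; lra].
  - apply Rmult_le_compat_r; [apply Cmod_ge_0 | ].
    unfold Rdiv at 3. destruct (pow_in_01 q n Hq) as [P P1].
    assert (I : (0 < / (1 - q))%R) by (apply Rinv_0_lt_compat; lra).
    apply Rmult_le_compat; [left; apply exp_pos | | now apply qpoch_growth_inf | ].
    + apply Rmult_le_pos; lra.
    + unfold Rdiv. rewrite <- (Rmult_1_l (/ (1 - q))) at 2. apply Rmult_le_compat_r; lra.
Qed.

Lemma qpoch_shift (a q : C) (n : nat) :
  qpoch a q (S n) = (1 - a) * qpoch (a * q) q n.
Proof.
  induction n; [simpl; ring | ].
  change (qpoch a q (S (S n))) with (qpoch a q (S n) * (1 - a * q ^ S n)).
  rewrite IHn. simpl. ring.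
Qed.

Lemma qpoch_inf_shift (q : R) (a : C) :
  (0 < q < 1)%R -> qpoch_inf a q = (1 - a) * qpoch_inf (a * q) q.
Proof.
  intros Hq. apply (clim_unique (fun n => qpoch a q (S n))).
  - apply -> clim_incr_1. now apply qpoch_inf_lim.
  - apply (clim_ext (fun n => (1 - a) * qpoch (a * q) q n));
      [intros; now rewrite qpoch_shift | ].
    apply clim_scal. now apply qpoch_inf_lim.
Qed.

Lemma qpoch_inf_split (q : R) (a : C) (n : nat) :
  (0 < q < 1)%R -> qpoch_inf a q = qpoch a q n * qpoch_inf (a * q ^ n) q.
Proof.
  intros Hq. induction n.
  - simpl. now rewrite Cmult_1_l, Cmult_1_r.
  - rewrite IHn, (qpoch_inf_shift q (a * q ^ n) Hq). simpl.
    replace (a * q ^ n * q) with (a * (q * q ^ n)) by ring. ring.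
Qed.

Lemma qpoch_0 (q : C) (n : nat) : qpoch 0 q n = 1.
Proof. induction n; simpl; [reflexivity | rewrite IHn; ring]. Qed.

Lemma qpoch_inf_0 (q : R) : (0 < q < 1)%R -> qpoch_inf 0 q = 1.
Proof.
  intros Hq. apply (clim_unique (qpoch 0 q)); [now apply qpoch_inf_lim | ].
  apply (clim_ext (fun _ => 1)); [intros; now rewrite qpoch_0 | apply clim_const].
Qed.

Lemma qpoch_neq_0 (a q : C) (n : nat) :
  (forall k, a * q ^ k <> 1) -> qpoch a q n <> 0.
Proof.
  intros H. induction n; simpl.
  - intros E. apply (f_equal fst) in E. simpl in E. lra.
  - apply Cmult_neq_0; [exact IHn | ]. intros E. apply (H n).
    replace (a * q ^ n) with (1 - (1 - a * q ^ n)) by ring. rewrite E. ring.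
Qed.

(** Near a = 0 the product is close to 1; moving finitely many factors out
    reduces every other point to this case. *)
Lemma qpoch_inf_neq_0 (q : R) (a : C) :
  (0 < q < 1)%R -> (forall k, a * q ^ k <> 1) -> qpoch_inf a q <> 0.
Proof.
  intros Hq H.
  set (K := (exp (Cmod a / (1 - q)) / (1 - q) * Cmod a)%R).
  assert (L : is_lim_seq (fun n => K * q ^ n)%R 0%R).
  { apply (is_lim_seq_eq _ (K * 0)%R); [ | ring].
    apply is_lim_seq_mult'; [apply is_lim_seq_const | now apply pow_lim_0]. }
  destruct (proj1 (filterlim_locally _ 0%R) L (mkposreal 1 Rlt_0_1)) as [n Hn].
  specialize (Hn n (Nat.le_refl n)).
  destruct (pow_in_01 q n Hq) as [P P1].
  rewrite (qpoch_inf_split q a n Hq). apply Cmult_neq_0; [now apply qpoch_neq_0 | ].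
  intros E.
  assert (B := qpoch_inf_lipschitz q (Cmod a) (a * q ^ n) 0 Hq).
  rewrite E, (qpoch_inf_0 q Hq) in B.
  replace (0 - 1) with (- (1)) in B by ring.
  replace (a * q ^ n - 0) with (a * q ^ n) in B by ring.
  rewrite Cmod_opp, Cmod_1, Cmod_0, Cmod_mult, <- RtoC_pow, Cmod_R, Rabs_pos_eq in B by lra.
  assert (B' : (1 <= K * q ^ n)%R).
  { unfold K. rewrite Rmult_assoc. apply B; [ | apply Cmod_ge_0].
    rewrite <- (Rmult_1_r (Cmod a)) at 2. apply Rmult_le_compat_l; [apply Cmod_ge_0 | lra]. }
  apply Rabs_def2 in Hn. unfold minus, plus, opp in Hn. simpl in Hn. lra.
Qed.

Lemma RtoC_neq (x y : R) : x <> y -> RtoC x <> RtoC y.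
Proof. intros H E. apply H. now apply (f_equal fst) in E. Qed.

Lemma Cmod_lt_1_neq (a : C) (q : R) (k : nat) :
  (0 < q < 1)%R -> (Cmod a < 1)%R -> a * q ^ k <> 1.
Proof.
  intros Hq Ha E. apply (f_equal Cmod) in E.
  destruct (pow_in_01 q k Hq) as [P P1].
  rewrite Cmod_mult, <- RtoC_pow, Cmod_R, Rabs_pos_eq, Cmod_1 in E by lra.
  assert (Cmod a * q ^ k <= Cmod a * 1)%R
    by (apply Rmult_le_compat_l; [apply Cmod_ge_0 | lra]). lra.
Qed.

Lemma qpoch_inf_disc_neq_0 (q : R) (a : C) :
  (0 < q < 1)%R -> (Cmod a < 1)%R -> qpoch_inf a q <> 0.
Proof.
  intros Hq Ha. apply qpoch_inf_neq_0; [exact Hq | ].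
  intros k. now apply Cmod_lt_1_neq.
Qed.

Lemma qpoch_disc_neq_0 (q : R) (a : C) (n : nat) :
  (0 < q < 1)%R -> (Cmod a < 1)%R -> qpoch a q n <> 0.
Proof.
  intros Hq Ha. apply qpoch_neq_0. intros k. now apply Cmod_lt_1_neq.
Qed.

(** The factors 1 - q^k are at most 1, so (q;q)_n decreases to its limit. *)
Lemma qpoch_qq_lower (q : R) (n : nat) :
  (0 < q < 1)%R -> (Cmod (qpoch_inf q q) <= Cmod (qpoch q q n))%R.
Proof.
  intros Hq.
  rewrite (qpoch_inf_split q q n Hq), Cmod_mult.
  rewrite <- (Rmult_1_r (Cmod (qpoch q q n))) at 2.
  apply Rmult_le_compat_l; [apply Cmod_ge_0 | ].
  apply (clim_bound (qpoch (q * q ^ n) q)); [now apply qpoch_inf_lim | ].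
  intros m. induction m; simpl; [rewrite Cmod_1; lra | ].
  rewrite Cmod_mult.
  destruct (pow_in_01 q n Hq), (pow_in_01 q m Hq).
  replace (1 - q * q ^ n * q ^ m) with (RtoC (1 - q * (q ^ n * q ^ m))).
  2:{ rewrite RtoC_minus, !RtoC_mult, !RtoC_pow. ring. }
  rewrite Cmod_R, Rabs_pos_eq.
  - assert (0 <= q * (q ^ n * q ^ m))%R by (repeat apply Rmult_le_pos; lra).
    generalize (Cmod_ge_0 (qpoch (q * q ^ n) q m)). nra.
  - assert (q ^ n * q ^ m <= 1 * 1)%R by (apply Rmult_le_compat; lra).
    assert (0 <= q ^ n * q ^ m)%R by (apply Rmult_le_pos; lra). nra.
Qed.

(** * The q-binomial theorem *)

Definition qbin (A : C) (q : R) (n : nat) : C := qpoch A q n / qpoch q q n.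

Lemma qpoch_qq_neq_0 (q : R) (n : nat) : (0 < q < 1)%R -> qpoch q q n <> 0.
Proof.
  intros Hq. apply qpoch_disc_neq_0; [exact Hq | ]. rewrite Cmod_R, Rabs_pos_eq; lra.
Qed.

Lemma qpoch_inf_qq_neq_0 (q : R) : (0 < q < 1)%R -> qpoch_inf q q <> 0.
Proof.
  intros Hq. apply qpoch_inf_disc_neq_0; [exact Hq | ]. rewrite Cmod_R, Rabs_pos_eq; lra.
Qed.

Lemma one_minus_pow_neq_0 (q : R) (n : nat) : (0 < q < 1)%R -> 1 - q * q ^ n <> 0.
Proof.
  intros Hq E.
  assert (H : RtoC q * q ^ n <> 1).
  { apply Cmod_lt_1_neq; [exact Hq | ]. rewrite Cmod_R, Rabs_pos_eq; lra. }
  apply H. replace (q * q ^ n) with (1 - (1 - q * q ^ n)) by ring. rewrite E. ring.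
Qed.

Lemma qbin_S (A : C) (q : R) (n : nat) :
  (0 < q < 1)%R -> qbin A q (S n) * (1 - q * q ^ n) = qbin A q n * (1 - A * q ^ n).
Proof.
  intros Hq. unfold qbin. simpl. field.
  split; [now apply qpoch_qq_neq_0 | now apply one_minus_pow_neq_0].
Qed.

Lemma qbin_0 (A : C) (q : R) : qbin A q 0 = 1.
Proof. unfold qbin. simpl. field. Qed.

Definition qbin_max (A : C) (q : R) : R :=
  (exp (Cmod A / (1 - q)) / Cmod (qpoch_inf q q))%R.

Lemma qbin_bound (A : C) (q : R) (n : nat) :
  (0 < q < 1)%R -> (Cmod (qbin A q n) <= qbin_max A q)%R.
Proof.
  intros Hq. unfold qbin, qbin_max.
  rewrite Cmod_div by now apply qpoch_qq_neq_0.
  assert (0 < Cmod (qpoch_inf q q))%R by (apply Cmod_gt_0; now apply qpoch_inf_qq_neq_0).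
  apply Rmult_le_compat.
  - apply Cmod_ge_0.
  - left. apply Rinv_0_lt_compat. eapply Rlt_le_trans; [eassumption | now apply qpoch_qq_lower].
  - apply qpoch_bound; [exact Hq | lra].
  - apply Rinv_le_contravar; [assumption | now apply qpoch_qq_lower].
Qed.

Lemma qbin_term_bound (A : C) (q : R) (x : C) (n : nat) :
  (0 < q < 1)%R -> (Cmod (qbin A q n * x ^ n) <= qbin_max A q * Cmod x ^ n)%R.
Proof.
  intros Hq. rewrite Cmod_mult, Cmod_pow.
  apply Rmult_le_compat_r; [apply pow_le, Cmod_ge_0 | now apply qbin_bound].
Qed.

Lemma qbin_max_pos (A : C) (q : R) : (0 < q < 1)%R -> (0 < qbin_max A q)%R.
Proof.
  intros Hq. apply Rdiv_lt_0_compat; [apply exp_pos | ].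
  apply Cmod_gt_0. now apply qpoch_inf_qq_neq_0.
Qed.

Lemma geom_bounded_lim (u : nat -> C) (M x : R) :
  (0 <= x < 1)%R -> (forall n, Cmod (u n) <= M * x ^ n)%R -> clim u 0.
Proof.
  intros Hx H. apply (clim_squeeze _ _ (fun n => M * x ^ n)%R).
  - intros n. replace (u n - 0) with (u n) by ring. apply H.
  - apply (is_lim_seq_eq _ (M * 0)%R); [ | ring].
    apply is_lim_seq_mult'; [apply is_lim_seq_const | ].
    apply is_lim_seq_geom. rewrite Rabs_pos_eq; lra.
Qed.

(** The sum F satisfies (1 - x) F(x) = (1 - A x) F(q x), as its partial sums do
    up to one boundary term; iterating and letting q^n x tend to 0 gives the
    product. *)
Lemma q_binomial (A : C) (q : R) (x : C) :
  (0 < q < 1)%R -> (Cmod x < 1)%R ->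
  has_sum (fun n => qbin A q n * x ^ n) (qpoch_inf (A * x) q / qpoch_inf x q).
Proof.
  intros Hq Hx.
  assert (conv : forall n, exists l, has_sum (fun k => qbin A q k * (x * q ^ n) ^ k) l).
  { intros n.
    apply (ex_has_sum _ (fun k => qbin_max A q * Cmod x ^ k)%R).
    - intros k. eapply Rle_trans; [now apply qbin_term_bound | ].
      apply Rmult_le_compat_l; [left; now apply qbin_max_pos | ].
      apply pow_incr. split; [apply Cmod_ge_0 | ].
      destruct (pow_in_01 q n Hq).
      rewrite Cmod_mult, <- RtoC_pow, Cmod_R, Rabs_pos_eq by lra.
      generalize (Cmod_ge_0 x). nra.
    - apply ex_series_geom_scal. split; [apply Cmod_ge_0 | exact Hx]. }
  assert (exF : exists F : nat -> C, forall n, has_sum (fun k => qbin A q k * (x * q ^ n) ^ k) (F n)).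
  { exists (fun n => proj1_sig (constructive_indefinite_description _ (conv n))).
    intros n. exact (proj2_sig (constructive_indefinite_description _ (conv n))). }
  destruct exF as [F HF].
  assert (step : forall n, (1 - x * q ^ n) * F n = (1 - A * (x * q ^ n)) * F (S n)).
  { intros n. set (y := x * q ^ n).
    assert (Hy : (Cmod y < 1)%R).
    { unfold y. destruct (pow_in_01 q n Hq).
      rewrite Cmod_mult, <- RtoC_pow, Cmod_R, Rabs_pos_eq by lra.
      generalize (Cmod_ge_0 x). nra. }
    assert (tel : forall N, (1 - y) * csum (fun k => qbin A q k * y ^ k) N
              - (1 - A * y) * csum (fun k => qbin A q k * (x * q ^ S n) ^ k) N
            = - (1 - q ^ N) * (qbin A q N * y ^ N)).
    { replace (x * q ^ S n) with (y * q) by (unfold y; simpl; ring).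
      induction N; [simpl; ring | ].
      simpl csum. rewrite Cpow_mult_l.
      transitivity ((1 - y) * csum (fun k => qbin A q k * y ^ k) N
              - (1 - A * y) * csum (fun k => qbin A q k * (y * q) ^ k) N
              + ((1 - y) - (1 - A * y) * q ^ N) * (qbin A q N * y ^ N)); [ring | ].
      rewrite IHN. simpl.
      transitivity (- (qbin A q (S N) * (1 - q * q ^ N)) * (y * y ^ N)); [ | ring].
      rewrite qbin_S by exact Hq. ring. }
    assert (Z : (1 - y) * F n - (1 - A * y) * F (S n) = 0).
    { apply (clim_unique (fun N => - (1 - q ^ N) * (qbin A q N * y ^ N))).
      - apply (clim_ext _ _ _ tel). apply clim_minus; apply clim_scal; apply HF.
      - apply (geom_bounded_lim _ (qbin_max A q) (Cmod y)); [split; [apply Cmod_ge_0 | exact Hy] | ].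
        intros N. rewrite Cmod_mult.
        rewrite <- (Rmult_1_l (qbin_max A q * Cmod y ^ N)).
        apply Rmult_le_compat; try apply Cmod_ge_0; [ | now apply qbin_term_bound].
        destruct (pow_in_01 q N Hq).
        rewrite Cmod_opp, <- RtoC_pow, <- RtoC_minus, Cmod_R, Rabs_pos_eq; lra. }
    replace ((1 - y) * F n) with ((1 - y) * F n - (1 - A * y) * F (S n)
      + (1 - A * y) * F (S n)) by ring. rewrite Z. ring. }
  assert (iter : forall n, qpoch x q n * F O = qpoch (A * x) q n * F n).
  { induction n; [simpl; ring | ]. simpl.
    transitivity (qpoch x q n * F O * (1 - x * q ^ n)); [ring | ].
    rewrite IHn.
    transitivity (qpoch (A * x) q n * ((1 - x * q ^ n) * F n)); [ring | ].
    rewrite step. ring. }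
  assert (F1 : clim F 1).
  { apply (clim_squeeze _ _ (fun n => (qbin_max A q / (1 - Cmod x)) * q ^ n)%R).
    - intros n.
      assert (H := HF n). apply clim_incr_1 in H.
      apply (clim_bound (fun N => csum (fun k => qbin A q k * (x * q ^ n) ^ k) (S N) - 1)).
      { apply clim_minus; [exact H | apply clim_const]. }
      intros N. rewrite csum_first, qbin_0.
      replace (1 * (x * q ^ n) ^ 0 + csum (fun k => qbin A q (S k) * (x * q ^ n) ^ S k) N - 1)
        with (csum (fun k => qbin A q (S k) * (x * q ^ n) ^ S k) N) by (simpl; ring).
      destruct (pow_in_01 q n Hq) as [Q0 Q1].
      set (M := fun k => (qbin_max A q * q ^ n * Cmod x ^ k)%R).
      assert (HM : ex_series M)
        by (apply ex_series_geom_scal; split; [apply Cmod_ge_0 | exact Hx]).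
      assert (Mpos : (0 <= qbin_max A q * q ^ n)%R).
      { apply Rmult_le_pos; [left; now apply qbin_max_pos | lra]. }
      eapply Rle_trans.
      + apply (csum_le_tail (fun k => qbin A q (S k) * (x * q ^ n) ^ S k) M 0 N); [ | exact HM].
        intros k. eapply Rle_trans; [now apply qbin_term_bound | ].
        unfold M. rewrite Rmult_assoc. apply Rmult_le_compat_l; [left; now apply qbin_max_pos | ].
        rewrite Cmod_mult, <- RtoC_pow, Cmod_R, Rabs_pos_eq, Rpow_mult_distr by lra. simpl.
        assert (X0 := Cmod_ge_0 x).
        assert (X1 : (0 <= Cmod x ^ k)%R) by now apply pow_le.
        assert (X2 : (0 <= (q ^ n) ^ k <= 1)%R).
        { split; [apply pow_le; lra | ]. rewrite <- (pow1 k). apply pow_incr; lra. }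
        set (u := (Cmod x ^ k)%R) in *. set (v := ((q ^ n) ^ k)%R) in *. set (w := (q ^ n)%R) in *.
        assert (0 <= u * w)%R by (apply Rmult_le_pos; lra).
        assert (Cmod x * v <= 1 * 1)%R by (apply Rmult_le_compat; lra).
        replace (Cmod x * u * (w * v))%R with ((u * w) * (Cmod x * v))%R by ring. nra.
      + unfold tail. simpl. unfold M.
        rewrite !Series_geom_scal by (split; [apply Cmod_ge_0 | exact Hx]).
        replace (Series (fun k => qbin_max A q * q ^ n * Cmod x ^ (N + k))%R)
          with (qbin_max A q * q ^ n * Cmod x ^ N / (1 - Cmod x))%R.
        2:{ rewrite <- (Series_geom_scal (qbin_max A q * q ^ n * Cmod x ^ N) (Cmod x))
              by (split; [apply Cmod_ge_0 | exact Hx]).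
            apply Series_ext. intros k. rewrite pow_add. ring. }
        assert (0 <= qbin_max A q * q ^ n * Cmod x ^ N / (1 - Cmod x))%R.
        { apply Rmult_le_pos; [apply Rmult_le_pos; [exact Mpos | apply pow_le, Cmod_ge_0] | ].
          left. apply Rinv_0_lt_compat. lra. }
        unfold Rdiv in *. lra.
    - apply (is_lim_seq_eq _ (qbin_max A q / (1 - Cmod x) * 0)%R); [ | ring].
      apply is_lim_seq_mult'; [apply is_lim_seq_const | now apply pow_lim_0]. }
  assert (E : qpoch_inf x q * F O = qpoch_inf (A * x) q * 1).
  { apply (clim_unique (fun n => qpoch x q n * F O)).
    - apply clim_mult; [now apply qpoch_inf_lim | apply clim_const].
    - apply (clim_ext (fun n => qpoch (A * x) q n * F n)); [intros; now rewrite iter | ].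
      apply clim_mult; [now apply qpoch_inf_lim | exact F1]. }
  assert (NZ := qpoch_inf_disc_neq_0 q x Hq Hx).
  replace (qpoch_inf (A * x) q / qpoch_inf x q) with (F O).
  - apply (has_sum_ext (fun k => qbin A q k * (x * q ^ 0) ^ k)); [ | apply HF].
    intros k. simpl. now rewrite Cmult_1_r.
  - rewrite <- (Cmult_1_r (qpoch_inf (A * x) q)), <- E. field. exact NZ.
Qed.

(** * Integrals of complex functions over [0, pi] *)

Lemma integral_components (f : R -> C) (l : C) :
  (is_RInt (fun t => fst (f t)) 0 PI (fst l) /\ is_RInt (fun t => snd (f t)) 0 PI (snd l))
  <-> is_integral_0_pi f l.
Proof.
  split.
  - intros [H1 H2]. destruct l as [l1 l2].
    exact (@is_RInt_fct_extend_pair R_NormedModule R_NormedModule f 0 PI l1 l2 H1 H2).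
  - intros H. split.
    + exact (@is_RInt_fct_extend_fst R_NormedModule R_NormedModule f 0 PI l H).
    + exact (@is_RInt_fct_extend_snd R_NormedModule R_NormedModule f 0 PI l H).
Qed.

Lemma integral_ext (f g : R -> C) (l m : C) :
  is_integral_0_pi f l -> (forall t, f t = g t) -> l = m -> is_integral_0_pi g m.
Proof. intros H E <-. refine (is_RInt_ext _ _ _ _ _ _ H). intros; apply E. Qed.

Lemma integral_plus (f g : R -> C) (l m : C) :
  is_integral_0_pi f l -> is_integral_0_pi g m ->
  is_integral_0_pi (fun t => f t + g t) (l + m).
Proof. intros Hf Hg. exact (is_RInt_plus _ _ _ _ _ _ Hf Hg). Qed.

Lemma integral_scal (c : C) (f : R -> C) (l : C) :
  is_integral_0_pi f l -> is_integral_0_pi (fun t => c * f t) (c * l).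
Proof.
  intros H. apply integral_components in H. destruct H as [H1 H2].
  apply integral_components. split; simpl.
  - apply (is_RInt_minus (V := R_NormedModule)
             (fun t => (fst c * fst (f t))%R) (fun t => (snd c * snd (f t))%R));
      now apply (is_RInt_scal (V := R_NormedModule)).
  - apply (is_RInt_plus (V := R_NormedModule)
             (fun t => (fst c * snd (f t))%R) (fun t => (snd c * fst (f t))%R));
      now apply (is_RInt_scal (V := R_NormedModule)).
Qed.

Lemma integral_minus (f g : R -> C) (l m : C) :
  is_integral_0_pi f l -> is_integral_0_pi g m ->
  is_integral_0_pi (fun t => f t - g t) (l - m).
Proof.
  intros Hf Hg.
  apply (integral_ext (fun t => f t + (-(1)) * g t) _ (l + (-(1)) * m));
    [ | intros; ring | ring].
  apply integral_plus; [exact Hf | now apply integral_scal].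
Qed.

Lemma is_RInt_const_eq (c l : R) :
  (PI * c)%R = l -> is_RInt (fun _ : R => c) 0 PI l.
Proof.
  intros <-. replace (PI * c)%R with (scal (PI - 0)%R c)
    by (unfold scal; simpl; unfold mult; simpl; ring).
  apply (is_RInt_const (V := R_NormedModule)).
Qed.

Lemma integral_0 : is_integral_0_pi (fun _ => 0) 0.
Proof.
  apply integral_components. simpl.
  split; apply (is_RInt_const_eq 0%R); ring.
Qed.

Lemma integral_csum (f : nat -> R -> C) (l : nat -> C) (n : nat) :
  (forall k, is_integral_0_pi (f k) (l k)) ->
  is_integral_0_pi (fun t => csum (fun k => f k t) n) (csum l n).
Proof.
  intros H. induction n; simpl; [apply integral_0 | ].
  now apply integral_plus.
Qed.

Lemma integral_unique (f : R -> C) (l m : C) :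
  is_integral_0_pi f l -> is_integral_0_pi f m -> l = m.
Proof.
  intros H1 H2. apply integral_components in H1, H2.
  destruct l, m, H1, H2. simpl in *.
  apply (is_RInt_unique (V := R_CompleteNormedModule)) in H, H0, H1, H2.
  congruence.
Qed.

Lemma norm_C_R (z : C) : @norm R_AbsRing C_R_NormedModule z = Cmod z.
Proof.
  unfold Cmod. change (sqrt (Rabs (fst z) ^ 2 + Rabs (snd z) ^ 2) = sqrt (fst z ^ 2 + snd z ^ 2)).
  now rewrite !pow2_abs.
Qed.

Lemma integral_bound (f : R -> C) (l : C) (M : R) :
  is_integral_0_pi f l -> (forall t, Cmod (f t) <= M)%R -> (Cmod l <= PI * M)%R.
Proof.
  intros H B.
  assert (H' := norm_RInt_le_const (V := C_R_NormedModule) f 0 PI l M).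
  rewrite norm_C_R, Rminus_0_r in H'.
  apply H'; [generalize PI_RGT_0; lra | intros; rewrite norm_C_R; apply B | exact H].
Qed.

(** Uniform convergence is asked on all of R, since the functions in question are
    functions of e^(i t). *)
Lemma integral_uniform (f : nat -> R -> C) (F : R -> C) (e : nat -> R) (l : nat -> C) :
  is_lim_seq e 0%R -> (forall n t, Cmod (f n t - F t) <= e n)%R ->
  (forall n, is_integral_0_pi (f n) (l n)) ->
  exists L, clim l L /\ is_integral_0_pi F L.
Proof.
  intros He H Hf.
  destruct (@filterlim_RInt nat C_R_CompleteNormedModule f 0%R PI eventually _ F l Hf)
    as [L [HL HF]].
  - apply filterlim_locally. intros eps.
    destruct (proj1 (filterlim_locally _ 0%R) He eps) as [N HN].
    exists N. intros n Hn t. apply C_NormedModule_mixin_compat1.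
    change (minus (f n t) (F t)) with (f n t - F t).
    eapply Rle_lt_trans; [apply H | ].
    specialize (HN n Hn). apply Rabs_def2 in HN.
    unfold minus, plus, opp in HN. simpl in HN. lra.
  - exists L. split; [ | exact HF]. now apply is_lim_seq_Cmod_filterlim.
Qed.

Lemma integral_has_sum (f : nat -> R -> C) (F : R -> C) (M : nat -> R) (l : nat -> C) :
  ex_series M -> (forall n t, Cmod (f n t) <= M n)%R ->
  (forall t, has_sum (fun n => f n t) (F t)) ->
  (forall n, is_integral_0_pi (f n) (l n)) ->
  exists L, has_sum l L /\ is_integral_0_pi F L.
Proof.
  intros HM Hf HF Hl.
  apply (integral_uniform (fun n t => csum (fun k => f k t) n) F (tail M)).
  - now apply tail_lim.
  - intros n t. apply has_sum_tail; [apply HF | intros; apply Hf | exact HM].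
  - intros n. now apply integral_csum.
Qed.

Lemma expi_plus (a b : R) : expi (a + b) = expi a * expi b.
Proof.
  unfold expi. rewrite cos_plus, sin_plus.
  apply injective_projections; simpl; ring.
Qed.

Lemma expi_0 : expi 0 = 1.
Proof. unfold expi. now rewrite cos_0, sin_0. Qed.

Lemma Cmod_expi (t : R) : Cmod (expi t) = 1%R.
Proof.
  unfold Cmod, expi. cbn [fst snd].
  replace (cos t ^ 2 + sin t ^ 2)%R with 1%R
    by (rewrite <- (sin2_cos2 t); unfold Rsqr; ring).
  apply sqrt_1.
Qed.

Lemma expi_neq_0 (t : R) : expi t <> 0.
Proof.
  intros E. apply (f_equal Cmod) in E. rewrite Cmod_expi, Cmod_0 in E. lra.
Qed.

Lemma expi_opp (t : R) : expi (- t) = / expi t.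
Proof.
  assert (H : expi (- t) * expi t = 1)
    by (rewrite <- expi_plus; replace (- t + t)%R with 0%R by ring; apply expi_0).
  rewrite <- (Cmult_1_l (/ expi t)), <- H. field. apply expi_neq_0.
Qed.

Lemma expi_pow (t : R) (n : nat) : expi t ^ n = expi (INR n * t).
Proof.
  induction n; [simpl; now rewrite Rmult_0_l, expi_0 | ].
  rewrite S_INR, Rmult_plus_distr_r, expi_plus, Rmult_1_l, <- IHn. simpl. ring.
Qed.

Lemma integral_expi (k : Z) :
  is_integral_0_pi (fun t => expi (2 * IZR k * t))
    (RtoC (if Z.eq_dec k 0 then PI else 0%R)).
Proof.
  destruct (Z.eq_dec k 0) as [-> | Hk]; apply integral_components; simpl.
  - split.
    + apply (is_RInt_ext (fun _ => 1%R)).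
      * intros t _. now rewrite Rmult_0_r, Rmult_0_l, cos_0.
      * apply (is_RInt_const_eq 1%R). ring.
    + apply (is_RInt_ext (fun _ => 0%R)).
      * intros t _. now rewrite Rmult_0_r, Rmult_0_l, sin_0.
      * apply (is_RInt_const_eq 0%R). ring.
  - assert (K : IZR k <> 0%R) by (now apply not_0_IZR).
    assert (S0 : sin (2 * IZR k * PI) = 0%R)
      by (apply sin_eq_0_1; exists (2 * k)%Z; rewrite mult_IZR; ring).
    assert (C1 : cos (2 * IZR k * PI) = 1%R).
    { rewrite Rmult_assoc, cos_2a_sin.
      assert (E : sin (IZR k * PI) = 0%R) by (apply sin_eq_0_1; now exists k).
      rewrite E. ring. }
    split.
    + replace 0%R with (minus (sin (2 * IZR k * PI) / (2 * IZR k))%R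
                              (sin (2 * IZR k * 0) / (2 * IZR k))%R) at 2.
      2:{ rewrite S0, Rmult_0_r, sin_0. unfold minus, plus, opp. simpl. field. exact K. }
      apply (is_RInt_derive (fun t => sin (2 * IZR k * t) / (2 * IZR k))%R).
      * intros t _. auto_derive; [exact I | ]. field. exact K.
      * intros t _. apply (ex_derive_continuous (V := R_NormedModule)). auto_derive. exact I.
    + replace 0%R with (minus (- cos (2 * IZR k * PI) / (2 * IZR k))%R
                              (- cos (2 * IZR k * 0) / (2 * IZR k))%R) at 2.
      2:{ rewrite C1, Rmult_0_r, cos_0. unfold minus, plus, opp. simpl. field. exact K. }
      apply (is_RInt_derive (fun t => - cos (2 * IZR k * t) / (2 * IZR k))%R).
      * intros t _. auto_derive; [exact I | ]. field. exact K.
      * intros t _. apply (ex_derive_continuous (V := R_NormedModule)). auto_derive. exact I.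
Qed.

Lemma has_sum_single (a : nat -> C) (m : nat) :
  (forall n, n <> m -> a n = 0) -> has_sum a (a m).
Proof.
  intros H.
  assert (Z : forall n, (n <= m)%nat -> csum a n = 0).
  { induction n; intros L; simpl; [reflexivity | ].
    rewrite IHn, H by lia. ring. }
  assert (E : forall n, csum a (n + S m)%nat = a m).
  { induction n; simpl.
    - rewrite Z by lia. ring.
    - rewrite IHn, (H (n + S m)%nat) by lia. ring. }
  unfold has_sum, clim. apply (is_lim_seq_incr_n _ (S m)).
  apply (is_lim_seq_ext (fun _ => 0%R)); [ | apply is_lim_seq_const].
  intros n. rewrite E. replace (a m - a m) with (RtoC 0) by ring. now rewrite Cmod_0.
Qed.

(** * Fourier coefficients of the weight *)

Definition rz (r : R) (k : Z) : C := RtoC (powerRZ r k).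

Lemma rz_plus (r : R) (j k : Z) : (0 < r)%R -> rz r (j + k) = rz r j * rz r k.
Proof. intros H. unfold rz. rewrite powerRZ_add by lra. now rewrite RtoC_mult. Qed.

Lemma rz_nat (r : R) (n : nat) : rz r (Z.of_nat n) = r ^ n.
Proof. unfold rz. now rewrite <- pow_powerRZ, RtoC_pow. Qed.

Lemma rz_0 (r : R) : rz r 0 = 1.
Proof. reflexivity. Qed.

Lemma rz_opp (r : R) (k : Z) : (0 < r)%R -> rz r k * rz r (- k) = 1.
Proof. intros H. rewrite <- rz_plus by exact H. now rewrite Z.add_opp_diag_r. Qed.

Lemma rz_neq_0 (r : R) (k : Z) : (0 < r)%R -> rz r k <> 0.
Proof. intros H. apply RtoC_neq. apply powerRZ_NOR. lra. Qed.

Lemma powerRZ_neq_1 (r : R) (k : Z) : (0 < r < 1)%R -> k <> 0%Z -> powerRZ r k <> 1%R.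
Proof.
  intros H.
  assert (P : forall p, (powerRZ r (Zpos p) < 1)%R).
  { intros p. simpl. apply (pow_lt_1_compat r (Pos.to_nat p)); [lra | lia]. }
  destruct k as [ | p | p]; intros K; [easy | | ].
  - intros E. specialize (P p). rewrite E in P. lra.
  - intros E. specialize (P p).
    assert (M : (powerRZ r (Zpos p) * powerRZ r (Zneg p) = 1)%R).
    { rewrite <- powerRZ_add by lra. now rewrite <- Pos2Z.opp_pos, Z.add_opp_diag_r. }
    rewrite E in M. lra.
Qed.

Lemma rz_neq_1 (r : R) (k : Z) : (0 < r < 1)%R -> k <> 0%Z -> rz r k <> 1.
Proof. intros H K. apply RtoC_neq. now apply powerRZ_neq_1. Qed.

(** At z = e^(i t), z^(-1) wP wQ is the factor u of the weight: wP is
    (z^2; q)_oo / (q^(1/2) z^2; q)_oo and wQ is (q/z^2; q)_oo / (q^(1/2)/z^2; q)_oo. *)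
Definition wP (r t : R) : C :=
  qpoch_inf (expi (2 * t)) (r ^ 4)%R / qpoch_inf (r ^ 2 * expi (2 * t)) (r ^ 4)%R.

Definition wQ (r t : R) : C :=
  qpoch_inf (r ^ 4 * expi (- (2 * t))) (r ^ 4)%R
  / qpoch_inf (r ^ 2 * expi (- (2 * t))) (r ^ 4)%R.

Definition coefP (r : R) (n : nat) : C := qbin (/ r ^ 2) (r ^ 4)%R n * (r ^ 2) ^ n.
Definition coefQ (r : R) (n : nat) : C := qbin (r ^ 2) (r ^ 4)%R n * (r ^ 2) ^ n.

Lemma r4_in_01 (r : R) : (0 < r < 1)%R -> (0 < r ^ 4 < 1)%R.
Proof.
  intros H. split; [apply pow_lt; lra | apply pow_lt_1_compat; [lra | lia]].
Qed.

Lemma Cmod_r2 (r : R) : (0 < r < 1)%R -> Cmod (r ^ 2) = (r ^ 2)%R.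
Proof. intros H. rewrite <- RtoC_pow, Cmod_R, Rabs_pos_eq; [reflexivity | ]. apply pow_le; lra. Qed.

Lemma r2_in_01 (r : R) : (0 < r < 1)%R -> (0 < r ^ 2 < 1)%R.
Proof.
  intros H. split; [apply pow_lt; lra | apply pow_lt_1_compat; [lra | lia]].
Qed.

Lemma r_neq_0 (r : R) : (0 < r < 1)%R -> RtoC r <> 0.
Proof. intros H. apply RtoC_neq. lra. Qed.

Lemma coef_bound (A : C) (r : R) (z : C) (n : nat) :
  (0 < r < 1)%R -> Cmod z = 1%R ->
  (Cmod (qbin A (r ^ 4)%R n * (r ^ 2) ^ n * z) <= qbin_max A (r ^ 4) * (r ^ 2) ^ n)%R.
Proof.
  intros H Hz. rewrite Cmod_mult, Hz, Rmult_1_r.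
  rewrite <- (Cmod_r2 r H). apply qbin_term_bound. now apply r4_in_01.
Qed.

Lemma wP_series (r t : R) :
  (0 < r < 1)%R -> has_sum (fun n => coefP r n * expi (2 * INR n * t)) (wP r t).
Proof.
  intros H. unfold wP, coefP.
  replace (expi (2 * t)) with (/ r ^ 2 * (r ^ 2 * expi (2 * t))) at 1
    by (field; now apply r_neq_0).
  refine (has_sum_ext _ _ _ _ (q_binomial _ _ _ (r4_in_01 r H) _)).
  - intros n. rewrite Cpow_mult_l, expi_pow. simpl.
    replace (INR n * (2 * t))%R with (2 * INR n * t)%R by ring. ring.
  - rewrite Cmod_mult, Cmod_expi, Cmod_r2 by exact H. generalize (r2_in_01 r H). lra.
Qed.

Lemma wQ_series (r t : R) :
  (0 < r < 1)%R -> has_sum (fun n => coefQ r n * expi (- (2 * INR n * t))) (wQ r t).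
Proof.
  intros H. unfold wQ, coefQ.
  replace (r ^ 4 * expi (- (2 * t))) with (r ^ 2 * (r ^ 2 * expi (- (2 * t)))) by ring.
  refine (has_sum_ext _ _ _ _ (q_binomial _ _ _ (r4_in_01 r H) _)).
  - intros n. rewrite Cpow_mult_l, expi_pow. simpl.
    replace (INR n * (- (2 * t)))%R with (- (2 * INR n * t))%R by ring. ring.
  - rewrite Cmod_mult, Cmod_expi, Cmod_r2 by exact H. generalize (r2_in_01 r H). lra.
Qed.

(** The coefficients of wP extended by 0 to negative indices: the recurrence
    [coefZ_step] then holds for every integer, since its left factor 1 - q^k
    vanishes at k = 0. *)
Definition coefZ (r : R) (k : Z) : C :=
  if Z_lt_dec k 0 then 0 else coefP r (Z.to_nat k).

Lemma coefZ_nat (r : R) (n : nat) : coefZ r (Z.of_nat n) = coefP r n.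
Proof.
  unfold coefZ. destruct (Z_lt_dec _ _); [lia | ]. now rewrite Nat2Z.id.
Qed.

Lemma integral_wP (r : R) (k : Z) :
  (0 < r < 1)%R ->
  is_integral_0_pi (fun t => expi (2 * IZR (- k) * t) * wP r t) (PI * coefZ r k).
Proof.
  intros H.
  set (l := fun n : nat =>
    coefP r n * RtoC (if Z.eq_dec (Z.of_nat n - k) 0 then PI else 0%R)).
  destruct (integral_has_sum
    (fun n t => coefP r n * expi (2 * IZR (Z.of_nat n - k) * t))
    (fun t => expi (2 * IZR (- k) * t) * wP r t)
    (fun n => qbin_max (/ r ^ 2) (r ^ 4) * (r ^ 2) ^ n)%R l) as [L [HL HI]].
  - apply ex_series_geom_scal. generalize (r2_in_01 r H). lra.
  - intros n t. apply coef_bound; [exact H | apply Cmod_expi].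
  - intros t.
    apply (has_sum_ext (fun n => expi (2 * IZR (- k) * t) * (coefP r n * expi (2 * INR n * t)))).
    + intros n. rewrite minus_IZR, opp_IZR, <- INR_IZR_INZ.
      replace (2 * (INR n - IZR k) * t)%R with (2 * - IZR k * t + 2 * INR n * t)%R by ring.
      rewrite expi_plus. ring.
    + apply has_sum_scal. now apply wP_series.
  - intros n. apply integral_scal, integral_expi.
  - refine (integral_ext _ _ _ _ HI (fun _ => eq_refl) _).
    refine (has_sum_unique _ _ _ HL _). unfold coefZ.
    destruct (Z_lt_dec k 0) as [N | N].
    + replace (PI * 0) with (l O).
      * apply has_sum_single. intros n _. unfold l.
        destruct (Z.eq_dec _ _); [lia | ring].
      * unfold l. destruct (Z.eq_dec _ _); [lia | ring].
    + replace (PI * coefP r (Z.to_nat k)) with (l (Z.to_nat k)).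
      * apply has_sum_single. intros n Hn. unfold l.
        destruct (Z.eq_dec _ _); [lia | ring].
      * unfold l. destruct (Z.eq_dec _ _); [ring | lia].
Qed.

Lemma wP_bound (r t : R) :
  (0 < r < 1)%R ->
  (Cmod (wP r t) <= qbin_max (/ r ^ 2) (r ^ 4) / (1 - r ^ 2))%R.
Proof.
  intros H. rewrite <- Series_geom_scal by (generalize (r2_in_01 r H); lra).
  apply (has_sum_bound _ _ _ (wP_series r t H)).
  - intros n. apply coef_bound; [exact H | apply Cmod_expi].
  - apply ex_series_geom_scal. generalize (r2_in_01 r H). lra.
Qed.

Lemma wQ_bound (r t : R) :
  (0 < r < 1)%R ->
  (Cmod (wQ r t) <= qbin_max (r ^ 2) (r ^ 4) / (1 - r ^ 2))%R.
Proof.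
  intros H. rewrite <- Series_geom_scal by (generalize (r2_in_01 r H); lra).
  apply (has_sum_bound _ _ _ (wQ_series r t H)).
  - intros n. apply coef_bound; [exact H | apply Cmod_expi].
  - apply ex_series_geom_scal. generalize (r2_in_01 r H). lra.
Qed.

Lemma integral_wPQ (r : R) (k : Z) :
  (0 < r < 1)%R ->
  exists N, has_sum (fun j => coefQ r j * coefZ r (k + Z.of_nat j)) N /\
    is_integral_0_pi (fun t => expi (2 * IZR (- k) * t) * wP r t * wQ r t) (PI * N).
Proof.
  intros H.
  set (B := (qbin_max (/ r ^ 2) (r ^ 4) / (1 - r ^ 2))%R).
  destruct (integral_has_sum
    (fun j t => coefQ r j * (expi (2 * IZR (- (k + Z.of_nat j)) * t) * wP r t))
    (fun t => expi (2 * IZR (- k) * t) * wP r t * wQ r t)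
    (fun n => qbin_max (r ^ 2) (r ^ 4) * B * (r ^ 2) ^ n)%R
    (fun j => coefQ r j * (PI * coefZ r (k + Z.of_nat j)))) as [L [HL HI]].
  - apply ex_series_geom_scal. generalize (r2_in_01 r H). lra.
  - intros n t. rewrite Cmult_assoc, Cmod_mult.
    replace (qbin_max (r ^ 2) (r ^ 4) * B * (r ^ 2) ^ n)%R
      with (qbin_max (r ^ 2) (r ^ 4) * (r ^ 2) ^ n * B)%R by ring.
    apply Rmult_le_compat; try apply Cmod_ge_0; [ | now apply wP_bound].
    apply coef_bound; [exact H | apply Cmod_expi].
  - intros t.
    apply (has_sum_ext (fun j => expi (2 * IZR (- k) * t) * wP r t
             * (coefQ r j * expi (- (2 * INR j * t))))).
    + intros n. rewrite !opp_IZR, plus_IZR, <- INR_IZR_INZ.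
      replace (2 * - (IZR k + INR n) * t)%R with (2 * - IZR k * t + - (2 * INR n * t))%R by ring.
      rewrite expi_plus. ring.
    + apply has_sum_scal. now apply wQ_series.
  - intros j. apply integral_scal. now apply integral_wP.
  - assert (P0 : RtoC PI <> 0) by (apply RtoC_neq; generalize PI_RGT_0; lra).
    exists (/ PI * L). split.
    + apply (has_sum_ext (fun j => / PI * (coefQ r j * (PI * coefZ r (k + Z.of_nat j))))).
      * intros j. field. exact P0.
      * now apply has_sum_scal.
    + refine (integral_ext _ _ _ _ HI (fun _ => eq_refl) _). field. exact P0.
Qed.

Lemma coefP_S (r : R) (n : nat) :
  (0 < r < 1)%R ->
  coefP r (S n) * (1 - r ^ 4 * (r ^ 4) ^ n) = (r ^ 2 - (r ^ 4) ^ n) * coefP r n.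
Proof.
  intros H. unfold coefP.
  assert (E := qbin_S (/ r ^ 2) (r ^ 4) n (r4_in_01 r H)). rewrite RtoC_pow in E.
  simpl Cpow at 3.
  transitivity (qbin (/ r ^ 2) (r ^ 4)%R (S n) * (1 - r ^ 4 * (r ^ 4) ^ n)
                * (r ^ 2 * (r ^ 2) ^ n)); [simpl; ring | ].
  rewrite E. assert (R0 := r_neq_0 r H). field. exact R0.
Qed.

Lemma coefQ_S (r : R) (n : nat) :
  (0 < r < 1)%R ->
  coefQ r (S n) * (1 - r ^ 4 * (r ^ 4) ^ n) = (r ^ 2 - r ^ 4 * (r ^ 4) ^ n) * coefQ r n.
Proof.
  intros H. unfold coefQ.
  assert (E := qbin_S (r ^ 2) (r ^ 4) n (r4_in_01 r H)). rewrite RtoC_pow in E.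
  transitivity (qbin (r ^ 2) (r ^ 4)%R (S n) * (1 - r ^ 4 * (r ^ 4) ^ n)
                * (r ^ 2 * (r ^ 2) ^ n)); [simpl; ring | ].
  rewrite E. ring.
Qed.

Lemma rz_4_nat (r : R) (n : nat) : rz r (4 * Z.of_nat n) = (r ^ 4) ^ n.
Proof.
  rewrite <- Cpow_mult_r, <- rz_nat. f_equal. lia.
Qed.

Lemma coefZ_step (r : R) (k : Z) :
  (0 < r < 1)%R ->
  coefZ r k * (1 - rz r (4 * k)) = (r ^ 2 - rz r (4 * k - 4)) * coefZ r (k - 1).
Proof.
  intros H. destruct (Z_lt_le_dec k 0) as [N | N].
  - unfold coefZ. destruct (Z_lt_dec k 0), (Z_lt_dec (k - 1) 0); try lia. ring.
  - destruct (Z.eq_dec k 0) as [-> | K].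
    + simpl Z.mul. rewrite rz_0. unfold coefZ at 2.
      destruct (Z_lt_dec (0 - 1) 0); [ring | lia].
    + destruct (Z_of_nat_complete (k - 1)) as [n Hn]; [lia | ].
      assert (E : k = Z.of_nat (S n)) by lia. rewrite Hn, E, !coefZ_nat.
      replace (4 * Z.of_nat (S n) - 4)%Z with (4 * Z.of_nat n)%Z by lia.
      rewrite !rz_4_nat. rewrite <- coefP_S by exact H. simpl. ring.
Qed.

Lemma coefP_bound (r : R) (n : nat) :
  (0 < r < 1)%R -> (Cmod (coefP r n) <= qbin_max (/ r ^ 2) (r ^ 4) * (r ^ 2) ^ n)%R.
Proof.
  intros H. rewrite <- (Cmult_1_r (coefP r n)). apply coef_bound; [exact H | apply Cmod_1].
Qed.

Lemma coefQ_bound (r : R) (n : nat) :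
  (0 < r < 1)%R -> (Cmod (coefQ r n) <= qbin_max (r ^ 2) (r ^ 4) * (r ^ 2) ^ n)%R.
Proof.
  intros H. rewrite <- (Cmult_1_r (coefQ r n)). apply coef_bound; [exact H | apply Cmod_1].
Qed.

Lemma coefZ_bound (r : R) (k : Z) :
  (0 < r < 1)%R -> (Cmod (coefZ r k) <= qbin_max (/ r ^ 2) (r ^ 4))%R.
Proof.
  intros H. assert (M := qbin_max_pos (/ r ^ 2) (r ^ 4) (r4_in_01 r H)).
  unfold coefZ. destruct (Z_lt_dec k 0).
  - rewrite Cmod_0. lra.
  - eapply Rle_trans; [now apply coefP_bound | ].
    rewrite <- (Rmult_1_r (qbin_max (/ r ^ 2) (r ^ 4))) at 2.
    apply Rmult_le_compat_l; [lra | ]. apply pow_in_01. now apply r2_in_01.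
Qed.

(** The invariance of u under z -> q^(1/2) z, at the level of its coefficients
    N = sum_j b_j a_(k+j).  The sum over j < J of the difference of the two sides
    telescopes to - q^(k-1) (1 - q^J) b_J a_(k+J-1), by the recurrences of the
    two hypergeometric coefficients, and this tends to 0. *)
Lemma moment_step (r : R) (k : Z) (N N' : C) :
  (0 < r < 1)%R ->
  has_sum (fun j => coefQ r j * coefZ r (k + Z.of_nat j)) N ->
  has_sum (fun j => coefQ r j * coefZ r (k - 1 + Z.of_nat j)) N' ->
  (1 - rz r (4 * k - 2)) * N = (r ^ 2 - rz r (4 * k - 4)) * N'.
Proof.
  intros H HN HN'.
  set (e := rz r (4 * k - 4)).
  assert (E2 : rz r (4 * k - 2) = e * r ^ 2).
  { unfold e. rewrite <- rz_nat, <- rz_plus by lra. f_equal. lia. }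
  assert (tel : forall J,
    (1 - rz r (4 * k - 2)) * csum (fun j => coefQ r j * coefZ r (k + Z.of_nat j)) J
    - (r ^ 2 - e) * csum (fun j => coefQ r j * coefZ r (k - 1 + Z.of_nat j)) J
    = - e * (1 - (r ^ 4) ^ J) * (coefQ r J * coefZ r (k - 1 + Z.of_nat J))).
  { induction J; [simpl; ring | ].
    simpl csum.
    set (A := csum (fun j => coefQ r j * coefZ r (k + Z.of_nat j)) J) in *.
    set (B := csum (fun j => coefQ r j * coefZ r (k - 1 + Z.of_nat j)) J) in *.
    transitivity ((1 - rz r (4 * k - 2)) * A - (r ^ 2 - e) * B
      + coefQ r J * ((1 - rz r (4 * k - 2)) * coefZ r (k + Z.of_nat J)
                     - (r ^ 2 - e) * coefZ r (k - 1 + Z.of_nat J))); [ring | ].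
    rewrite IHJ, E2.
    replace (k - 1 + Z.of_nat (S J))%Z with (k + Z.of_nat J)%Z by lia.
    assert (Z1 := coefZ_step r (k + Z.of_nat J) H).
    replace (rz r (4 * (k + Z.of_nat J))) with (e * r ^ 4 * (r ^ 4) ^ J) in Z1.
    2:{ unfold e. rewrite <- rz_4_nat, <- (rz_nat r 4), <- !rz_plus by lra.
        f_equal. lia. }
    replace (rz r (4 * (k + Z.of_nat J) - 4)) with (e * (r ^ 4) ^ J) in Z1.
    2:{ unfold e. rewrite <- rz_4_nat, <- !rz_plus by lra. f_equal. lia. }
    replace (k + Z.of_nat J - 1)%Z with (k - 1 + Z.of_nat J)%Z in Z1 by lia.
    assert (Q1 := coefQ_S r J H).
    set (a := coefZ r (k + Z.of_nat J)) in *.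
    set (b := coefZ r (k - 1 + Z.of_nat J)) in *.
    set (c := coefQ r J) in *. set (y := (r ^ 4) ^ J) in *.
    transitivity (- e * (coefQ r (S J) * (1 - r ^ 4 * y)) * a);
      [ | change ((r ^ 4) ^ S J) with (r ^ 4 * y); ring].
    rewrite Q1.
    transitivity (c * (a * (1 - e * r ^ 4 * y) - (r ^ 2 - e * y) * b)
                  - e * (r ^ 2 - r ^ 4 * y) * c * a); [ring | ].
    rewrite Z1. ring. }
  assert (Z : (1 - rz r (4 * k - 2)) * N - (r ^ 2 - e) * N' = 0).
  { apply (clim_unique (fun J => - e * (1 - (r ^ 4) ^ J) * (coefQ r J * coefZ r (k - 1 + Z.of_nat J)))).
    - apply (clim_ext _ _ _ tel). apply clim_minus; apply clim_scal; assumption.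
    - apply (geom_bounded_lim _ (Cmod e * (qbin_max (r ^ 2) (r ^ 4) * qbin_max (/ r ^ 2) (r ^ 4))) (r ^ 2)).
      + generalize (r2_in_01 r H). lra.
      + intros J. rewrite !Cmod_mult, Cmod_opp.
        destruct (pow_in_01 (r ^ 4) J (r4_in_01 r H)).
        rewrite <- !RtoC_pow, <- RtoC_minus, Cmod_R, Rabs_pos_eq by lra.
        rewrite !Rmult_assoc. apply Rmult_le_compat_l; [apply Cmod_ge_0 | ].
        rewrite <- (Rmult_1_l (qbin_max (r ^ 2)%R (r ^ 4) * _)).
        assert (B1 := coefQ_bound r J H).
        assert (B2 := coefZ_bound r (k - 1 + Z.of_nat J) H).
        rewrite <- RtoC_pow in B1, B2.
        apply Rmult_le_compat; [lra | | lra | ].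
        * apply Rmult_le_pos; apply Cmod_ge_0.
        * rewrite (Rmult_comm (qbin_max (/ (r ^ 2)%R) _)), <- Rmult_assoc.
          apply Rmult_le_compat; try apply Cmod_ge_0; assumption. }
  replace ((1 - rz r (4 * k - 2)) * N) with
    ((1 - rz r (4 * k - 2)) * N - (r ^ 2 - e) * N' + (r ^ 2 - e) * N') by ring.
  rewrite Z. ring.
Qed.

Definition moment_const (r : R) : C :=
  - (/ r ^ 2 * (qpoch_inf (r ^ 2) (r ^ 4)%R) ^ 2 / (qpoch_inf (r ^ 4) (r ^ 4)%R) ^ 2).

Lemma qbin_lim (A : C) (q : R) :
  (0 < q < 1)%R -> clim (qbin A q) (qpoch_inf A q / qpoch_inf q q).
Proof.
  intros Hq. assert (N0 := qpoch_inf_qq_neq_0 q Hq).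
  assert (P0 : (0 < Cmod (qpoch_inf q q))%R) by now apply Cmod_gt_0.
  apply (clim_squeeze _ _ (fun n => Cmod (qpoch A q n * qpoch_inf q q - qpoch_inf A q * qpoch q q n)
      / (Cmod (qpoch_inf q q) * Cmod (qpoch_inf q q)))%R).
  - intros n. assert (N1 := qpoch_qq_neq_0 q n Hq).
    replace (qbin A q n - qpoch_inf A q / qpoch_inf q q) with
      ((qpoch A q n * qpoch_inf q q - qpoch_inf A q * qpoch q q n)
        / (qpoch q q n * qpoch_inf q q)) by (unfold qbin; field; auto).
    rewrite Cmod_div by now apply Cmult_neq_0. rewrite Cmod_mult.
    apply Rmult_le_compat_l; [apply Cmod_ge_0 | ].
    apply Rinv_le_contravar; [now apply Rmult_lt_0_compat | ].
    apply Rmult_le_compat_r; [lra | now apply qpoch_qq_lower].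
  - apply (is_lim_seq_eq _ (0 * / (Cmod (qpoch_inf q q) * Cmod (qpoch_inf q q)))%R); [ | ring].
    apply is_lim_seq_mult'; [ | apply is_lim_seq_const].
    assert (L : clim (fun n => qpoch A q n * qpoch_inf q q - qpoch_inf A q * qpoch q q n)
                (qpoch_inf A q * qpoch_inf q q - qpoch_inf A q * qpoch_inf q q)).
    { apply clim_minus; apply clim_mult; try apply clim_const; now apply qpoch_inf_lim. }
    replace (qpoch_inf A q * qpoch_inf q q - qpoch_inf A q * qpoch_inf q q)
      with (RtoC 0) in L by ring.
    apply clim_Cmod in L. rewrite Cmod_0 in L. exact L.
Qed.

Lemma coefQ_sum (r : R) :
  (0 < r < 1)%R ->
  has_sum (fun j => coefQ r j * (r ^ 2) ^ j)
    (qpoch_inf (r ^ 2 * r ^ 4) (r ^ 4)%R / qpoch_inf (r ^ 4) (r ^ 4)%R).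
Proof.
  intros H. assert (Q := r4_in_01 r H).
  refine (has_sum_ext _ _ _ _ (q_binomial (r ^ 2) (r ^ 4) (r ^ 4) Q _)).
  - intros n. unfold coefQ. replace (r ^ 4) with (r ^ 2 * r ^ 2) by ring.
    rewrite Cpow_mult_l. ring.
  - rewrite <- RtoC_pow, Cmod_R, Rabs_pos_eq; lra.
Qed.

Lemma moment_const_eq (r : R) :
  (0 < r < 1)%R ->
  moment_const r =
  (qpoch_inf (/ r ^ 2) (r ^ 4)%R / qpoch_inf (r ^ 4) (r ^ 4)%R)
  * (qpoch_inf (r ^ 2 * r ^ 4) (r ^ 4)%R / qpoch_inf (r ^ 4) (r ^ 4)%R).
Proof.
  intros H. assert (Q := r4_in_01 r H). assert (R0 := r_neq_0 r H).
  unfold moment_const.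
  assert (N0 : qpoch_inf (r ^ 4) (r ^ 4)%R <> 0)
    by (rewrite <- RtoC_pow; now apply qpoch_inf_qq_neq_0).
  rewrite (qpoch_inf_shift (r ^ 4) (/ r ^ 2) Q).
  replace (/ r ^ 2 * (r ^ 4)%R) with (r ^ 2) by (rewrite RtoC_pow; field; exact R0).
  replace (qpoch_inf (r ^ 2) (r ^ 4)%R ^ 2) with
    (qpoch_inf (r ^ 2) (r ^ 4)%R * ((1 - r ^ 2) * qpoch_inf (r ^ 2 * r ^ 4) (r ^ 4)%R)).
  2:{ replace (r ^ 2 * r ^ 4) with (r ^ 2 * (r ^ 4)%R) by (now rewrite RtoC_pow).
      rewrite <- (qpoch_inf_shift (r ^ 4) (r ^ 2) Q). ring. }
  field. split; assumption.
Qed.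

(** As k -> +oo, coefP (k + j) is asymptotic to r^(2k + 2j) times the limit of the
    coefficients of the q-binomial series, so that the sum over j is again a
    q-binomial series. *)
Lemma moment_limit (r : R) (N : nat -> C) :
  (0 < r < 1)%R ->
  (forall k, has_sum (fun j => coefQ r j * coefZ r (Z.of_nat k + Z.of_nat j)) (N k)) ->
  clim (fun k => N k * rz r (- (2 * Z.of_nat k))) (moment_const r).
Proof.
  intros H HN. rewrite moment_const_eq by exact H.
  set (A := qpoch_inf (/ r ^ 2) (r ^ 4)%R / qpoch_inf (r ^ 4) (r ^ 4)%R).
  set (S := qpoch_inf (r ^ 2 * r ^ 4) (r ^ 4)%R / qpoch_inf (r ^ 4) (r ^ 4)%R).
  assert (R2 := r2_in_01 r H). assert (R4 := r4_in_01 r H).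
  assert (HA : clim (qbin (/ r ^ 2) (r ^ 4)%R) A).
  { unfold A. rewrite <- (RtoC_pow r 4). now apply qbin_lim. }
  set (B := (qbin_max (r ^ 2) (r ^ 4) / (1 - r ^ 2))%R).
  assert (B0 : (0 < B)%R).
  { apply Rdiv_lt_0_compat; [now apply qbin_max_pos | lra]. }
  apply filterlim_locally. intros eps.
  assert (e0 : (0 < eps / (2 * B))%R).
  { apply Rdiv_lt_0_compat; [apply cond_pos | lra]. }
  destruct (proj1 (filterlim_locally _ 0%R) HA (mkposreal _ e0)) as [n0 Hn0].
  exists n0. intros k Hk.
  assert (D : has_sum (fun j => coefQ r j * (r ^ 2) ^ j * (qbin (/ r ^ 2) (r ^ 4)%R (k + j) - A))
                (N k * rz r (- (2 * Z.of_nat k)) - A * S)).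
  { apply (has_sum_ext (fun j => rz r (- (2 * Z.of_nat k)) * (coefQ r j * coefZ r (Z.of_nat k + Z.of_nat j))
                        + (- A) * (coefQ r j * (r ^ 2) ^ j))).
    - intros j. rewrite <- Nat2Z.inj_add, coefZ_nat. unfold coefP.
      rewrite <- !Cpow_mult_r.
      replace (2 * (k + j))%nat with (2 * k + 2 * j)%nat by lia. rewrite Cpow_add_r.
      assert (E : rz r (- (2 * Z.of_nat k)) * r ^ (2 * k) = 1).
      { rewrite <- rz_nat, Cmult_comm.
        replace (2 * Z.of_nat k)%Z with (Z.of_nat (2 * k)) by lia. apply rz_opp. lra. }
      set (u := r ^ (2 * k)) in *. set (v := r ^ (2 * j)).
      transitivity ((rz r (- (2 * Z.of_nat k)) * u)
        * (coefQ r j * qbin (/ r ^ 2) (r ^ 4)%R (k + j) * v)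
        - A * (coefQ r j * v)); [ring | ].
      rewrite E. ring.
    - replace (N k * rz r (- (2 * Z.of_nat k)) - A * S)
        with (rz r (- (2 * Z.of_nat k)) * N k + (- A) * S) by ring.
      apply has_sum_plus; apply has_sum_scal; [apply HN | now apply coefQ_sum]. }
  assert (L : (Cmod (N k * rz r (- (2 * Z.of_nat k)) - A * S) <= eps / 2)%R).
  { replace (eps / 2)%R with (Series (fun j => qbin_max (r ^ 2) (r ^ 4) * (eps / (2 * B)) * (r ^ 2) ^ j)%R).
    - apply (has_sum_bound _ _ _ D); [ | apply ex_series_geom_scal; lra].
      intros j. rewrite !Cmod_mult.
      assert (Hj : (Rabs (Cmod (qbin (/ r ^ 2) (r ^ 4)%R (k + j) - A) - 0) < eps / (2 * B))%R)
        by (apply (Hn0 (k + j)%nat); lia).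
      apply Rabs_def2 in Hj.
      apply Rle_trans with ((qbin_max (r ^ 2) (r ^ 4) * (r ^ 2) ^ j) * 1 * (eps / (2 * B)))%R.
      + apply Rmult_le_compat; try apply Cmod_ge_0; try lra.
        * apply Rmult_le_pos; apply Cmod_ge_0.
        * apply Rmult_le_compat; try apply Cmod_ge_0; [now apply coefQ_bound | ].
          rewrite Cmod_pow, Cmod_r2 by exact H. now apply pow_in_01.
      + right. ring.
    - rewrite Series_geom_scal by lra. unfold B.
      assert (M0 := qbin_max_pos (r ^ 2) (r ^ 4) R4).
      field. split; lra. }
  change (Rabs (Cmod (N k * rz r (- (2 * Z.of_nat k)) - A * S) - 0) < eps)%R.
  rewrite Rminus_0_r, Rabs_pos_eq by apply Cmod_ge_0.
  generalize (cond_pos eps). lra.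
Qed.

(** By [moment_step] the quantity N k (1 - r^(4k-2)) r^(-2k) is the same for
    all integers k; its value is the limit at +oo. *)
Lemma moment_closed_form (r : R) (N : Z -> C) :
  (0 < r < 1)%R ->
  (forall k, has_sum (fun j => coefQ r j * coefZ r (k + Z.of_nat j)) (N k)) ->
  forall k, N k * (1 - rz r (4 * k - 2)) = moment_const r * rz r (2 * k).
Proof.
  intros H HN.
  set (X := fun k => N k * (1 - rz r (4 * k - 2)) * rz r (- (2 * k))).
  assert (step : forall k, X k = X (k - 1)%Z).
  { intros k. unfold X.
    transitivity ((1 - rz r (4 * k - 2)) * N k * rz r (- (2 * k))); [ring | ].
    rewrite (moment_step r k (N k) (N (k - 1)%Z) H (HN k) (HN (k - 1)%Z)).
    replace (rz r (4 * k - 4)) with (r ^ 2 * rz r (4 * (k - 1) - 2)).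
    2:{ rewrite <- rz_nat, <- rz_plus by lra. f_equal. lia. }
    replace (rz r (- (2 * (k - 1)))) with (r ^ 2 * rz r (- (2 * k))).
    2:{ rewrite <- rz_nat, <- rz_plus by lra. f_equal. lia. }
    ring. }
  assert (const : forall k, X k = X 0%Z).
  { apply Z.bi_induction.
    - intros a b ->. reflexivity.
    - reflexivity.
    - intros k. rewrite (step (Z.succ k)). replace (Z.succ k - 1)%Z with k by lia. reflexivity. }
  assert (X0 : X 0%Z = moment_const r).
  { apply (clim_unique (fun k : nat => X (Z.of_nat k))).
    - apply (clim_ext (fun _ => X 0%Z)); [intros; symmetry; apply const | apply clim_const].
    - apply (clim_ext (fun k : nat => N (Z.of_nat k) * rz r (- (2 * Z.of_nat k))
                               * (1 - / r ^ 2 * (r ^ 4) ^ k))).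
      + intros k. unfold X.
        replace (rz r (4 * Z.of_nat k - 2)) with (/ r ^ 2 * (r ^ 4) ^ k); [ring | ].
        assert (E : (r ^ 4) ^ k = r ^ 2 * rz r (4 * Z.of_nat k - 2)).
        { rewrite <- rz_4_nat, <- (rz_nat r 2), <- rz_plus by lra. f_equal. lia. }
        rewrite E. field. now apply r_neq_0.
      + replace (moment_const r) with (moment_const r * (1 - / r ^ 2 * 0)) by ring.
        apply clim_mult; [apply (moment_limit r (fun k => N (Z.of_nat k)) H); intros; apply HN | ].
        apply clim_minus; [apply clim_const | apply clim_scal].
        apply (geom_bounded_lim _ 1 (r ^ 4)); [generalize (r4_in_01 r H); lra | ].
        intros n. rewrite <- !RtoC_pow, Cmod_R, Rabs_pos_eq; [lra | ].
        apply pow_le. generalize (r4_in_01 r H); lra. }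
  intros k. rewrite <- X0, <- (const k). unfold X.
  rewrite <- Cmult_assoc, (Cmult_comm (rz r (- (2 * k)))), rz_opp by lra. ring.
Qed.

Definition wU (r t : R) : C := expi (- t) * wP r t * wQ r t.

(** With k = (1 - s) / 2 the closed form r^(2k) / (1 - r^(4k-2)) of the moment
    is r / (r^s - r^(-s)). *)
Lemma integral_wU (r : R) (s : Z) :
  (0 < r < 1)%R -> Z.odd s = true ->
  is_integral_0_pi (fun t => expi (IZR s * t) * wU r t)
    (PI * moment_const r * r / (rz r s - rz r (- s))).
Proof.
  intros H Hs. apply Z.odd_spec in Hs. destruct Hs as [m Hm].
  assert (ex : exists N : Z -> C, forall k,
     has_sum (fun j => coefQ r j * coefZ r (k + Z.of_nat j)) (N k) /\
     is_integral_0_pi (fun t => expi (2 * IZR (- k) * t) * wP r t * wQ r t) (PI * N k)).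
  { exists (fun k => proj1_sig (constructive_indefinite_description _ (integral_wPQ r k H))).
    intros k. exact (proj2_sig (constructive_indefinite_description _ (integral_wPQ r k H))). }
  destruct ex as [N HN].
  assert (Cf := moment_closed_form r N H (fun k => proj1 (HN k)) (- m)).
  refine (integral_ext _ _ _ _ (proj2 (HN (- m)%Z)) _ _).
  - intros t. unfold wU. rewrite Z.opp_involutive.
    replace (2 * IZR m * t)%R with (IZR s * t + - t)%R
      by (rewrite Hm, plus_IZR, mult_IZR; ring).
    rewrite expi_plus. ring.
  - assert (S0 : rz r s <> 0) by (apply rz_neq_0; lra).
    assert (I := rz_opp r s (proj1 H)).
    assert (D : rz r s * rz r s - 1 <> 0).
    { intros E. apply (rz_neq_1 r (s + s) H); [lia | ].
      rewrite rz_plus by lra.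
      replace (rz r s * rz r s) with (rz r s * rz r s - 1 + 1) by ring. rewrite E. ring. }
    assert (J : rz r (- s) = / rz r s).
    { rewrite <- (Cmult_1_l (/ rz r s)), <- I. field. exact S0. }
    replace (rz r (4 * - m - 2)) with (/ (rz r s * rz r s)) in Cf.
    2:{ replace (4 * - m - 2)%Z with (- s + - s)%Z by lia.
        rewrite rz_plus, J by lra. field. exact S0. }
    replace (rz r (2 * - m)) with (r * / rz r s) in Cf.
    2:{ replace (2 * - m)%Z with (Z.of_nat 1 + - s)%Z by lia.
        rewrite rz_plus, rz_nat, J by lra. simpl. ring. }
    rewrite J.
    replace (N (- m)%Z) with (N (- m)%Z * (1 - / (rz r s * rz r s))
       * (rz r s * rz r s / (rz r s * rz r s - 1))) by (field; auto).
    rewrite Cf. field. auto.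
Qed.

(** * Continuous q-Hermite polynomials *)

(** The pair (h_(n-1), h_n), where h_n = H_n(x|q) / (q;q)_n for the continuous
    q-Hermite polynomials H_n and X = 2 x. *)
Fixpoint herm_pair (q : R) (X : C) (n : nat) : C * C :=
  match n with
  | O => (RtoC 0, RtoC 1)
  | S m => (snd (herm_pair q X m),
            (X * snd (herm_pair q X m) - fst (herm_pair q X m)) / (1 - q * q ^ m))
  end.

Definition herm (q : R) (n : nat) (X : C) : C := snd (herm_pair q X n).
Definition herm_prev (q : R) (n : nat) (X : C) : C := fst (herm_pair q X n).

Lemma herm_S (q : R) (n : nat) (X : C) :
  (0 < q < 1)%R ->
  (1 - q * q ^ n) * herm q (S n) X = X * herm q n X - herm_prev q n X.
Proof.
  intros Hq. unfold herm, herm_prev. simpl. field. now apply one_minus_pow_neq_0.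
Qed.

Lemma nat_ind2 (P : nat -> Prop) :
  P 0%nat -> P 1%nat -> (forall n, P n -> P (S n) -> P (S (S n))) -> forall n, P n.
Proof.
  intros H0 H1 H n. enough (P n /\ P (S n)) by tauto.
  induction n; [auto | ]. destruct IHn. auto.
Qed.

Lemma Cmult_cancel_l (a x y : C) : a <> 0 -> a * x = a * y -> x = y.
Proof.
  intros Ha H. replace x with (/ a * (a * x)) by (field; exact Ha).
  rewrite H. field. exact Ha.
Qed.

Lemma one_minus_neq_0 (q : R) : (0 < q < 1)%R -> 1 - q <> 0.
Proof.
  intros Hq. generalize (one_minus_pow_neq_0 q 0 Hq). simpl. now rewrite Cmult_1_r.
Qed.

(** In h_n(z) = sum over j + k = n of z^(j-k) / ((q)_j (q)_k) the shift multiplies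
    s^n times a term by q^j = 1 - (1 - q^j), and 1 - q^j lowers j. *)
Lemma herm_shift (q : R) (s z : C) (n : nat) :
  (0 < q < 1)%R -> s ^ 2 = q -> z <> 0 ->
  s ^ n * herm q n (s * z + / (s * z))
  = herm q n (z + / z) - z * herm_prev q n (z + / z).
Proof.
  intros Hq Hs Hz.
  assert (S0 : s <> 0).
  { intros E. rewrite E in Hs. assert (A : RtoC q = 0) by (rewrite <- Hs; ring).
    apply (RtoC_neq q 0); [lra | exact A]. }
  assert (Q0 : forall n, 1 - q * q ^ n <> 0) by (intros; now apply one_minus_pow_neq_0).
  revert n. apply nat_ind2.
  - unfold herm, herm_prev. simpl. ring.
  - unfold herm, herm_prev. simpl. rewrite <- Hs. field.
    repeat split; try assumption. rewrite Hs. now apply one_minus_neq_0.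
  - intros n Pn Pn1. apply (Cmult_cancel_l (1 - q * q ^ S n)); [apply Q0 | ].
    assert (A := herm_S q (S n) (s * z + / (s * z)) Hq).
    assert (B := herm_S q (S n) (z + / z) Hq).
    assert (D := herm_S q n (z + / z) Hq).
    change (herm_prev q (S n) (s * z + / (s * z))) with (herm q n (s * z + / (s * z))) in A.
    change (herm_prev q (S n) (z + / z)) with (herm q n (z + / z)) in B, Pn1.
    change (herm_prev q (S (S n)) (z + / z)) with (herm q (S n) (z + / z)).
    transitivity (s ^ S (S n) * ((1 - q * q ^ S n) * herm q (S (S n)) (s * z + / (s * z)))); [ring | ].
    rewrite A.
    transitivity (s * (s * z + / (s * z)) * (s ^ S n * herm q (S n) (s * z + / (s * z)))
                  - s ^ 2 * (s ^ n * herm q n (s * z + / (s * z)))); [simpl; ring | ].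
    rewrite Pn, Pn1.
    transitivity ((1 - q * q ^ S n) * herm q (S (S n)) (z + / z)
                  - z * ((1 - q * q ^ S n) * herm q (S n) (z + / z))); [ | ring].
    rewrite B.
    set (a := herm q (S n) (z + / z)) in *. set (b := herm q n (z + / z)) in *.
    set (c := herm_prev q n (z + / z)) in *.
    transitivity ((z + / z) * a - b - z * a + s ^ 2 * z * (a - (z + / z) * b + c)).
    { field. auto. }
    replace (a - (z + / z) * b + c) with (a - (1 - q * q ^ n) * a) by (rewrite D; ring).
    rewrite Hs. simpl. ring.
Qed.

Definition shift_diff (r : R) (f : C -> C) (z : C) : C :=
  f (r ^ 2 * z) - f (/ r ^ 2 * z).

(** The polynomial depends on z only through z + 1/z, so the shift by q^(-1/2)
    is the shift by q^(1/2) at 1/z. *)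
Lemma herm_shift_diff (r : R) (z : C) (n : nat) :
  (0 < r < 1)%R -> z <> 0 ->
  (r ^ 2) ^ n * shift_diff r (fun z => herm (r ^ 4) n (z + / z)) z
  = (/ z - z) * herm_prev (r ^ 4) n (z + / z).
Proof.
  intros H Hz. assert (R0 := r_neq_0 r H).
  assert (E : (r ^ 2) ^ 2 = (r ^ 4)%R) by (rewrite RtoC_pow; ring).
  assert (Z0 : / z <> 0).
  { intros E'. assert (A : z * / z = 1) by (field; exact Hz). rewrite E' in A.
    apply (RtoC_neq 0 1); [lra | ]. rewrite <- A. ring. }
  assert (U := herm_shift (r ^ 4) (r ^ 2) z n (r4_in_01 r H) E Hz).
  assert (D := herm_shift (r ^ 4) (r ^ 2) (/ z) n (r4_in_01 r H) E Z0).
  unfold shift_diff.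
  replace (/ r ^ 2 * z + / (/ r ^ 2 * z)) with (r ^ 2 * / z + / (r ^ 2 * / z))
    by (field; auto).
  replace (/ z + / / z) with (z + / z) in D by (field; auto).
  transitivity ((r ^ 2) ^ n * herm (r ^ 4) n (r ^ 2 * z + / (r ^ 2 * z))
    - (r ^ 2) ^ n * herm (r ^ 4) n (r ^ 2 * / z + / (r ^ 2 * / z))); [ring | ].
  rewrite U, D. ring.
Qed.

(** * q-integration by parts *)

(** Laurent polynomials all of whose exponents j - k have the given parity, as
    functions on the nonzero complex numbers. *)
Inductive laurent (odd : bool) : (C -> C) -> Prop :=
| laurent_mono (j k : nat) :
    Nat.odd (j + k) = odd -> laurent odd (fun z => z ^ j * (/ z) ^ k)
| laurent_plus (f g : C -> C) :
    laurent odd f -> laurent odd g -> laurent odd (fun z => f z + g z)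
| laurent_scal (c : C) (f : C -> C) :
    laurent odd f -> laurent odd (fun z => c * f z)
| laurent_ext (f g : C -> C) :
    (forall z : C, z <> 0 -> f z = g z) -> laurent odd f -> laurent odd g.

Lemma laurent_0 (odd : bool) : laurent odd (fun _ => 0).
Proof.
  apply (laurent_ext _ (fun z => 0 * (z ^ (if odd then 1 else 0)%nat * (/ z) ^ 0))).
  - intros; ring.
  - apply laurent_scal, laurent_mono. now destruct odd.
Qed.

Lemma laurent_mul_X (odd : bool) (f : C -> C) :
  laurent odd f -> laurent (negb odd) (fun z => (z + / z) * f z).
Proof.
  intros H. induction H as [j k E | f g _ IHf _ IHg | c f _ IHf | f g E _ IHf].
  - apply (laurent_ext _ (fun z => z ^ S j * (/ z) ^ k + z ^ j * (/ z) ^ S k)).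
    + intros; simpl; ring.
    + apply laurent_plus; apply laurent_mono; rewrite <- E.
      * now rewrite Nat.add_succ_l, Nat.odd_succ, <- Nat.negb_odd.
      * now rewrite Nat.add_succ_r, Nat.odd_succ, <- Nat.negb_odd.
  - refine (laurent_ext _ _ _ _ (laurent_plus _ _ _ IHf IHg)). intros; simpl; ring.
  - refine (laurent_ext _ _ _ _ (laurent_scal _ c _ IHf)). intros; simpl; ring.
  - refine (laurent_ext _ _ _ _ IHf). intros z Hz; simpl. now rewrite E.
Qed.

Lemma laurent_herm (q : R) (n : nat) :
  (0 < q < 1)%R -> laurent (Nat.odd n) (fun z => herm q n (z + / z)).
Proof.
  intros Hq. revert n. apply nat_ind2.
  - refine (laurent_ext _ _ _ _ (laurent_mono _ 0 0 eq_refl)).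
    intros z _. unfold herm. simpl. ring.
  - refine (laurent_ext _ _ _ _ (laurent_scal _ (/ (1 - q)) _
              (laurent_mul_X _ _ (laurent_mono _ 0 0 eq_refl)))).
    intros z Hz. unfold herm. simpl.
    assert (N := one_minus_neq_0 q Hq). field. auto.
  - intros n P0 P1. rewrite Nat.odd_succ, <- Nat.negb_odd.
    apply (laurent_ext _ (fun z => / (1 - q * q ^ S n) *
       ((z + / z) * herm q (S n) (z + / z) + (- (1)) * herm q n (z + / z)))).
    + intros z Hz.
      assert (N := one_minus_pow_neq_0 q (S n) Hq).
      apply (Cmult_cancel_l (1 - q * q ^ S n)); [exact N | ].
      rewrite herm_S by exact Hq.
      change (herm_prev q (S n) (z + / z)) with (herm q n (z + / z)).
      set (N' := 1 - q * q ^ S n) in *. field. auto.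
    + apply laurent_scal, laurent_plus; [now apply laurent_mul_X | ].
      apply laurent_scal. rewrite Nat.odd_succ, <- Nat.negb_odd, Bool.negb_involutive.
      exact P0.
Qed.

Lemma laurent_csum (odd : bool) (f : nat -> C -> C) (n : nat) :
  (forall k, laurent odd (f k)) -> laurent odd (fun z => csum (fun k => f k z) n).
Proof.
  intros H. induction n; simpl; [apply laurent_0 | now apply laurent_plus].
Qed.

Lemma Cinv_neq_0 (z : C) : z <> 0 -> / z <> 0.
Proof.
  intros Hz E. assert (A : z * / z = 1) by (field; exact Hz). rewrite E in A.
  apply (RtoC_neq 0 1); [lra | ]. rewrite <- A. ring.
Qed.

Lemma mono_mult (j k : nat) (x y : C) :
  x <> 0 -> y <> 0 ->
  (x * y) ^ j * (/ (x * y)) ^ k = (x ^ j * (/ x) ^ k) * (y ^ j * (/ y) ^ k).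
Proof.
  intros Hx Hy. replace (/ (x * y)) with (/ x * / y) by (field; auto).
  rewrite !Cpow_mult_l. ring.
Qed.

Lemma mono_inv (j k : nat) (x : C) :
  x <> 0 -> ((/ x) ^ j * (/ / x) ^ k) * (x ^ j * (/ x) ^ k) = 1.
Proof.
  intros Hx. rewrite <- mono_mult by (auto using Cinv_neq_0).
  replace (/ x * x) with (RtoC 1) by (field; exact Hx).
  replace (/ 1) with (RtoC 1) by field. rewrite !Cpow_1_l. ring.
Qed.

Lemma mono_real (r : R) (j k : nat) :
  (0 < r)%R -> r ^ j * (/ r) ^ k = rz r (Z.of_nat j - Z.of_nat k).
Proof.
  intros H. assert (R0 : RtoC r <> 0) by (apply RtoC_neq; lra).
  apply (Cmult_cancel_l (r ^ k)); [now apply Cpow_nz | ].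
  rewrite <- (rz_nat r k), <- rz_plus by exact H.
  replace (Z.of_nat k + (Z.of_nat j - Z.of_nat k))%Z with (Z.of_nat j) by lia.
  rewrite !rz_nat, Cpow_inv by exact R0. field. now apply Cpow_nz.
Qed.

Lemma mono_expi (t : R) (j k : nat) :
  expi t ^ j * (/ expi t) ^ k = expi (IZR (Z.of_nat j - Z.of_nat k) * t).
Proof.
  rewrite <- expi_opp, !expi_pow, <- expi_plus, minus_IZR, <- !INR_IZR_INZ.
  f_equal. ring.
Qed.

(** For monomials z^a, z^b with a + b odd the difference operator produces
    r^(2a) - r^(-2a) + r^(2b) - r^(-2b) = (r^(a+b) - r^(-a-b)) (r^(a-b) + r^(b-a)),
    and the first factor is the denominator of the Fourier coefficient of index
    a + b. *)
Lemma q_integration_by_parts (r : R) (f g : C -> C) :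
  (0 < r < 1)%R -> laurent false f -> laurent true g ->
  is_integral_0_pi
    (fun t => (shift_diff r f (expi t) * g (expi t)
               + f (expi t) * shift_diff r g (expi t)) * wU r t)
    (PI * moment_const r * r * (f r * g (/ r) + f (/ r) * g r)).
Proof.
  intros H Hf Hg. assert (R0 := r_neq_0 r H).
  assert (R2 : RtoC r ^ 2 <> 0) by now apply Cpow_nz.
  induction Hf as [j k Ef | f1 f2 _ IH1 _ IH2 | c f _ IH | f1 f2 E _ IH].
  - induction Hg as [j' k' Eg | g1 g2 _ IH1 _ IH2 | c g _ IH | g1 g2 E _ IH].
    + set (a := (Z.of_nat j - Z.of_nat k)%Z). set (b := (Z.of_nat j' - Z.of_nat k')%Z).
      assert (odd_ab : Z.odd (a + b) = true).
      { replace (a + b)%Z with (Z.of_nat (j + k) + Z.of_nat (j' + k')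
          + 2 * (- Z.of_nat k - Z.of_nat k'))%Z by (unfold a, b; lia).
        apply Z.odd_spec.
        destruct (Nat.Even_or_Odd (j + k)) as [[u Hu] | O].
        2:{ apply Nat.odd_spec in O. congruence. }
        apply Nat.odd_spec in Eg. destruct Eg as [v Hv].
        exists (Z.of_nat u + Z.of_nat v - Z.of_nat k - Z.of_nat k')%Z. lia. }
      refine (integral_ext _ _ _ _ (integral_scal
        (rz r a * rz r a - rz r (- a) * rz r (- a) + (rz r b * rz r b - rz r (- b) * rz r (- b)))
        _ _ (integral_wU r (a + b) H odd_ab)) _ _).
      * intros t. assert (T := expi_neq_0 t). unfold shift_diff.
        rewrite !(mono_mult _ _ _ (expi t)) by auto using Cinv_neq_0.
        rewrite !mono_expi. fold a b.
        assert (P : forall j k, (r ^ 2) ^ j * (/ r ^ 2) ^ k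
          = rz r (Z.of_nat j - Z.of_nat k) * rz r (Z.of_nat j - Z.of_nat k)).
        { intros x y. replace (RtoC r ^ 2) with (r * r) by ring.
          rewrite mono_mult, mono_real by (try lra; exact R0). reflexivity. }
        assert (M : forall j k, (/ r ^ 2) ^ j * (/ / r ^ 2) ^ k
          = rz r (- (Z.of_nat j - Z.of_nat k)) * rz r (- (Z.of_nat j - Z.of_nat k))).
        { intros x y. set (n := (Z.of_nat x - Z.of_nat y)%Z).
          apply (Cmult_cancel_l (rz r n * rz r n)).
          - apply Cmult_neq_0; apply rz_neq_0; lra.
          - unfold n at 1 2. rewrite <- P, Cmult_comm, mono_inv by exact R2.
            assert (I := rz_opp r n (proj1 H)).
            transitivity ((rz r n * rz r (- n)) * (rz r n * rz r (- n))); [ | ring].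
            rewrite I. ring. }
        rewrite !P, !M. fold a b.
        rewrite plus_IZR, Rmult_plus_distr_r, expi_plus. ring.
      * assert (S0 : forall j k, (/ r) ^ j * (/ / r) ^ k = rz r (- (Z.of_nat j - Z.of_nat k))).
        { intros x y. set (n := (Z.of_nat x - Z.of_nat y)%Z).
          apply (Cmult_cancel_l (rz r n)); [apply rz_neq_0; lra | ].
          rewrite (rz_opp r n (proj1 H)). unfold n. rewrite <- mono_real, Cmult_comm by lra.
          now apply mono_inv. }
        rewrite !S0, !mono_real by lra. fold a b.
        assert (A0 := rz_neq_0 r a (proj1 H)). assert (B0 := rz_neq_0 r b (proj1 H)).
        assert (inv : forall n, rz r (- n) = / rz r n).
        { intros n. apply (Cmult_cancel_l (rz r n)); [apply rz_neq_0; lra | ].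
          rewrite rz_opp by lra. field. apply rz_neq_0; lra. }
        assert (D : (rz r a * rz r b) * (rz r a * rz r b) - 1 <> 0).
        { intros E. apply (rz_neq_1 r (a + b + (a + b)) H).
          - apply Z.odd_spec in odd_ab. destruct odd_ab. lia.
          - rewrite !rz_plus by lra.
            replace (rz r a * rz r b * (rz r a * rz r b))
              with (rz r a * rz r b * (rz r a * rz r b) - 1 + 1) by ring.
            rewrite E. ring. }
        rewrite !inv, !rz_plus by lra.
        set (x := rz r a) in *. set (y := rz r b) in *.
        field. repeat split; try assumption.
    + refine (integral_ext _ _ _ _ (integral_plus _ _ _ _ IH1 IH2) _ _).
      * intros t. unfold shift_diff. ring.
      * ring.
    + refine (integral_ext _ _ _ _ (integral_scal c _ _ IH) _ _).
      * intros t. unfold shift_diff. ring.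
      * ring.
    + assert (E0 := fun t => expi_neq_0 t).
      refine (integral_ext _ _ _ _ IH _ _).
      * intros t. unfold shift_diff.
        rewrite (E (r ^ 2 * expi t)), (E (/ r ^ 2 * expi t)), (E (expi t))
          by auto using Cmult_neq_0, Cinv_neq_0. ring.
      * rewrite !E by auto using Cinv_neq_0. ring.
  - refine (integral_ext _ _ _ _ (integral_plus _ _ _ _ IH1 IH2) _ _).
    + intros t. unfold shift_diff. ring.
    + ring.
  - refine (integral_ext _ _ _ _ (integral_scal c _ _ IH) _ _).
    + intros t. unfold shift_diff. ring.
    + ring.
  - assert (E0 := fun t => expi_neq_0 t).
    refine (integral_ext _ _ _ _ IH _ _).
    + intros t. unfold shift_diff.
      rewrite (E (r ^ 2 * expi t)), (E (/ r ^ 2 * expi t)), (E (expi t))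
          by auto using Cmult_neq_0, Cinv_neq_0. ring.
    + rewrite !E by auto using Cinv_neq_0. ring.
Qed.

Lemma Rpower_half (r : R) : (0 < r < 1)%R -> Rpower (r ^ 4) (1 / 2) = (r ^ 2)%R.
Proof.
  intros H. rewrite <- (Rpower_pow 4 r), Rpower_mult by lra.
  rewrite <- (Rpower_pow 2 r) by lra. f_equal. simpl. lra.
Qed.

Lemma Rpower_quarter (r : R) : (0 < r < 1)%R -> Rpower (r ^ 4) (1 / 4) = r.
Proof.
  intros H. rewrite <- (Rpower_pow 4 r), Rpower_mult by lra.
  replace (INR 4 * (1 / 4))%R with 1%R by (simpl; lra). apply Rpower_1; lra.
Qed.

Lemma fourth_root (q : R) : (0 < q < 1)%R -> exists r, (0 < r < 1)%R /\ q = (r ^ 4)%R.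
Proof.
  intros Hq. exists (Rpower q (1 / 4)). split; [split; [apply exp_pos | ] | ].
  - unfold Rpower. apply Rlt_le_trans with (exp 0); [ | rewrite exp_0; lra].
    apply exp_increasing.
    assert (ln q < 0)%R by (rewrite <- ln_1; apply ln_increasing; lra). lra.
  - rewrite <- Rpower_pow by apply exp_pos. rewrite Rpower_mult.
    replace (1 / 4 * INR 4)%R with 1%R by (simpl; lra). rewrite Rpower_1; lra.
Qed.

(** (z^(-2); q)_oo = z^(-1) (z - 1/z) (q z^(-2); q)_oo for z = e^(i t). *)
Lemma weight_factor (r t : R) :
  (0 < r < 1)%R -> weight (r ^ 4) t = (expi t - / expi t) * wU r t.
Proof.
  intros H. assert (Q := r4_in_01 r H). assert (R2 := r2_in_01 r H).
  assert (T := expi_neq_0 t).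
  unfold weight, wU, wP, wQ. rewrite Rpower_half by exact H.
  rewrite (qpoch_inf_shift (r ^ 4) (expi (- (2 * t))) Q).
  replace (expi (- (2 * t)) * (r ^ 4)%R) with (r ^ 4 * expi (- (2 * t)))
    by (rewrite RtoC_pow; ring).
  rewrite !(RtoC_pow r 2).
  assert (N : forall x, qpoch_inf (r ^ 2 * expi x) (r ^ 4)%R <> 0).
  { intros x. apply qpoch_inf_disc_neq_0; [exact Q | ].
    rewrite Cmod_mult, Cmod_expi, Cmod_r2 by exact H. lra. }
  assert (N1 := N (2 * t)%R). assert (N2 := N (- (2 * t))%R).
  replace (expi (- (2 * t))) with (/ expi t * / expi t) in *.
  2:{ rewrite <- expi_opp, <- expi_plus. f_equal. ring. }
  rewrite !expi_opp.
  set (A := qpoch_inf (r ^ 2 * expi (2 * t)) (r ^ 4)%R) in *.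
  set (B := qpoch_inf (r ^ 2 * (/ expi t * / expi t)) (r ^ 4)%R) in *.
  field. auto.
Qed.

(** (-q v^2; q^2)_oo times the basic cosine (d = 0) or sine (d = 1) is the sum of
    these terms over n; X = 2 x. *)
Definition term (r : R) (d : nat) (v X : C) (n : nat) : C :=
  (- (1)) ^ n * r ^ ((2 * n + d) * (2 * n + d)) * herm (r ^ 4) (2 * n + d) X * v ^ (2 * n + d).

Definition part (r : R) (d : nat) (v X : C) (N : nat) : C := csum (term r d v X) N.

Definition norm_const (r : R) : C :=
  (qpoch_inf (r ^ 2) (r ^ 4)%R) ^ 2 / (qpoch_inf (r ^ 4) (r ^ 4)%R) ^ 2.

Lemma laurent_part (r : R) (d : nat) (v : C) (N : nat) :
  (0 < r < 1)%R -> laurent (Nat.odd d) (fun z => part r d v (z + / z) N).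
Proof.
  intros H. unfold part. apply (laurent_csum _ (fun n z => term r d v (z + / z) n)).
  intros n. unfold term.
  apply (laurent_ext _ (fun z => ((- (1)) ^ n * r ^ ((2 * n + d) * (2 * n + d)) * v ^ (2 * n + d))
    * herm (r ^ 4) (2 * n + d) (z + / z))); [intros; ring | ].
  apply laurent_scal. replace (Nat.odd d) with (Nat.odd (2 * n + d)).
  - apply laurent_herm. now apply r4_in_01.
  - rewrite Nat.add_comm, Nat.odd_add_mul_2. reflexivity.
Qed.

Lemma shift_diff_csum (r : R) (f : nat -> C -> C) (N : nat) (z : C) :
  shift_diff r (fun z => csum (fun n => f n z) N) z
  = csum (fun n => shift_diff r (f n) z) N.
Proof.
  unfold shift_diff. induction N; cbn [csum]; [ring | rewrite <- IHN; ring].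
Qed.

Lemma shift_diff_term (r : R) (d n : nat) (v z : C) :
  (0 < r < 1)%R -> z <> 0 ->
  (r ^ 2) ^ (2 * n + d) * shift_diff r (fun z => term r d v (z + / z) n) z
  = (- (1)) ^ n * r ^ ((2 * n + d) * (2 * n + d)) * v ^ (2 * n + d)
    * ((/ z - z) * herm_prev (r ^ 4) (2 * n + d) (z + / z)).
Proof.
  intros H Hz. rewrite <- herm_shift_diff by assumption.
  unfold shift_diff, term. ring.
Qed.

(** The exponents match because (2n+2)^2 - 2 (2n+2) = (2n+1)^2 - 1; the term n = 0
    is constant and disappears. *)
Lemma shift_diff_part_even (r : R) (v z : C) (N : nat) :
  (0 < r < 1)%R -> z <> 0 ->
  r * shift_diff r (fun z => part r 0 v (z + / z) (S N)) z
  = - (/ z - z) * v * part r 1 v (z + / z) N.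
Proof.
  intros H Hz. assert (R0 := r_neq_0 r H).
  unfold part. rewrite (shift_diff_csum r (fun n z => term r 0 v (z + / z) n)).
  rewrite csum_first.
  replace (shift_diff r (fun z => term r 0 v (z + / z) 0) z) with (RtoC 0)
    by (unfold shift_diff, term, herm; simpl; ring).
  rewrite Cplus_0_l, <- !csum_scal. apply csum_ext. intros n _.
  apply (Cmult_cancel_l ((r ^ 2) ^ (2 * S n + 0))); [now repeat apply Cpow_nz | ].
  transitivity (r * ((r ^ 2) ^ (2 * S n + 0)
                     * shift_diff r (fun z => term r 0 v (z + / z) (S n)) z)); [ring | ].
  rewrite shift_diff_term by assumption.
  unfold term.
  replace (2 * S n + 0)%nat with (S (2 * n + 1)) by lia.
  change (herm_prev (r ^ 4) (S (2 * n + 1)) (z + / z)) with (herm (r ^ 4) (2 * n + 1) (z + / z)).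
  rewrite <- Cpow_mult_r.
  replace (S (2 * n + 1) * S (2 * n + 1))%nat
    with ((2 * n + 1) * (2 * n + 1) + (2 * (2 * n + 1) + 1))%nat by lia.
  replace (2 * S (2 * n + 1))%nat with (S (2 * (2 * n + 1) + 1)) by lia.
  rewrite Cpow_add_r, !Cpow_S. ring.
Qed.

(** Here (2n+1)^2 - 2 (2n+1) = (2n)^2 - 1, and no term is lost. *)
Lemma shift_diff_part_odd (r : R) (v z : C) (N : nat) :
  (0 < r < 1)%R -> z <> 0 ->
  r * shift_diff r (fun z => part r 1 v (z + / z) N) z
  = (/ z - z) * v * part r 0 v (z + / z) N.
Proof.
  intros H Hz. assert (R0 := r_neq_0 r H).
  unfold part. rewrite (shift_diff_csum r (fun n z => term r 1 v (z + / z) n)).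
  rewrite <- !csum_scal. apply csum_ext. intros n _.
  apply (Cmult_cancel_l ((r ^ 2) ^ (2 * n + 1))); [now repeat apply Cpow_nz | ].
  transitivity (r * ((r ^ 2) ^ (2 * n + 1)
                     * shift_diff r (fun z => term r 1 v (z + / z) n) z)); [ring | ].
  rewrite shift_diff_term by assumption.
  unfold term.
  replace (2 * n + 1)%nat with (S (2 * n)) by lia.
  replace (2 * n + 0)%nat with (2 * n)%nat by lia.
  change (herm_prev (r ^ 4) (S (2 * n)) (z + / z)) with (herm (r ^ 4) (2 * n) (z + / z)).
  rewrite <- Cpow_mult_r.
  replace (S (2 * n) * S (2 * n))%nat with (2 * n * (2 * n) + (2 * (2 * n) + 1))%nat by lia.
  replace (2 * S (2 * n))%nat with (S (2 * (2 * n) + 1)) by lia.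
  rewrite Cpow_add_r, !Cpow_S. ring.
Qed.

Lemma two_cos (t : R) : RtoC (2 * cos t) = expi t + / expi t.
Proof.
  rewrite <- expi_opp. unfold expi. rewrite cos_neg, sin_neg.
  apply injective_projections; simpl; ring.
Qed.

(** Integration by parts for the partial sums.  The even one has one term more,
    because the difference operator annihilates its first term. *)
Lemma integral_parts (r : R) (v v' : C) (N : nat) :
  (0 < r < 1)%R ->
  is_integral_0_pi
    (fun t => (v' * (part r 0 v (2 * cos t)%R (S N) * part r 0 v' (2 * cos t)%R N)
               - v * (part r 1 v (2 * cos t)%R N * part r 1 v' (2 * cos t)%R N))
              * weight (r ^ 4) t)
    (2 * PI * norm_const r * (part r 0 v (r + / r)%R (S N) * part r 1 v' (r + / r)%R N)).
Proof.
  intros H. assert (R0 := r_neq_0 r H).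
  refine (integral_ext _ _ _ _ (integral_scal (- r) _ _
    (q_integration_by_parts r (fun z => part r 0 v (z + / z) (S N))
       (fun z => part r 1 v' (z + / z) N) H
       (laurent_part r 0 v (S N) H) (laurent_part r 1 v' N H))) _ _).
  - intros t. assert (T := expi_neq_0 t). rewrite two_cos, weight_factor by exact H.
    set (z := expi t) in *.
    transitivity (((- (r * shift_diff r (fun z => part r 0 v (z + / z) (S N)) z)
                      * part r 1 v' (z + / z) N)
      - part r 0 v (z + / z) (S N)
        * (r * shift_diff r (fun z => part r 1 v' (z + / z) N) z)) * wU r t); [ring | ].
    rewrite shift_diff_part_even, shift_diff_part_odd by assumption. ring.
  - replace (/ r + / / r) with (r + / r) by (field; exact R0).
    rewrite RtoC_plus, RtoC_inv by lra.
    unfold moment_const, norm_const.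
    assert (N0 : qpoch_inf (r ^ 4) (r ^ 4)%R <> 0)
      by (rewrite <- RtoC_pow; apply qpoch_inf_qq_neq_0; now apply r4_in_01).
    field. auto.
Qed.

(** * Convergence of the series *)

(** On |X| <= M the recurrence gives |h_n| <= herm_max^n, and the Gaussian factor
    r^(n^2) of the terms beats every such power. *)
Definition herm_max (q M : R) : R := ((M + 1) / (1 - q))%R.

Lemma herm_bound (q M : R) (X : C) (n : nat) :
  (0 < q < 1)%R -> (Cmod X <= M)%R -> (Cmod (herm q n X) <= herm_max q M ^ n)%R.
Proof.
  intros Hq HX. assert (X0 := Cmod_ge_0 X).
  set (B := herm_max q M).
  assert (B1 : (M + 1 = B * (1 - q))%R) by (unfold B, herm_max; field; lra).
  assert (B2 : (1 <= B)%R).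
  { unfold B, herm_max. apply Rmult_le_reg_r with (1 - q)%R; [lra | ].
    unfold Rdiv. rewrite Rmult_assoc, Rinv_l by lra. lra. }
  assert (low : forall n, (1 - q <= Cmod (1 - q * q ^ n))%R).
  { intros m. destruct (pow_in_01 q m Hq).
    rewrite <- RtoC_pow, <- RtoC_mult, <- RtoC_minus, Cmod_R, Rabs_pos_eq; nra. }
  assert (cancel : forall m a b, (Cmod (1 - q * q ^ m) * a <= (1 - q) * b -> 0 <= a -> a <= b)%R).
  { intros m a b Hab Ha. specialize (low m).
    assert ((1 - q) * a <= (1 - q) * b)%R; [ | nra].
    eapply Rle_trans; [ | exact Hab]. apply Rmult_le_compat_r; assumption. }
  revert n. apply nat_ind2.
  - unfold herm. simpl. rewrite Cmod_1. lra.
  - apply (cancel 0%nat); [ | apply Cmod_ge_0].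
    rewrite <- Cmod_mult, herm_S by exact Hq. unfold herm, herm_prev. simpl.
    replace (X * 1 - 0) with X by ring. nra.
  - intros n P0 P1. apply (cancel (S n)); [ | apply Cmod_ge_0].
    rewrite <- Cmod_mult, herm_S by exact Hq.
    change (herm_prev q (S n) X) with (herm q n X).
    eapply Rle_trans; [apply Cmod_triangle | ]. rewrite Cmod_mult, Cmod_opp.
    assert (Pn : (0 <= B ^ n)%R) by (apply pow_le; lra).
    simpl in P1 |- *.
    apply Rle_trans with (M * (B * B ^ n) + B * B ^ n)%R.
    + apply Rplus_le_compat.
      * apply Rmult_le_compat; try apply Cmod_ge_0; assumption.
      * eapply Rle_trans; [exact P0 | ]. rewrite <- (Rmult_1_l (B ^ n)) at 1.
        apply Rmult_le_compat_r; lra.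
    + right. transitivity ((M + 1) * (B * B ^ n))%R; [ring | rewrite B1; ring].
Qed.

Lemma herm_max_pos (q M : R) : (0 < q < 1)%R -> (0 <= M)%R -> (0 < herm_max q M)%R.
Proof. intros. apply Rdiv_lt_0_compat; lra. Qed.

Definition term_max (r A : R) (d n : nat) : R :=
  (r ^ ((2 * n + d) * (2 * n + d)) * A ^ (2 * n + d))%R.

Lemma term_bound (r V M : R) (d n : nat) (v X : C) :
  (0 < r < 1)%R -> (Cmod v <= V)%R -> (Cmod X <= M)%R ->
  (Cmod (term r d v X n) <= term_max r (herm_max (r ^ 4) M * V) d n)%R.
Proof.
  intros H Hv HX. unfold term, term_max.
  rewrite !Cmod_mult, !Cmod_pow, Cmod_opp, Cmod_1, pow1, Rmult_1_l, Cmod_R, Rabs_pos_eq by lra.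
  rewrite Rpow_mult_distr, <- Rmult_assoc.
  assert (R1 : (0 <= r ^ ((2 * n + d) * (2 * n + d)))%R) by (apply pow_le; lra).
  apply Rmult_le_compat.
  - apply Rmult_le_pos; [exact R1 | apply Cmod_ge_0].
  - apply pow_le, Cmod_ge_0.
  - apply Rmult_le_compat_l; [exact R1 | ].
    apply herm_bound; [now apply r4_in_01 | exact HX].
  - apply pow_incr. split; [apply Cmod_ge_0 | exact Hv].
Qed.

Lemma ex_series_gauss (r A : R) (s d : nat) :
  (0 < r < 1)%R -> (0 < A)%R -> (0 < s)%nat ->
  ex_series (fun n => r ^ ((s * n + d) * (s * n + d)) * A ^ (s * n + d))%R.
Proof.
  intros H HA Hs.
  apply ex_series_Rabs, ex_series_DAlembert with (k := 0%R); [lra | | ].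
  - intros n. apply Rgt_not_eq. apply Rmult_lt_0_compat; apply pow_lt; lra.
  - apply (is_lim_seq_ext
      (fun n => (r ^ (s * s + 2 * s * d) * A ^ s) * (r ^ (2 * (s * s))) ^ n)%R).
    + intros n.
      replace (s * S n + d)%nat with ((s * n + d) + s)%nat by lia.
      replace ((s * n + d + s) * (s * n + d + s))%nat
        with ((s * n + d) * (s * n + d) + (s * s + 2 * s * d + 2 * (s * s) * n))%nat by lia.
      set (m := (s * n + d)%nat).
      rewrite !pow_add, <- pow_mult.
      assert (r ^ (m * m) <> 0)%R by (apply pow_nonzero; lra).
      assert (A ^ m <> 0)%R by (apply pow_nonzero; lra).
      rewrite Rabs_pos_eq.
      * field. auto.
      * apply Rmult_le_pos; [ | left; apply Rinv_0_lt_compat; apply Rmult_lt_0_compat; apply pow_lt; lra].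
        repeat first [apply pow_le; lra | apply Rmult_le_pos].
    + apply (is_lim_seq_eq _ ((r ^ (s * s + 2 * s * d) * A ^ s) * 0)%R); [ | ring].
      apply is_lim_seq_mult'; [apply is_lim_seq_const | ].
      apply pow_lim_0. split; [apply pow_lt; lra | apply pow_lt_1_compat; [lra | lia]].
Qed.

Lemma ex_series_term_max (r A : R) (d : nat) :
  (0 < r < 1)%R -> (0 < A)%R -> ex_series (term_max r A d).
Proof. intros H HA. apply (ex_series_gauss r A 2 d H HA). lia. Qed.

(** * The q-Hermite expansion of the basic cosine and sine *)

Lemma herm_two_steps (q : R) (m : nat) (X : C) :
  (0 < q < 1)%R ->
  (1 - q * q ^ m) * (1 - q * q ^ S m) * herm q (S (S m)) X
  = (X * X - 2) * herm q m X + q ^ m * (1 + q) * herm q m X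
    - (X * herm_prev q m X - (1 - q ^ m) * herm q m X).
Proof.
  intros Hq.
  transitivity ((1 - q * q ^ m) * ((1 - q * q ^ S m) * herm q (S (S m)) X)); [ring | ].
  rewrite herm_S by exact Hq.
  change (herm_prev q (S m) X) with (herm q m X).
  transitivity (X * ((1 - q * q ^ m) * herm q (S m) X) - (1 - q * q ^ m) * herm q m X); [ring | ].
  rewrite herm_S by exact Hq. ring.
Qed.

Lemma herm_three_term (q : R) (m : nat) (X : C) :
  (0 < q < 1)%R ->
  (1 - q * q ^ S (S m)) * (1 - q * q ^ S (S (S m))) * herm q (S (S (S (S m)))) X
  = (X * X - 2) * herm q (S (S m)) X + q ^ S (S m) * (1 + q) * herm q (S (S m)) X
    - herm q m X.
Proof.
  intros Hq. rewrite herm_two_steps by exact Hq.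
  change (herm_prev q (S (S m)) X) with (herm q (S m) X).
  assert (E := herm_S q (S m) X Hq).
  change (herm_prev q (S m) X) with (herm q m X) in E.
  replace (1 - q ^ S (S m)) with (1 - q * q ^ S m) by reflexivity.
  rewrite E. ring.
Qed.

(** 1 / (q^2;q^2)_(n-j), with the usual convention that it is 0 for j > n. *)
Definition conv_weight (q : R) (n j : nat) : C :=
  if Nat.leb j n then / qpoch (q ^ 2)%R (q ^ 2)%R (n - j) else 0.

Lemma q2_in_01 (q : R) : (0 < q < 1)%R -> (0 < q ^ 2 < 1)%R.
Proof. intros H. simpl. nra. Qed.

Lemma conv_weight_up (q : R) (n j : nat) :
  (0 < q < 1)%R -> (j <= S n)%nat ->
  conv_weight q n j = (1 - (q ^ 2) ^ (S n - j)) * conv_weight q (S n) j.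
Proof.
  intros Hq Hj. unfold conv_weight.
  destruct (Nat.leb_spec j (S n)) as [_ | ]; [ | lia].
  destruct (Nat.leb_spec j n) as [L | L].
  - replace (S n - j)%nat with (S (n - j)) by lia.
    cbn [qpoch]. rewrite RtoC_pow, <- Cpow_S.
    assert (A := qpoch_qq_neq_0 (q ^ 2) (n - j) (q2_in_01 q Hq)).
    assert (B := one_minus_pow_neq_0 (q ^ 2) (n - j) (q2_in_01 q Hq)).
    rewrite RtoC_pow in A, B. rewrite <- Cpow_S in B. field. auto.
  - replace (S n - j)%nat with O by lia. simpl. ring.
Qed.

Lemma conv_weight_S (q : R) (n j : nat) : conv_weight q (S n) (S j) = conv_weight q n j.
Proof. reflexivity. Qed.

Definition conv_term (q : R) (d : nat) (X : C) (n j : nat) : C :=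
  q ^ (j * j + d * j) * herm q (2 * j + d) X * conv_weight q n j.

(** The n-th coefficient, in powers of t = - v^2, of the q-Hermite series divided
    by (t; q^2)_oo. *)
Definition conv_sum (q : R) (d : nat) (X : C) (n : nat) : C :=
  csum (conv_term q d X n) (S n).

Lemma conv_weight_gt (q : R) (n j : nat) : (n < j)%nat -> conv_weight q n j = 0.
Proof. intros H. unfold conv_weight. destruct (Nat.leb_spec j n); [lia | reflexivity]. Qed.

(** Multiplication by X^2 - 2 is a three-term operator on the h_(2j+d).  The
    outer two terms shift j, and after the shift the coefficients of h_(2j+d)
    add up to those of the next sum; the boundary terms of the shifts leave the
    range of summation. *)
Lemma conv_sum_step (q : R) (d : nat) (X : C) (n : nat) :
  (0 < q < 1)%R -> (d <= 1)%nat ->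
  let u := q ^ (2 * n + 1 + d) in
  conv_sum q d X (S n) * ((1 - u) * (1 - q * u))
  = conv_sum q d X n * (1 + u * u + u * (X * X - 2)).
Proof.
  intros Hq Hd u.
  assert (Q0 : RtoC q <> 0) by (apply RtoC_neq; lra).
  (* what the sum of the terms below J exchanges with the terms from J on *)
  set (G := fun J : nat => match J with
    | O => RtoC 0
    | S j => u * (q ^ (j * j + d * j) * conv_weight q n j
          * (1 - q * q ^ (2 * j + d)) * (1 - q * q ^ S (2 * j + d)) * herm q (S (S (2 * j + d))) X)
        - u * (q ^ (S j * S j + d * S j) * conv_weight q n (S j) * herm q (2 * j + d) X)
    end).
  assert (tel : forall J, (J <= S (S n))%nat ->
    csum (conv_term q d X n) J * (1 + u * u + u * (X * X - 2))
    = csum (conv_term q d X (S n)) J * ((1 - u) * (1 - q * u)) + G J).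
  { induction J as [ | J IH]; intros HJ; [simpl; ring | ].
    cbn [csum].
    rewrite !Cmult_plus_distr_r, IH by lia.
    enough (E : conv_term q d X n J * (1 + u * u + u * (X * X - 2)) + G J
              = conv_term q d X (S n) J * ((1 - u) * (1 - q * u)) + G (S J)).
    { transitivity (csum (conv_term q d X (S n)) J * ((1 - u) * (1 - q * u))
        + (conv_term q d X n J * (1 + u * u + u * (X * X - 2)) + G J)); [ring | ].
      rewrite E. ring. }
    set (beta := (q ^ 2) ^ (S n - J)).
    set (I1 := conv_weight q (S n) J).
    assert (W0 : conv_weight q n J = (1 - beta) * I1) by (apply conv_weight_up; [exact Hq | lia]).
    assert (W1 : q ^ 2 * conv_weight q n (S J) = (q ^ 2 - beta) * ((1 - beta) * I1)).
    { rewrite <- W0. destruct (Nat.leb_spec J n) as [L | L].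
      - rewrite <- (conv_weight_S q n J), (conv_weight_up q n (S J)) by (assumption || lia).
        unfold beta. replace (S n - J)%nat with (S (S n - S J)) by lia.
        rewrite (Cpow_S (q ^ 2) (S n - S J)). ring.
      - rewrite !conv_weight_gt by lia. ring. }
    assert (U : q ^ (2 * J) * beta = q ^ (2 * n + 2)).
    { unfold beta. rewrite <- Cpow_mult_r, <- Cpow_add_r. f_equal. lia. }
    destruct J as [ | j].
    -
      (* at the lower end h_(d-2) = 0 for d = 0 and d = 1 *)
      unfold G, conv_term. cbn [Nat.mul Nat.add]. rewrite Nat.mul_0_r, Nat.mul_1_r, W0.
      rewrite Nat.mul_0_r in U. rewrite Cmult_1_l in U.
      fold I1.
      assert (W2 : q ^ (1 + d) * conv_weight q n 1 = q ^ d * / q * ((q ^ 2 - beta) * ((1 - beta) * I1))).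
      { rewrite <- W1. rewrite Cpow_add_r. field. exact Q0. }
      cbn [Nat.add] in W2. rewrite W2.
      assert (Uq : u = q ^ d * / q * beta).
      { rewrite U. unfold u. replace (2 * n + 2)%nat with (S (2 * n + 1)) by lia.
        rewrite Cpow_S, Cpow_add_r. field. exact Q0. }
      assert (Z : X * herm_prev q d X - (1 - q ^ d) * herm q d X = 0).
      { destruct d as [ | [ | d]]; [ | | lia]; unfold herm, herm_prev; simpl.
        - ring.
        - field. now apply one_minus_neq_0. }
      assert (T := herm_two_steps q d X Hq). rewrite Z in T.
      set (h := herm q d X) in *. set (h2 := herm q (S (S d)) X) in *.
      transitivity ((1 - beta) * I1 * ((1 + u * u) * h + u * ((X * X - 2) * h))); [simpl; ring | ].
      replace ((X * X - 2) * h) with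
        ((1 - q * q ^ d) * (1 - q * q ^ S d) * h2 - q ^ d * (1 + q) * h) by (rewrite T; ring).
      rewrite Uq. cbn [Cpow].
      destruct d as [ | [ | d]]; [ | | lia]; simpl; field; exact Q0.
    - unfold G, conv_term. fold I1. rewrite W0.
      replace (2 * S j + d)%nat with (S (S (2 * j + d))) by lia.
      set (m := (2 * j + d)%nat).
      replace (S j * S j + d * S j)%nat with ((j * j + d * j) + S m)%nat by (unfold m; lia).
      replace (S (S j) * S (S j) + d * S (S j))%nat
        with ((j * j + d * j) + (m + (m + 2)) + 2)%nat by (unfold m; lia).
      rewrite (Cpow_add_r q (j * j + d * j) (S m)),
        (Cpow_add_r q (j * j + d * j + (m + (m + 2))) 2),
        (Cpow_add_r q (j * j + d * j) (m + (m + 2))), (Cpow_add_r q m (m + 2)), (Cpow_add_r q m 2).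
      change (conv_weight q n j) with I1.
      assert (T := herm_three_term q m X Hq).
      set (w := q ^ (j * j + d * j)).
      set (h0 := herm q m X) in *. set (h2 := herm q (S (S m)) X) in *.
      set (h4 := herm q (S (S (S (S m)))) X) in *.
      assert (Uq : u = q ^ m * q * beta).
      { apply (Cmult_cancel_l (q ^ 1)); [now apply Cpow_nz | ].
        transitivity (q ^ d * q ^ (2 * n + 2)).
        - unfold u. rewrite <- !Cpow_add_r. f_equal. lia.
        - rewrite <- U. replace (2 * S j)%nat with (2 * j + 2)%nat by lia.
          unfold m. rewrite !Cpow_add_r. ring. }
      replace (q ^ 2 * conv_weight q n (S (S j))) with
        ((q ^ 2 - beta) * ((1 - beta) * I1)) by (now rewrite W1).
      transitivity (w * q ^ S m * ((1 - beta) * I1) * ((1 + u * u) * h2 + u * ((X * X - 2) * h2))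
        + (u * (w * I1 * (1 - q * q ^ m) * (1 - q * q ^ S m) * h2)
           - u * (w * q ^ S m * ((1 - beta) * I1) * h0))); [ring | ].
      replace ((X * X - 2) * h2) with
        ((1 - q * q ^ S (S m)) * (1 - q * q ^ S (S (S m))) * h4
         - q ^ S (S m) * (1 + q) * h2 + h0) by (rewrite T; ring).
      transitivity (w * q ^ S m * I1 * h2 * ((1 - u) * (1 - q * u))
         + (u * (w * q ^ S m * ((1 - beta) * I1) * (1 - q * q ^ S (S m)) * (1 - q * q ^ S (S (S m))) * h4)
            - u * (w * (q ^ m * (q ^ m * q ^ 2)) * (q ^ 2 * conv_weight q n (S (S j))) * h2))).
      2:{ ring. }
      rewrite W1, Uq. rewrite !Cpow_S. set (Q := q ^ m). ring. }
  unfold conv_sum.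
  assert (E := tel (S (S n)) (Nat.le_refl _)).
  change (csum (conv_term q d X n) (S (S n)))
    with (csum (conv_term q d X n) (S n) + conv_term q d X n (S n)) in E.
  replace (conv_term q d X n (S n)) with (RtoC 0) in E
    by (unfold conv_term; rewrite conv_weight_gt by lia; ring).
  rewrite Cplus_0_r in E. rewrite E. unfold G. rewrite !conv_weight_gt by lia. ring.
Qed.

(** The factor 1 + u^2 + u (X^2 - 2) in [conv_sum_step] is
    (1 + u z^2) (1 + u / z^2), so the sums satisfy the first-order recurrence of
    the terms of the hypergeometric series. *)
Lemma conv_sum_closed (q : R) (d n : nat) (z : C) :
  (0 < q < 1)%R -> (d <= 1)%nat -> z <> 0 ->
  conv_sum q d (z + / z) n
  = herm q d (z + / z)
    * (qpoch (- (q ^ (1 + d) * z ^ 2)) (q ^ 2) n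
       * qpoch (- (q ^ (1 + d) * (/ z) ^ 2)) (q ^ 2) n
       / (qpoch (q ^ 2) (q ^ 2) n * qpoch (q ^ (1 + 2 * d)) (q ^ 2) n)).
Proof.
  intros Hq Hd Hz.
  assert (P := q2_in_01 q Hq).
  assert (N1 : forall m, qpoch (q ^ 2) (q ^ 2) m <> 0).
  { intros m. rewrite <- RtoC_pow. now apply qpoch_qq_neq_0. }
  assert (N2 : forall m, qpoch (q ^ (1 + 2 * d)) (q ^ 2) m <> 0).
  { intros m. rewrite <- (RtoC_pow q 2). apply qpoch_disc_neq_0; [exact P | ].
    rewrite <- RtoC_pow, Cmod_R, Rabs_pos_eq by (apply pow_le; lra).
    apply pow_lt_1_compat; [lra | lia]. }
  induction n.
  - unfold conv_sum, conv_term, conv_weight. simpl. rewrite Nat.mul_0_r. simpl. field.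
  - assert (S1 := conv_sum_step q d (z + / z) n Hq Hd). cbv zeta in S1.
    set (u := q ^ (2 * n + 1 + d)) in *.
    assert (M1 := N1 (S n)). assert (M2 := N2 (S n)).
    assert (K1 := N1 n). assert (K2 := N2 n).
    cbn [qpoch] in M1, M2 |- *.
    assert (F : (1 - q ^ 2 * (q ^ 2) ^ n) * (1 - q ^ (1 + 2 * d) * (q ^ 2) ^ n)
                = (1 - u) * (1 - q * u)).
    { unfold u. rewrite <- Cpow_mult_r.
      assert (E : d = 0%nat \/ d = 1%nat) by lia.
      destruct E as [-> | ->]; rewrite ?Nat.add_0_r, !Cpow_add_r; simpl; ring. }
    assert (A : (1 - - (q ^ (1 + d) * z ^ 2) * (q ^ 2) ^ n)
                * (1 - - (q ^ (1 + d) * (/ z) ^ 2) * (q ^ 2) ^ n)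
                = 1 + u * u + u * ((z + / z) * (z + / z) - 2)).
    { unfold u. rewrite <- Cpow_mult_r.
      replace (2 * n + 1 + d)%nat with (1 + d + 2 * n)%nat by lia. rewrite (Cpow_add_r q (1 + d)).
      set (a := q ^ (1 + d)). set (b := q ^ (2 * n)). field. exact Hz. }
    assert (D : (1 - u) * (1 - q * u) <> 0).
    { rewrite <- F. intros E0.
      assert (E1 : (qpoch (q ^ 2) (q ^ 2) n * (1 - q ^ 2 * (q ^ 2) ^ n))
         * (qpoch (q ^ (1 + 2 * d)) (q ^ 2) n * (1 - q ^ (1 + 2 * d) * (q ^ 2) ^ n)) = 0).
      { transitivity (qpoch (q ^ 2) (q ^ 2) n * qpoch (q ^ (1 + 2 * d)) (q ^ 2) n
          * ((1 - q ^ 2 * (q ^ 2) ^ n) * (1 - q ^ (1 + 2 * d) * (q ^ 2) ^ n))); [ring | ].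
        rewrite E0. ring. }
      exact (Cmult_neq_0 _ _ M1 M2 E1). }
    apply (Cmult_cancel_l ((1 - u) * (1 - q * u))); [exact D | ].
    rewrite Cmult_comm, S1, IHn, <- A, <- F.
    set (x1 := 1 - q ^ 2 * (q ^ 2) ^ n) in *.
    set (x2 := 1 - q ^ (1 + 2 * d) * (q ^ 2) ^ n) in *.
    set (k1 := qpoch (q ^ 2) (q ^ 2) n) in *.
    set (k2 := qpoch (q ^ (1 + 2 * d)) (q ^ 2) n) in *.
    assert (x1 <> 0) by (intros E0; apply M1; rewrite E0; ring).
    assert (x2 <> 0) by (intros E0; apply M2; rewrite E0; ring).
    field. auto.
Qed.

Lemma has_sum_components (a : nat -> C) (l : C) :
  has_sum a l <->
  is_series (fun n => Re (a n)) (Re l) /\ is_series (fun n => Im (a n)) (Im l).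
Proof.
  assert (E1 : forall n, Re (csum a (S n)) = sum_n (fun n => Re (a n)) n).
  { induction n; [rewrite sum_O; exact (Rplus_0_l (Re (a 0%nat))) | ].
    rewrite sum_Sn, <- IHn. reflexivity. }
  assert (E2 : forall n, Im (csum a (S n)) = sum_n (fun n => Im (a n)) n).
  { induction n; [rewrite sum_O; exact (Rplus_0_l (Im (a 0%nat))) | ].
    rewrite sum_Sn, <- IHn. reflexivity. }
  unfold has_sum. rewrite clim_incr_1, <- clim_components.
  split; intros [H1 H2]; split.
  - exact (is_lim_seq_ext _ _ (Re l) E1 H1).
  - exact (is_lim_seq_ext _ _ (Im l) E2 H2).
  - exact (is_lim_seq_ext _ _ (Re l) (fun n => eq_sym (E1 n)) H1).
  - exact (is_lim_seq_ext _ _ (Im l) (fun n => eq_sym (E2 n)) H2).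
Qed.

(** The Cauchy product of real series, applied to real and imaginary parts. *)
Lemma has_sum_mult (a b : nat -> C) (la lb : C) :
  has_sum a la -> has_sum b lb ->
  ex_series (fun n => Cmod (a n)) -> ex_series (fun n => Cmod (b n)) ->
  has_sum (fun n => csum (fun k => a k * b (n - k)%nat) (S n)) (la * lb).
Proof.
  intros Ha Hb Na Nb.
  apply has_sum_components in Ha, Hb. destruct Ha as [A1 A2], Hb as [B1 B2].
  assert (dom : forall (c : nat -> C) (x : nat -> R), ex_series (fun n => Cmod (c n)) ->
     (forall n, Rabs (x n) <= Cmod (c n))%R -> ex_series (fun n => Rabs (x n))).
  { intros c x Hc Hx. apply (ex_series_le (V := R_CompleteNormedModule) _ (fun n => Cmod (c n)));
      [ | exact Hc]. intros n. unfold norm; simpl; unfold abs; simpl. rewrite Rabs_Rabsolu. apply Hx. }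
  assert (im : forall c : C, (Rabs (Im c) <= Cmod c)%R).
  { intros c. eapply Rle_trans; [ | apply Rmax_Cmod]. apply Rmax_r. }
  assert (RA := dom a (fun n => Re (a n)) Na (fun n => re_le_Cmod _)).
  assert (IA := dom a (fun n => Im (a n)) Na (fun n => im _)).
  assert (RB := dom b (fun n => Re (b n)) Nb (fun n => re_le_Cmod _)).
  assert (IB := dom b (fun n => Im (b n)) Nb (fun n => im _)).
  assert (E : forall n m,
     Re (csum (fun k => a k * b (n - k)%nat) (S m))
       = (sum_f_R0 (fun k => Re (a k) * Re (b (n - k)%nat)) m
          - sum_f_R0 (fun k => Im (a k) * Im (b (n - k)%nat)) m)%R /\
     Im (csum (fun k => a k * b (n - k)%nat) (S m))
       = (sum_f_R0 (fun k => Re (a k) * Im (b (n - k)%nat)) m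
          + sum_f_R0 (fun k => Im (a k) * Re (b (n - k)%nat)) m)%R).
  { intros n. induction m as [ | m [I1 I2]].
    - split; cbn [sum_f_R0].
      + transitivity (0 + (Re (a O) * Re (b (n - 0)%nat) - Im (a O) * Im (b (n - 0)%nat)))%R;
          [reflexivity | ring].
      + transitivity (0 + (Re (a O) * Im (b (n - 0)%nat) + Im (a O) * Re (b (n - 0)%nat)))%R;
          [reflexivity | ring].
    - split.
      + change (csum (fun k => a k * b (n - k)%nat) (S (S m)))
          with (csum (fun k => a k * b (n - k)%nat) (S m) + a (S m) * b (n - S m)%nat).
        cbn [sum_f_R0].
        transitivity (Re (csum (fun k => (a k * b (n - k)%nat)%C) (S m))
          + (Re (a (S m)) * Re (b (n - S m)%nat) - Im (a (S m)) * Im (b (n - S m)%nat)))%R;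
          [reflexivity | ]. rewrite I1. ring.
      + change (csum (fun k => a k * b (n - k)%nat) (S (S m)))
          with (csum (fun k => a k * b (n - k)%nat) (S m) + a (S m) * b (n - S m)%nat).
        cbn [sum_f_R0].
        transitivity (Im (csum (fun k => (a k * b (n - k)%nat)%C) (S m))
          + (Re (a (S m)) * Im (b (n - S m)%nat) + Im (a (S m)) * Re (b (n - S m)%nat)))%R;
          [reflexivity | ]. rewrite I2. ring. }
  apply has_sum_components. split.
  - apply (is_series_ext _ _ _ (fun n => eq_sym (proj1 (E n n)))).
    apply (is_series_minus (V := R_NormedModule)).
    + exact (is_series_mult _ _ _ _ A1 B1 RA RB).
    + exact (is_series_mult _ _ _ _ A2 B2 IA IB).
  - apply (is_series_ext _ _ _ (fun n => eq_sym (proj2 (E n n)))).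
    apply (is_series_plus (V := R_NormedModule)).
    + exact (is_series_mult _ _ _ _ A1 B2 RA IB).
    + exact (is_series_mult _ _ _ _ A2 B1 IA RB).
Qed.

Lemma ex_series_dominated (a : nat -> C) (M : nat -> R) :
  (forall n, Cmod (a n) <= M n)%R -> ex_series M -> ex_series (fun n => Cmod (a n)).
Proof.
  intros H HM. apply (ex_series_le (V := R_CompleteNormedModule) _ M); [ | exact HM].
  intros n. unfold norm; simpl; unfold abs; simpl. rewrite Rabs_pos_eq; [apply H | apply Cmod_ge_0].
Qed.

Lemma euler_sum (q : R) (t : C) :
  (0 < q < 1)%R -> (Cmod t < 1)%R ->
  has_sum (fun n => / qpoch q q n * t ^ n) (/ qpoch_inf t q) /\
  ex_series (fun n => Cmod (/ qpoch q q n * t ^ n)).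
Proof.
  intros Hq Ht.
  assert (E : forall n, qbin 0 q n * t ^ n = / qpoch q q n * t ^ n).
  { intros n. unfold qbin. rewrite qpoch_0. unfold Cdiv. now rewrite Cmult_1_l. }
  split.
  - refine (has_sum_ext _ _ _ E _).
    replace (/ qpoch_inf t q) with (qpoch_inf (0 * t) q / qpoch_inf t q).
    + now apply q_binomial.
    + rewrite Cmult_0_l, qpoch_inf_0 by exact Hq. unfold Cdiv. now rewrite Cmult_1_l.
  - apply (ex_series_dominated _ (fun n => qbin_max 0 q * Cmod t ^ n)%R).
    + intros n. rewrite <- E. now apply qbin_term_bound.
    + apply ex_series_geom_scal. split; [apply Cmod_ge_0 | exact Ht].
Qed.

Lemma term_eq (r : R) (d n : nat) (v X : C) :
  (d <= 1)%nat ->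
  term r d v X n
  = r ^ d * v ^ d * ((r ^ 4) ^ (n * n + d * n) * herm (r ^ 4) (2 * n + d) X * (- v ^ 2) ^ n).
Proof.
  intros Hd. unfold term.
  replace ((2 * n + d) * (2 * n + d))%nat with (4 * (n * n + d * n) + d)%nat.
  2:{ assert (E : d = 0%nat \/ d = 1%nat) by lia. destruct E as [-> | ->]; lia. }
  replace (- v ^ 2) with (- (1) * v ^ 2) by ring.
  rewrite (Cpow_add_r r), (Cpow_mult_r r 4), (Cpow_add_r v), (Cpow_mult_r v 2), Cpow_mult_l.
  set (a := (r ^ 4) ^ (n * n + d * n)). ring.
Qed.

Lemma has_sum_term (r : R) (d : nat) (v X : C) :
  (0 < r < 1)%R -> exists T, has_sum (term r d v X) T.
Proof.
  intros H. apply (ex_has_sum _ (term_max r (herm_max (r ^ 4) (Cmod X) * (Cmod v + 1)) d)).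
  - intros n. apply term_bound; [exact H | lra | lra].
  - apply ex_series_term_max; [exact H | ].
    apply Rmult_lt_0_compat; [ | generalize (Cmod_ge_0 v); lra].
    apply herm_max_pos; [now apply r4_in_01 | apply Cmod_ge_0].
Qed.

(** The q-Hermite expansion, on the disc where the hypergeometric series
    converges; the factor herm d is 1 for d = 0 and 2 x / (1 - q) for d = 1. *)
Lemma phi21_expansion (r : R) (d : nat) (v z T : C) :
  (0 < r < 1)%R -> (d <= 1)%nat -> z <> 0 -> (Cmod v < 1)%R ->
  has_sum (term r d v (z + / z)) T ->
  exists L, T = r ^ d * v ^ d * L /\
  has_sum (fun n => herm (r ^ 4) d (z + / z) *
    (qpoch (- ((r ^ 4)%R ^ (1 + d) * z ^ 2)) ((r ^ 4)%R ^ 2) n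
     * qpoch (- ((r ^ 4)%R ^ (1 + d) * (/ z) ^ 2)) ((r ^ 4)%R ^ 2) n
     / (qpoch ((r ^ 4)%R ^ 2) ((r ^ 4)%R ^ 2) n * qpoch ((r ^ 4)%R ^ (1 + 2 * d)) ((r ^ 4)%R ^ 2) n)
     * (- v ^ 2) ^ n))
    (L / qpoch_inf (- v ^ 2) ((r ^ 4)%R ^ 2)).
Proof.
  intros H Hd Hz Hv HT.
  assert (Q := r4_in_01 r H). assert (P := q2_in_01 _ Q).
  assert (Ht : (Cmod (- v ^ 2) < 1)%R).
  { rewrite Cmod_opp, Cmod_pow. simpl. generalize (Cmod_ge_0 v). nra. }
  set (X := z + / z) in *. set (t := - v ^ 2) in *.
  set (g := fun n => (r ^ 4) ^ (n * n + d * n) * herm (r ^ 4) (2 * n + d) X * t ^ n).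
  set (A := herm_max (r ^ 4) (Cmod X)).
  assert (A0 : (0 < A)%R) by (apply herm_max_pos; [exact Q | apply Cmod_ge_0]).
  assert (gb : forall n, (Cmod (g n) <= / r ^ d * term_max r A d n)%R).
  { intros n. unfold g, term_max.
    replace ((2 * n + d) * (2 * n + d))%nat with (4 * (n * n + d * n) + d)%nat.
    2:{ assert (E : d = 0%nat \/ d = 1%nat) by lia. destruct E as [-> | ->]; lia. }
    rewrite pow_add, pow_mult, !Cmod_mult, !Cmod_pow, Cmod_R, (Rabs_pos_eq r) by lra.
    assert (r ^ d <> 0)%R by (apply pow_nonzero; lra).
    replace (/ r ^ d * ((r ^ 4) ^ (n * n + d * n) * r ^ d * A ^ (2 * n + d)))%R
      with ((r ^ 4) ^ (n * n + d * n) * A ^ (2 * n + d) * 1)%R by (field; assumption).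
    assert (0 <= (r ^ 4) ^ (n * n + d * n))%R by (apply pow_le; lra).
    apply Rmult_le_compat.
    - apply Rmult_le_pos; [assumption | apply Cmod_ge_0].
    - apply pow_le, Cmod_ge_0.
    - apply Rmult_le_compat_l; [assumption | ]. apply herm_bound; [exact Q | lra].
    - rewrite <- (pow1 n). apply pow_incr. split; [apply Cmod_ge_0 | lra]. }
  assert (gs : ex_series (fun n => / r ^ d * term_max r A d n)%R).
  { apply (ex_series_scal (/ r ^ d)%R (term_max r A d)). now apply ex_series_term_max. }
  destruct (ex_has_sum g _ gb gs) as [L HL].
  exists L. split.
  - apply (has_sum_unique _ _ _ HT).
    apply (has_sum_ext (fun n => r ^ d * v ^ d * g n)).
    + intros n. now rewrite term_eq by exact Hd.
    + now apply has_sum_scal.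
  - destruct (euler_sum ((r ^ 4) ^ 2) t P Ht) as [E1 E2].
    assert (HC := has_sum_mult g _ L _ HL E1 (ex_series_dominated _ _ gb gs) E2).
    rewrite (RtoC_pow (r ^ 4) 2) in HC.
    refine (has_sum_ext _ _ _ _ HC). intros n.
    rewrite Cmult_assoc. unfold X. rewrite <- conv_sum_closed by assumption. fold X.
    unfold conv_sum. rewrite Cmult_comm, <- csum_scal.
    apply csum_ext. intros k Hk. unfold conv_term, conv_weight, g.
    destruct (Nat.leb_spec k n) as [_ | ]; [ | lia].
    rewrite (RtoC_pow (r ^ 4) 2), (RtoC_pow r 4).
    replace (t ^ n) with (t ^ k * t ^ (n - k)) by (rewrite <- Cpow_add_r; f_equal; lia).
    ring.
Qed.

Lemma Cmod_v2_lt (q : R) (v : C) :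
  (0 < q < 1)%R -> (Cmod v < 1)%R -> (Cmod (- (q * v ^ 2)) < 1)%R /\ (Cmod (- v ^ 2) < 1)%R.
Proof.
  intros Hq Hv. assert (V := Cmod_ge_0 v).
  rewrite !Cmod_opp, Cmod_mult, Cmod_pow, Cmod_R, Rabs_pos_eq by lra.
  assert (Cmod v ^ 2 < 1)%R by (simpl; nra).
  assert (0 <= Cmod v ^ 2)%R by (apply pow_le; exact V). split; nra.
Qed.

Lemma cos_disc_expansion (r : R) (v x T : C) :
  (0 < r < 1)%R -> (Cmod v < 1)%R ->
  exp_itheta x <> 0 -> x = (exp_itheta x + / exp_itheta x) / 2 ->
  has_sum (term r 0 v (2 * x)) T ->
  qpoch_inf (- ((r ^ 4)%R * v ^ 2)) ((r ^ 4)%R ^ 2) * cos_disc (r ^ 4) x v = T.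
Proof.
  intros H Hv Hz Hx HT. assert (Q := r4_in_01 r H). assert (P := q2_in_01 _ Q).
  unfold cos_disc. set (z := exp_itheta x) in *.
  replace (2 * x) with (z + / z) in HT by (rewrite Hx; field; exact Hz).
  destruct (phi21_expansion r 0 v z T H ltac:(lia) Hz Hv HT) as [L [EL HL]].
  destruct (Cmod_v2_lt (r ^ 4) v Q Hv) as [V1 V2].
  assert (N1 : qpoch_inf (- ((r ^ 4)%R * v ^ 2)) ((r ^ 4)%R ^ 2) <> 0)
    by (rewrite <- RtoC_pow; now apply qpoch_inf_disc_neq_0).
  assert (N2 : qpoch_inf (- v ^ 2) ((r ^ 4)%R ^ 2) <> 0)
    by (rewrite <- RtoC_pow; now apply qpoch_inf_disc_neq_0).
  unfold phi21. rewrite (has_sum_Clim_seq _ (L / qpoch_inf (- v ^ 2) ((r ^ 4)%R ^ 2))).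
  - rewrite EL. simpl. field. auto.
  - refine (has_sum_ext _ _ _ _ HL). intros n.
    change (herm (r ^ 4) 0 (z + / z)) with (RtoC 1).
    replace ((r ^ 4)%R ^ (1 + 0)) with (RtoC (r ^ 4)%R) by (simpl; ring).
    replace ((r ^ 4)%R ^ (1 + 2 * 0)) with (RtoC (r ^ 4)%R) by (simpl; ring).
    now rewrite Cmult_1_l.
Qed.

Lemma sin_disc_expansion (r : R) (v x T : C) :
  (0 < r < 1)%R -> (Cmod v < 1)%R ->
  exp_itheta x <> 0 -> x = (exp_itheta x + / exp_itheta x) / 2 ->
  has_sum (term r 1 v (2 * x)) T ->
  qpoch_inf (- ((r ^ 4)%R * v ^ 2)) ((r ^ 4)%R ^ 2) * sin_disc (r ^ 4) x v = T.
Proof.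
  intros H Hv Hz Hx HT. assert (Q := r4_in_01 r H). assert (P := q2_in_01 _ Q).
  unfold sin_disc. set (z := exp_itheta x) in *.
  assert (X2 : 2 * x = z + / z) by (rewrite Hx; field; exact Hz).
  rewrite X2 in HT.
  destruct (phi21_expansion r 1 v z T H ltac:(lia) Hz Hv HT) as [L [EL HL]].
  destruct (Cmod_v2_lt (r ^ 4) v Q Hv) as [V1 V2].
  assert (N1 : qpoch_inf (- ((r ^ 4)%R * v ^ 2)) ((r ^ 4)%R ^ 2) <> 0)
    by (rewrite <- RtoC_pow; now apply qpoch_inf_disc_neq_0).
  assert (N2 : qpoch_inf (- v ^ 2) ((r ^ 4)%R ^ 2) <> 0)
    by (rewrite <- RtoC_pow; now apply qpoch_inf_disc_neq_0).
  assert (N3 := one_minus_neq_0 _ Q).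
  rewrite Rpower_quarter by exact H.
  replace (herm (r ^ 4) 1 (z + / z)) with (2 * x / (1 - (r ^ 4)%R)) in HL.
  2:{ rewrite X2. unfold herm. cbn [herm_pair snd fst Cpow]. rewrite !Cmult_1_r.
      field. auto. }
  set (c := 2 * x / (1 - (r ^ 4)%R)) in *.
  set (y := phi21 (- ((r ^ 4)%R ^ 2 * z ^ 2)) (- ((r ^ 4)%R ^ 2 * (/ z) ^ 2)) ((r ^ 4)%R ^ 3)
              ((r ^ 4)%R ^ 2) (- v ^ 2)).
  assert (E : c * y = L / qpoch_inf (- v ^ 2) ((r ^ 4)%R ^ 2)).
  { destruct (excluded_middle_informative (c = 0)) as [C0 | C0].
    -
      (* at x = 0 every term vanishes *)
      rewrite C0 in HL |- *. rewrite Cmult_0_l.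
      apply (has_sum_unique (fun _ => 0)).
      + exact (has_sum_single (fun _ => RtoC 0) 0 (fun _ _ => eq_refl)).
      + refine (has_sum_ext _ _ _ _ HL). intros n. apply Cmult_0_l.
    - unfold y, phi21.
      rewrite (has_sum_Clim_seq _ (/ c * (L / qpoch_inf (- v ^ 2) ((r ^ 4)%R ^ 2)))).
      + field. auto.
      + refine (has_sum_ext _ _ _ _ (has_sum_scal (/ c) _ _ HL)). intros n.
        cbn [Nat.add Nat.mul].
        match goal with |- / c * (c * ?a) = _ => set (b := a) end.
        transitivity b; [field; exact C0 | reflexivity]. }
  rewrite EL.
  transitivity (r * v * qpoch_inf (- v ^ 2) ((r ^ 4)%R ^ 2) * (c * y)).
  - unfold c. field. auto.
  - rewrite E. simpl. field. exact N2.
Qed.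

(** * Entire extensions *)

Lemma pow_n_Cpow (v : C) (k : nat) : @pow_n C_Ring v k = v ^ k.
Proof. induction k; [reflexivity | ]. simpl. now rewrite IHk. Qed.

Lemma is_pseries_has_sum (a : nat -> C) (v l : C) :
  is_pseries a v l <-> has_sum (fun k => v ^ k * a k) l.
Proof.
  assert (E : forall n, scal (pow_n (K := C_AbsRing) v n) (a n) = v ^ n * a n)
    by (intros; exact (f_equal (fun x => x * a n) (pow_n_Cpow v n))).
  unfold is_pseries. rewrite is_series_has_sum.
  split; apply has_sum_ext; intros n; [exact (E n) | exact (eq_sym (E n))].
Qed.

Lemma has_sum_terms_bounded (a : nat -> C) (l : C) :
  has_sum a l -> exists B, forall n, (Cmod (a n) <= B)%R.
Proof.
  intros H. assert (L := clim_Cmod _ _ H).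
  destruct (filterlim_bounded (V := R_NormedModule) (fun n => Cmod (csum a n))) as [M HM].
  { exists (Cmod l). exact L. }
  exists (M + M)%R. intros n.
  assert (B : forall n, (Cmod (csum a n) <= M)%R).
  { intros m. eapply Rle_trans; [ | exact (HM m)]. apply Rle_abs. }
  replace (a n) with (csum a (S n) + - csum a n) by (simpl; ring).
  eapply Rle_trans; [apply Cmod_triangle | ]. rewrite Cmod_opp.
  apply Rplus_le_compat; apply B.
Qed.

Lemma Cmod_le_small (c : C) (K : R) :
  (forall e, 0 < e < 1 / 4 -> Cmod c <= e * K)%R -> c = 0.
Proof.
  intros H. apply Cmod_eq_0. apply Rle_antisym; [ | apply Cmod_ge_0].
  apply Rnot_lt_le. intros P.
  assert (K0 : (0 < K)%R) by (generalize (H (1 / 8)%R ltac:(lra)); lra).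
  assert (E : (0 < Cmod c / (2 * K))%R) by (apply Rdiv_lt_0_compat; lra).
  destruct (Rlt_dec (Cmod c / (2 * K)) (1 / 4)) as [L | L].
  - specialize (H _ (conj E L)).
    replace (Cmod c / (2 * K) * K)%R with (Cmod c / 2)%R in H by (field; lra). lra.
  - specialize (H (1 / 8)%R ltac:(lra)).
    assert (1 / 4 * (2 * K) <= Cmod c / (2 * K) * (2 * K))%R
      by (apply Rmult_le_compat_r; lra).
    replace (Cmod c / (2 * K) * (2 * K))%R with (Cmod c) in H0 by (field; lra). lra.
Qed.

(** When the lower coefficients vanish, the sum at a point e is e^n times
    c_n + O(e), so that |c_n| is at most a constant times e for all small e. *)
Lemma pseries_zero (c : nat -> C) :
  (forall v, (Cmod v < 1)%R -> has_sum (fun k => v ^ k * c k) 0) -> forall n, c n = 0.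
Proof.
  intros H.
  destruct (has_sum_terms_bounded _ _ (H (RtoC (1 / 2)) ltac:(rewrite Cmod_R, Rabs_pos_eq; lra)))
    as [B HB].
  assert (HB' : forall n, (Cmod (c n) <= B * 2 ^ n)%R).
  { intros n. specialize (HB n). rewrite Cmod_mult, Cmod_pow, Cmod_R, Rabs_pos_eq in HB by lra.
    assert (P : (0 < 2 ^ n)%R) by (apply pow_lt; lra).
    replace (Cmod (c n)) with (2 ^ n * ((1 / 2) ^ n * Cmod (c n)))%R.
    - rewrite (Rmult_comm B). apply Rmult_le_compat_l; lra.
    - rewrite <- Rmult_assoc, <- Rpow_mult_distr.
      replace (2 * (1 / 2))%R with 1%R by field. rewrite pow1. ring. }
  intros n. induction n as [n IH] using (well_founded_induction lt_wf).
  apply (Cmod_le_small _ (B * 2 ^ n * 2 * 2)). intros e He.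
  assert (E0 : RtoC e <> 0) by (apply RtoC_neq; lra).
  assert (S1 : has_sum (fun k => e ^ k * c (n + k)%nat) 0).
  { assert (S0 := H (RtoC e) ltac:(rewrite Cmod_R, Rabs_pos_eq; lra)).
    apply (clim_ext (fun N => / e ^ n * csum (fun k => e ^ k * c k) (n + N))).
    - intros N. rewrite csum_add.
      replace (csum (fun k => e ^ k * c k) n) with (RtoC 0).
      + rewrite Cplus_0_l, <- csum_scal. apply csum_ext. intros k _.
        rewrite Cpow_add_r. field. now apply Cpow_nz.
      + transitivity (csum (fun _ => 0 * 0) n); [rewrite csum_scal; ring | ].
        apply csum_ext. intros k Hk. rewrite IH by exact Hk. ring.
    - replace (RtoC 0) with (/ e ^ n * 0) by ring. apply clim_scal.
      apply (clim_subseq (csum (fun k => e ^ k * c k)) 0 (fun N => (n + N)%nat)); [intros; lia | exact S0]. }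
  assert (M : ex_series (fun k => B * 2 ^ n * (2 * e) ^ k)%R)
    by (apply ex_series_geom_scal; lra).
  assert (dom : forall k, (Cmod (e ^ k * c (n + k)%nat) <= B * 2 ^ n * (2 * e) ^ k)%R).
  { intros k. rewrite Cmod_mult, Cmod_pow, Cmod_R, Rabs_pos_eq, Rpow_mult_distr by lra.
    replace (B * 2 ^ n * (2 ^ k * e ^ k))%R with (e ^ k * (B * 2 ^ (n + k)))%R
      by (rewrite pow_add; ring).
    apply Rmult_le_compat_l; [apply pow_le; lra | apply HB']. }
  assert (T := has_sum_tail _ _ _ 1 S1 dom M). simpl csum in T.
  replace (0 + 1 * c (n + 0)%nat - 0) with (c n) in T by (rewrite Nat.add_0_r; ring).
  eapply Rle_trans; [exact T | ].
  unfold tail.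
  rewrite (Series_ext _ (fun k => (B * 2 ^ n * (2 * e)) * (2 * e) ^ k)%R)
    by (intros; simpl; ring).
  rewrite Series_geom_scal by lra.
  assert (P : (0 <= B * 2 ^ n)%R) by (eapply Rle_trans; [apply Cmod_ge_0 | apply HB']).
  apply Rmult_le_reg_r with (1 - 2 * e)%R; [lra | ].
  unfold Rdiv. rewrite Rmult_assoc, Rinv_l by lra.
  assert (0 <= B * 2 ^ n * e * (1 - 4 * e))%R by (apply Rmult_le_pos; [apply Rmult_le_pos; lra | lra]). nra.
Qed.

Lemma entire_identity (g h : C -> C) :
  entire g -> entire h -> (forall v, (Cmod v < 1)%R -> g v = h v) -> forall w, g w = h w.
Proof.
  intros [a Ha] [b Hb] E w.
  assert (Z : forall n, a n + (- (1)) * b n = 0).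
  { apply pseries_zero. intros v Hv.
    apply (has_sum_ext (fun k => v ^ k * a k + (- (1)) * (v ^ k * b k))); [intros; ring | ].
    replace (RtoC 0) with (g v + (- (1)) * h v) by (rewrite (E v Hv); ring).
    apply has_sum_plus; [ | apply has_sum_scal]; now apply is_pseries_has_sum. }
  apply (has_sum_unique (fun k => w ^ k * a k)); [now apply is_pseries_has_sum | ].
  apply (has_sum_ext (fun k => w ^ k * b k)); [ | now apply is_pseries_has_sum].
  intros n. replace (a n) with ((a n + (- (1)) * b n) + b n) by ring. rewrite Z. ring.
Qed.

Lemma entire_extension_eq (f g : C -> C) (w : C) :
  entire g -> (forall v, (Cmod v < 1)%R -> f v = g v) -> entire_extension f w = g w.
Proof.
  intros Hg E. unfold entire_extension.
  assert (S := epsilon_spec (inhabits f)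
    (fun h => entire h /\ forall v : C, (Cmod v < 1)%R -> h v = f v)
    (ex_intro _ g (conj Hg (fun v Hv => eq_sym (E v Hv))))).
  destruct S as [S1 S2]. apply entire_identity; [exact S1 | exact Hg | ].
  intros v Hv. now rewrite (S2 v Hv), E.
Qed.

(** The entire function (-q v^2; q^2)_oo C(x;v) for d = 0, (-q v^2; q^2)_oo S(x;v)
    for d = 1, where X = 2 x. *)
Definition tsum (r : R) (d : nat) (v X : C) : C := Clim_seq (csum (term r d v X)).

Lemma tsum_correct (r : R) (d : nat) (v X : C) :
  (0 < r < 1)%R -> has_sum (term r d v X) (tsum r d v X).
Proof.
  intros H. destruct (has_sum_term r d v X H) as [T HT].
  unfold tsum. now rewrite (clim_Clim_seq _ _ HT).
Qed.

Lemma entire_tsum (r : R) (d : nat) (X : C) :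
  (0 < r < 1)%R -> (d <= 1)%nat -> entire (fun v => tsum r d v X).
Proof.
  intros H Hd.
  set (a := fun k => if Bool.eqb (Nat.odd k) (Nat.odd d)
     then (- (1)) ^ Nat.div2 k * r ^ (k * k) * herm (r ^ 4) k X else RtoC 0).
  exists a. intros v. apply is_pseries_has_sum.
  set (B := herm_max (r ^ 4) (Cmod X)).
  assert (B0 : (0 < B)%R) by (apply herm_max_pos; [now apply r4_in_01 | apply Cmod_ge_0]).
  assert (V0 := Cmod_ge_0 v).
  destruct (ex_has_sum (fun k => v ^ k * a k)
    (fun k => r ^ ((1 * k + 0) * (1 * k + 0)) * (B * (Cmod v + 1)) ^ (1 * k + 0))%R) as [l Hl].
  - intros k. replace (1 * k + 0)%nat with k by lia.
    assert (R1 : (0 <= r ^ (k * k))%R) by (apply pow_le; lra).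
    assert (W : (0 <= (B * (Cmod v + 1)) ^ k)%R) by (apply pow_le; nra).
    unfold a. destruct (Bool.eqb _ _).
    + rewrite !Cmod_mult, !Cmod_pow, Cmod_opp, Cmod_1, pow1, Rmult_1_l, Cmod_R, Rabs_pos_eq by lra.
      rewrite Rpow_mult_distr.
      replace (r ^ (k * k) * (B ^ k * (Cmod v + 1) ^ k))%R
        with ((Cmod v + 1) ^ k * (r ^ (k * k) * B ^ k))%R by ring.
      apply Rmult_le_compat.
      * apply pow_le; lra.
      * apply Rmult_le_pos; [exact R1 | apply Cmod_ge_0].
      * apply pow_incr; lra.
      * apply Rmult_le_compat_l; [exact R1 | ].
        apply herm_bound; [now apply r4_in_01 | apply Rle_refl].
    + rewrite Cmult_0_r, Cmod_0. now apply Rmult_le_pos.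
  - apply ex_series_gauss; [exact H | nra | lia].
  - replace (tsum r d v X) with l; [exact Hl | ].
    apply (clim_unique (fun N => csum (fun k => v ^ k * a k) (2 * N))).
    + apply (clim_subseq _ l (fun N => (2 * N)%nat)); [intros; lia | exact Hl].
    + refine (clim_ext _ _ _ _ (tsum_correct r d v X H)).
      induction n; [reflexivity | ].
      replace (2 * S n)%nat with (S (S (2 * n))) by lia. cbn [csum]. rewrite IHn.
      assert (O0 : Nat.odd (2 * n) = false) by (rewrite Nat.odd_mul; reflexivity).
      assert (O1 : Nat.odd (S (2 * n)) = true)
        by (rewrite Nat.odd_succ, <- Nat.negb_odd, O0; reflexivity).
      assert (D0 : Nat.div2 (2 * n) = n) by apply Nat.div2_double.
      assert (D1 : Nat.div2 (S (2 * n)) = n) by apply Nat.div2_succ_double.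
      unfold a, term. rewrite O0, O1, D0, D1.
      assert (E : d = 0%nat \/ d = 1%nat) by lia.
      destruct E as [-> | ->]; cbn [Nat.odd Nat.even negb Bool.eqb].
      * rewrite Nat.add_0_r. ring.
      * rewrite Nat.add_1_r. ring.
Qed.

Lemma exp_itheta_spec (x z : C) :
  z <> 0 -> x = (z + / z) / 2 ->
  exp_itheta x <> 0 /\ x = (exp_itheta x + / exp_itheta x) / 2.
Proof.
  intros Hz Hx. unfold exp_itheta.
  exact (epsilon_spec (inhabits (RtoC 1)) (fun z => z <> 0 /\ x = (z + / z) / 2)
    (ex_intro _ z (conj Hz Hx))).
Qed.

Definition pole_factor (q : R) (w : C) : C := qpoch_inf (- (q * w ^ 2)) (q ^ 2).

Lemma basic_cos_series (r : R) (x z w : C) :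
  (0 < r < 1)%R -> z <> 0 -> x = (z + / z) / 2 ->
  basic_cos (r ^ 4) x w = tsum r 0 w (2 * x) / pole_factor (r ^ 4) w.
Proof.
  intros H Hz Hx. destruct (exp_itheta_spec x z Hz Hx) as [E1 E2].
  unfold basic_cos. f_equal.
  apply (entire_extension_eq _ (fun v => tsum r 0 v (2 * x))); [apply entire_tsum; [exact H | lia] | ].
  intros v Hv. apply cos_disc_expansion; try assumption. now apply tsum_correct.
Qed.

Lemma basic_sin_series (r : R) (x z w : C) :
  (0 < r < 1)%R -> z <> 0 -> x = (z + / z) / 2 ->
  basic_sin (r ^ 4) x w = tsum r 1 w (2 * x) / pole_factor (r ^ 4) w.
Proof.
  intros H Hz Hx. destruct (exp_itheta_spec x z Hz Hx) as [E1 E2].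
  unfold basic_sin. f_equal.
  apply (entire_extension_eq _ (fun v => tsum r 1 v (2 * x))); [apply entire_tsum; [exact H | lia] | ].
  intros v Hv. apply sin_disc_expansion; try assumption. now apply tsum_correct.
Qed.

(** * Passage to the limit under the integral *)

Definition uconv (f : nat -> R -> C) (F : R -> C) : Prop :=
  exists e : nat -> R, is_lim_seq e 0%R /\ forall n t, (Cmod (f n t - F t) <= e n)%R.

Definition bounded (F : R -> C) : Prop := exists M : R, forall t, (Cmod (F t) <= M)%R.

Lemma uconv_const (F : R -> C) : uconv (fun _ => F) F.
Proof.
  exists (fun _ => 0%R). split; [apply is_lim_seq_const | ].
  intros _ t. replace (F t - F t) with (RtoC 0) by ring. rewrite Cmod_0. lra.
Qed.

Lemma uconv_S (f : nat -> R -> C) (F : R -> C) : uconv f F -> uconv (fun n => f (S n)) F.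
Proof.
  intros [e [He H]]. exists (fun n => e (S n)). split; [ | intros; apply H].
  now apply (is_lim_seq_incr_1 e).
Qed.

Lemma uconv_minus (f g : nat -> R -> C) (F G : R -> C) :
  uconv f F -> uconv g G -> uconv (fun n t => f n t - g n t) (fun t => F t - G t).
Proof.
  intros [e [He Hf]] [e' [He' Hg]]. exists (fun n => e n + e' n)%R. split.
  - apply (is_lim_seq_eq _ (0 + 0)%R); [now apply is_lim_seq_plus' | ring].
  - intros n t. replace (f n t - g n t - (F t - G t)) with ((f n t - F t) + - (g n t - G t)) by ring.
    eapply Rle_trans; [apply Cmod_triangle | ]. rewrite Cmod_opp.
    apply Rplus_le_compat; [apply Hf | apply Hg].
Qed.

Lemma uconv_mult (f g : nat -> R -> C) (F G : R -> C) :
  uconv f F -> uconv g G -> bounded F -> bounded G ->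
  uconv (fun n t => f n t * g n t) (fun t => F t * G t).
Proof.
  intros [e [He Hf]] [e' [He' Hg]] [M HM] [M' HM'].
  exists (fun n => e n * (e' n + M') + M * e' n)%R. split.
  - apply (is_lim_seq_eq _ (0 * (0 + M') + M * 0)%R); [ | ring].
    repeat first [apply is_lim_seq_plus' | apply is_lim_seq_mult' | assumption | apply is_lim_seq_const].
  - intros n t. replace (f n t * g n t - F t * G t)
      with ((f n t - F t) * ((g n t - G t) + G t) + F t * (g n t - G t)) by ring.
    eapply Rle_trans; [apply Cmod_triangle | ]. rewrite !Cmod_mult.
    apply Rplus_le_compat; apply Rmult_le_compat; try apply Cmod_ge_0; auto.
    eapply Rle_trans; [apply Cmod_triangle | ]. apply Rplus_le_compat; auto.
Qed.

Lemma bounded_mult (F G : R -> C) : bounded F -> bounded G -> bounded (fun t => F t * G t).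
Proof.
  intros [M HM] [M' HM']. exists (M * M')%R. intros t. rewrite Cmod_mult.
  apply Rmult_le_compat; try apply Cmod_ge_0; auto.
Qed.

Lemma integral_uconv (f : nat -> R -> C) (F : R -> C) (l : nat -> C) :
  uconv f F -> (forall n, is_integral_0_pi (f n) (l n)) ->
  exists L, clim l L /\ is_integral_0_pi F L.
Proof. intros [e [He H]] Hf. exact (integral_uniform f F e l He H Hf). Qed.

Lemma two_cos_bound (t : R) : (Cmod (2 * cos t)%R <= 2)%R.
Proof.
  rewrite Cmod_R. apply Rabs_le. generalize (COS_bound t). lra.
Qed.

Lemma uconv_part (r : R) (d : nat) (v : C) :
  (0 < r < 1)%R ->
  uconv (fun N t => part r d v (2 * cos t)%R N) (fun t => tsum r d v (2 * cos t)%R).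
Proof.
  intros H.
  set (M := term_max r (herm_max (r ^ 4) 2 * (Cmod v + 1)) d).
  assert (HM : ex_series M).
  { apply ex_series_term_max; [exact H | ].
    apply Rmult_lt_0_compat; [ | generalize (Cmod_ge_0 v); lra].
    apply herm_max_pos; [now apply r4_in_01 | lra]. }
  exists (tail M). split; [now apply tail_lim | ].
  intros N t. apply has_sum_tail; [now apply tsum_correct | | exact HM].
  intros k. apply term_bound; [exact H | lra | apply two_cos_bound].
Qed.

Lemma bounded_tsum (r : R) (d : nat) (v : C) :
  (0 < r < 1)%R -> bounded (fun t => tsum r d v (2 * cos t)%R).
Proof.
  intros H.
  set (M := term_max r (herm_max (r ^ 4) 2 * (Cmod v + 1)) d).
  exists (Series M). intros t. apply (has_sum_bound (term r d v (2 * cos t)%R)).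
  - now apply tsum_correct.
  - intros k. apply term_bound; [exact H | lra | apply two_cos_bound].
  - apply ex_series_term_max; [exact H | ].
    apply Rmult_lt_0_compat; [ | generalize (Cmod_ge_0 v); lra].
    apply herm_max_pos; [now apply r4_in_01 | lra].
Qed.

Lemma bounded_weight (r : R) : (0 < r < 1)%R -> bounded (weight (r ^ 4)).
Proof.
  intros H.
  exists (2 * (1 * (qbin_max (/ r ^ 2) (r ^ 4) / (1 - r ^ 2))
    * (qbin_max (r ^ 2) (r ^ 4) / (1 - r ^ 2))))%R.
  intros t. rewrite weight_factor by exact H. unfold wU. rewrite !Cmod_mult, Cmod_expi.
  assert (0 <= Cmod (wP r t))%R by apply Cmod_ge_0.
  assert (0 <= Cmod (wQ r t))%R by apply Cmod_ge_0.
  apply Rmult_le_compat.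
  - apply Cmod_ge_0.
  - repeat apply Rmult_le_pos; lra.
  - eapply Rle_trans; [apply (Cmod_triangle _ (- / expi t)) | ].
    rewrite Cmod_opp, <- expi_opp, !Cmod_expi. lra.
  - apply Rmult_le_compat; [lra | lra | | now apply wQ_bound].
    apply Rmult_le_compat; [lra | lra | lra | now apply wP_bound].
Qed.

Lemma ex_integral_expi (s : R) : exists l, is_integral_0_pi (fun t => expi (s * t)) l.
Proof.
  destruct (ex_RInt_continuous (V := R_CompleteNormedModule) (fun t => cos (s * t)) 0 PI) as [l1 H1].
  { intros t _. apply (ex_derive_continuous (V := R_NormedModule)). auto_derive. exact I. }
  destruct (ex_RInt_continuous (V := R_CompleteNormedModule) (fun t => sin (s * t)) 0 PI) as [l2 H2].
  { intros t _. apply (ex_derive_continuous (V := R_NormedModule)). auto_derive. exact I. }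
  exists (l1, l2). apply integral_components. now split.
Qed.

Lemma ex_integral_wP (r s : R) :
  (0 < r < 1)%R -> exists l, is_integral_0_pi (fun t => expi (s * t) * wP r t) l.
Proof.
  intros H.
  set (ex := fun n : nat => ex_integral_expi (s + 2 * INR n)).
  set (l := fun n => coefP r n * proj1_sig (constructive_indefinite_description _ (ex n))).
  destruct (integral_has_sum
    (fun n t => coefP r n * expi ((s + 2 * INR n) * t))
    (fun t => expi (s * t) * wP r t)
    (fun n => qbin_max (/ r ^ 2) (r ^ 4) * (r ^ 2) ^ n)%R l) as [L [_ HI]].
  - apply ex_series_geom_scal. generalize (r2_in_01 r H). lra.
  - intros n t. apply coef_bound; [exact H | apply Cmod_expi].
  - intros t.
    apply (has_sum_ext (fun n => expi (s * t) * (coefP r n * expi (2 * INR n * t)))).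
    + intros n. rewrite Rmult_plus_distr_r, expi_plus. ring.
    + apply has_sum_scal. now apply wP_series.
  - intros n. apply integral_scal.
    exact (proj2_sig (constructive_indefinite_description _ (ex n))).
  - now exists L.
Qed.

Lemma ex_integral_wPQ (r s : R) :
  (0 < r < 1)%R -> exists l, is_integral_0_pi (fun t => expi (s * t) * wP r t * wQ r t) l.
Proof.
  intros H.
  set (B := (qbin_max (/ r ^ 2) (r ^ 4) / (1 - r ^ 2))%R).
  set (ex := fun n : nat => ex_integral_wP r (s - 2 * INR n) H).
  set (l := fun n => coefQ r n * proj1_sig (constructive_indefinite_description _ (ex n))).
  destruct (integral_has_sum
    (fun j t => coefQ r j * (expi ((s - 2 * INR j) * t) * wP r t))
    (fun t => expi (s * t) * wP r t * wQ r t)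
    (fun n => qbin_max (r ^ 2) (r ^ 4) * B * (r ^ 2) ^ n)%R l) as [L [_ HI]].
  - apply ex_series_geom_scal. generalize (r2_in_01 r H). lra.
  - intros n t. rewrite Cmult_assoc, Cmod_mult.
    replace (qbin_max (r ^ 2) (r ^ 4) * B * (r ^ 2) ^ n)%R
      with (qbin_max (r ^ 2) (r ^ 4) * (r ^ 2) ^ n * B)%R by ring.
    apply Rmult_le_compat; try apply Cmod_ge_0; [ | now apply wP_bound].
    apply coef_bound; [exact H | apply Cmod_expi].
  - intros t.
    apply (has_sum_ext (fun j => expi (s * t) * wP r t
             * (coefQ r j * expi (- (2 * INR j * t))))).
    + intros n.
      replace ((s - 2 * INR n) * t)%R with (s * t + - (2 * INR n * t))%R by ring.
      rewrite expi_plus. ring.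
    + apply has_sum_scal. now apply wQ_series.
  - intros n. apply integral_scal.
    exact (proj2_sig (constructive_indefinite_description _ (ex n))).
  - now exists L.
Qed.

(** For either parity: the pairing of C with S involves odd functions, whose
    moments are not among those computed above. *)
Lemma ex_integral_laurent (r : R) (odd : bool) (f : C -> C) :
  (0 < r < 1)%R -> laurent odd f ->
  exists l, is_integral_0_pi (fun t => f (expi t) * weight (r ^ 4) t) l.
Proof.
  intros H Hf.
  induction Hf as [j k E | f g _ [l1 H1] _ [l2 H2] | c f _ [l1 H1] | f g E _ [l1 H1]].
  - set (a := IZR (Z.of_nat j - Z.of_nat k)).
    destruct (ex_integral_wPQ r a H) as [l1 H1].
    destruct (ex_integral_wPQ r (a - 2) H) as [l2 H2].
    exists (l1 - l2). refine (integral_ext _ _ _ _ (integral_minus _ _ _ _ H1 H2) _ eq_refl).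
    intros t. rewrite weight_factor, mono_expi by exact H. fold a. unfold wU.
    replace ((a - 2) * t)%R with (a * t + (- t + - t))%R by ring.
    rewrite !expi_plus, !expi_opp. field. apply expi_neq_0.
  - exists (l1 + l2). refine (integral_ext _ _ _ _ (integral_plus _ _ _ _ H1 H2) _ eq_refl).
    intros t. simpl. ring.
  - exists (c * l1). refine (integral_ext _ _ _ _ (integral_scal c _ _ H1) _ eq_refl).
    intros t. simpl. ring.
  - exists l1. refine (integral_ext _ _ _ _ H1 _ eq_refl).
    intros t. rewrite E; [reflexivity | apply expi_neq_0].
Qed.

Lemma laurent_mult (a b : bool) (f g : C -> C) :
  laurent a f -> laurent b g -> laurent (xorb a b) (fun z => f z * g z).
Proof.
  intros Hf Hg. induction Hf as [j k E | f1 f2 _ IH1 _ IH2 | c f _ IH | f1 f2 E _ IH].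
  - induction Hg as [j' k' E' | g1 g2 _ IH1 _ IH2 | c g _ IH | g1 g2 E' _ IH].
    + apply (laurent_ext _ (fun z => z ^ (j + j') * (/ z) ^ (k + k'))).
      * intros z _. rewrite !Cpow_add_r. ring.
      * apply laurent_mono.
        replace (j + j' + (k + k'))%nat with ((j + k) + (j' + k'))%nat by lia.
        rewrite Nat.odd_add, E, E'. reflexivity.
    + refine (laurent_ext _ _ _ _ (laurent_plus _ _ _ IH1 IH2)). intros; simpl; ring.
    + refine (laurent_ext _ _ _ _ (laurent_scal _ c _ IH)). intros; simpl; ring.
    + refine (laurent_ext _ _ _ _ IH). intros z Hz; simpl. now rewrite E'.
  - refine (laurent_ext _ _ _ _ (laurent_plus _ _ _ IH1 IH2)). intros; simpl; ring.
  - refine (laurent_ext _ _ _ _ (laurent_scal _ c _ IH)). intros; simpl; ring.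
  - refine (laurent_ext _ _ _ _ IH). intros z Hz; simpl. now rewrite E.
Qed.

Lemma ex_integral_tsum (r : R) (d d' : nat) (v v' : C) :
  (0 < r < 1)%R ->
  exists l, is_integral_0_pi
    (fun t => tsum r d v (2 * cos t)%R * tsum r d' v' (2 * cos t)%R * weight (r ^ 4) t) l.
Proof.
  intros H.
  assert (ex : forall N, exists l, is_integral_0_pi
     (fun t => part r d v (2 * cos t)%R N * part r d' v' (2 * cos t)%R N * weight (r ^ 4) t) l).
  { intros N.
    destruct (ex_integral_laurent r _ _ H
      (laurent_mult _ _ _ _ (laurent_part r d v N H) (laurent_part r d' v' N H))) as [l Hl].
    exists l. refine (integral_ext _ _ _ _ Hl _ eq_refl).
    intros t. cbv beta. now rewrite two_cos. }
  destruct (integral_uconv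
    (fun N t => part r d v (2 * cos t)%R N * part r d' v' (2 * cos t)%R N * weight (r ^ 4) t)
    (fun t => tsum r d v (2 * cos t)%R * tsum r d' v' (2 * cos t)%R * weight (r ^ 4) t)
    (fun N => proj1_sig (constructive_indefinite_description _ (ex N)))) as [L [_ HL]].
  - apply uconv_mult; [ | apply uconv_const | | now apply bounded_weight].
    + apply uconv_mult; auto using uconv_part, bounded_tsum.
    + apply bounded_mult; now apply bounded_tsum.
  - intros N. exact (proj2_sig (constructive_indefinite_description _ (ex N))).
  - now exists L.
Qed.

(** The pairing is bilinear, without complex conjugation.  It is a choice of the
    value of the integral, which exists by [ex_integral_tsum]. *)
Definition inner (r : R) (d : nat) (v v' : C) : C :=
  epsilon (inhabits (RtoC 0)) (is_integral_0_pi
    (fun t => tsum r d v (2 * cos t)%R * tsum r d v' (2 * cos t)%R * weight (r ^ 4) t)).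

Lemma inner_correct (r : R) (d : nat) (v v' : C) :
  (0 < r < 1)%R ->
  is_integral_0_pi
    (fun t => tsum r d v (2 * cos t)%R * tsum r d v' (2 * cos t)%R * weight (r ^ 4) t)
    (inner r d v v').
Proof. intros H. unfold inner. apply epsilon_spec. now apply ex_integral_tsum. Qed.

Lemma inner_sym (r : R) (d : nat) (v v' : C) :
  (0 < r < 1)%R -> inner r d v v' = inner r d v' v.
Proof.
  intros H. apply (integral_unique _ _ _ (inner_correct r d v v' H)).
  refine (integral_ext _ _ _ _ (inner_correct r d v' v H) _ eq_refl). intros; ring.
Qed.

Lemma inner_identity (r : R) (v v' : C) :
  (0 < r < 1)%R ->
  v' * inner r 0 v v' - v * inner r 1 v v'
  = 2 * PI * norm_const r * (tsum r 0 v (r + / r)%R * tsum r 1 v' (r + / r)%R).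
Proof.
  intros H.
  assert (H1 := integral_minus _ _ _ _
    (integral_scal v' _ _ (inner_correct r 0 v v' H))
    (integral_scal v _ _ (inner_correct r 1 v v' H))).
  destruct (integral_uconv
    (fun N t => (v' * (part r 0 v (2 * cos t)%R (S N) * part r 0 v' (2 * cos t)%R N)
               - v * (part r 1 v (2 * cos t)%R N * part r 1 v' (2 * cos t)%R N))
              * weight (r ^ 4) t)
    (fun t => (v' * (tsum r 0 v (2 * cos t)%R * tsum r 0 v' (2 * cos t)%R)
               - v * (tsum r 1 v (2 * cos t)%R * tsum r 1 v' (2 * cos t)%R))
              * weight (r ^ 4) t)
    (fun N => 2 * PI * norm_const r * (part r 0 v (r + / r)%R (S N) * part r 1 v' (r + / r)%R N)))
    as [L [HL HI]].
  - assert (B := fun d v => bounded_tsum r d v H).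
    assert (cb : forall c : C, bounded (fun _ => c)) by (intros c; exists (Cmod c); intros; lra).
    apply uconv_mult; [ | apply uconv_const | | now apply bounded_weight].
    + apply uconv_minus; apply (uconv_mult (fun _ _ => _)); try apply uconv_const; auto using bounded_mult.
      * apply uconv_mult; auto; [ | now apply uconv_part].
        apply (uconv_S (fun N t => part r 0 v (2 * cos t)%R N)). now apply uconv_part.
      * apply uconv_mult; auto; now apply uconv_part.
    + destruct (B 0%nat v) as [M0 B0], (B 0%nat v') as [M0' B0'],
        (B 1%nat v) as [M1 B1], (B 1%nat v') as [M1' B1'].
      exists (Cmod v' * (M0 * M0') + Cmod v * (M1 * M1'))%R. intros t.
      eapply Rle_trans; [apply (Cmod_triangle _ (- (v * _))) | ].
      rewrite Cmod_opp, !Cmod_mult.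
      apply Rplus_le_compat; apply Rmult_le_compat_l; try apply Cmod_ge_0;
        apply Rmult_le_compat; try apply Cmod_ge_0; auto.
  - intros N. now apply integral_parts.
  - transitivity L.
    + refine (integral_unique _ _ _ H1 (integral_ext _ _ _ _ HI _ eq_refl)). intros; ring.
    + apply (clim_unique _ _ _ HL). apply clim_scal, clim_mult.
      * apply -> (clim_incr_1 (part r 0 v (r + / r)%R)). now apply tsum_correct.
      * now apply tsum_correct.
Qed.

(** * Continuity in the parameter *)

Lemma Cpow_lipschitz (u v : C) (V : R) (n : nat) :
  (Cmod u <= V)%R -> (Cmod v <= V)%R -> (1 <= V)%R ->
  (Cmod (u ^ n - v ^ n) <= (2 * V) ^ n * Cmod (u - v))%R.
Proof.
  intros Hu Hv HV. induction n.
  - simpl. replace (1 - 1) with (RtoC 0) by ring. rewrite Cmod_0.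
    generalize (Cmod_ge_0 (u - v)). lra.
  - rewrite !Cpow_S.
    replace (u * u ^ n - v * v ^ n) with (u * (u ^ n - v ^ n) + (u - v) * v ^ n) by ring.
    eapply Rle_trans; [apply Cmod_triangle | ]. rewrite !Cmod_mult, Cmod_pow.
    assert (D := Cmod_ge_0 (u - v)). set (e := Cmod (u - v)) in *.
    assert (P : (0 <= (2 * V) ^ n)%R) by (apply pow_le; lra).
    assert (A : (Cmod u * Cmod (u ^ n - v ^ n) <= V * ((2 * V) ^ n * e))%R)
      by (apply Rmult_le_compat; try apply Cmod_ge_0; assumption).
    assert (B : (e * Cmod v ^ n <= e * (V * (2 * V) ^ n))%R).
    { apply Rmult_le_compat_l; [exact D | ].
      apply Rle_trans with ((2 * V) ^ n)%R.
      - apply pow_incr. split; [apply Cmod_ge_0 | lra].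
      - rewrite <- (Rmult_1_l ((2 * V) ^ n)) at 1. apply Rmult_le_compat_r; lra. }
    simpl. replace (2 * V * (2 * V) ^ n * e)%R
      with (V * ((2 * V) ^ n * e) + e * (V * (2 * V) ^ n))%R by ring. lra.
Qed.

Lemma tsum_lipschitz (r V : R) (d : nat) :
  (0 < r < 1)%R -> (1 <= V)%R ->
  exists K, forall u v t, (Cmod u <= V)%R -> (Cmod v <= V)%R ->
    (Cmod (tsum r d u (2 * cos t)%R - tsum r d v (2 * cos t)%R) <= K * Cmod (u - v))%R.
Proof.
  intros H HV.
  set (M := term_max r (herm_max (r ^ 4) 2 * (2 * V)) d).
  assert (HM : ex_series M).
  { apply ex_series_term_max; [exact H | ].
    apply Rmult_lt_0_compat; [ | lra].
    apply herm_max_pos; [now apply r4_in_01 | lra]. }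
  exists (Series M). intros u v t Hu Hv. set (X := RtoC (2 * cos t)).
  rewrite Rmult_comm, <- Series_scal_l.
  apply (has_sum_bound (fun n => term r d u X n + (- (1)) * term r d v X n)).
  - replace (tsum r d u X - tsum r d v X) with (tsum r d u X + (- (1)) * tsum r d v X) by ring.
    apply has_sum_plus; [ | apply has_sum_scal]; now apply tsum_correct.
  - intros n. unfold term, M, term_max.
    set (m := (2 * n + d)%nat). set (h := herm (r ^ 4) m X).
    assert (Hh : (Cmod h <= herm_max (r ^ 4) 2 ^ m)%R)
      by (apply herm_bound; [now apply r4_in_01 | apply two_cos_bound]).
    replace ((- (1)) ^ n * r ^ (m * m) * h * u ^ m + - (1) * ((- (1)) ^ n * r ^ (m * m) * h * v ^ m))
      with ((- (1)) ^ n * r ^ (m * m) * h * (u ^ m - v ^ m)) by ring.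
    rewrite !Cmod_mult, !Cmod_pow, Cmod_opp, Cmod_1, pow1, Rmult_1_l, Cmod_R, Rabs_pos_eq by lra.
    rewrite Rpow_mult_distr.
    assert (L := Cpow_lipschitz u v V m Hu Hv HV).
    assert (R1 : (0 <= r ^ (m * m))%R) by (apply pow_le; lra).
    apply Rle_trans with (r ^ (m * m) * herm_max (r ^ 4) 2 ^ m * ((2 * V) ^ m * Cmod (u - v)))%R.
    + apply Rmult_le_compat; try apply Cmod_ge_0; [ | | exact L].
      * apply Rmult_le_pos; [exact R1 | apply Cmod_ge_0].
      * now apply Rmult_le_compat_l.
    + right. ring.
  - now apply (ex_series_scal (Cmod (u - v)) M).
Qed.

Lemma clim_seq_bounded (u : nat -> C) (l : C) :
  clim u l -> exists V, (1 <= V)%R /\ (Cmod l <= V)%R /\ forall n, (Cmod (u n) <= V)%R.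
Proof.
  intros H.
  destruct (filterlim_bounded (V := R_NormedModule) (fun n => Cmod (u n))) as [M HM].
  { exists (Cmod l). exact (clim_Cmod _ _ H). }
  assert (B : forall n, (Cmod (u n) <= M)%R).
  { intros m. eapply Rle_trans; [ | exact (HM m)]. apply Rle_abs. }
  exists (Rmax 1 M). split; [apply Rmax_l | ]. split.
  - apply (clim_bound u); [exact H | ]. intros n. eapply Rle_trans; [apply B | apply Rmax_r].
  - intros n. eapply Rle_trans; [apply B | apply Rmax_r].
Qed.

Lemma inner_continuous (r : R) (d : nat) (v w : C) (u : nat -> C) :
  (0 < r < 1)%R -> clim u w -> clim (fun n => inner r d v (u n)) (inner r d v w).
Proof.
  intros H Hu. destruct (clim_seq_bounded u w Hu) as [V [V1 [Vw Vu]]].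
  destruct (tsum_lipschitz r V d H V1) as [K HK].
  destruct (bounded_mult _ _ (bounded_tsum r d v H) (bounded_weight r H)) as [B HB].
  apply (clim_squeeze _ _ (fun n => PI * (B * (K * Cmod (u n - w))))%R).
  - intros n.
    refine (integral_bound _ _ _ (integral_minus _ _ _ _ (inner_correct r d v (u n) H)
              (inner_correct r d v w H)) _).
    intros t. cbv beta.
    replace (tsum r d v (2 * cos t)%R * tsum r d (u n) (2 * cos t)%R * weight (r ^ 4) t -
      tsum r d v (2 * cos t)%R * tsum r d w (2 * cos t)%R * weight (r ^ 4) t)
      with ((tsum r d v (2 * cos t)%R * weight (r ^ 4) t)
        * (tsum r d (u n) (2 * cos t)%R - tsum r d w (2 * cos t)%R)) by ring.
    rewrite Cmod_mult. apply Rmult_le_compat; try apply Cmod_ge_0; [apply HB | now apply HK].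
  - apply (is_lim_seq_eq _ (PI * (B * (K * 0)))%R); [ | ring].
    repeat (apply is_lim_seq_mult'; [apply is_lim_seq_const | ]). exact Hu.
Qed.

Lemma pole_factor_continuous (q : R) (w : C) (u : nat -> C) :
  (0 < q < 1)%R -> clim u w -> clim (fun n => pole_factor q (u n)) (pole_factor q w).
Proof.
  intros Hq Hu. destruct (clim_seq_bounded u w Hu) as [V [V1 [Vw Vu]]].
  assert (P := q2_in_01 q Hq). unfold pole_factor. rewrite <- (RtoC_pow q 2).
  assert (B : forall x, (Cmod x <= V)%R -> (Cmod (- (q * x ^ 2)) <= V ^ 2)%R).
  { intros x Hx. rewrite Cmod_opp, Cmod_mult, Cmod_pow, Cmod_R, Rabs_pos_eq by lra.
    assert (X := Cmod_ge_0 x).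
    assert (Cmod x ^ 2 <= V ^ 2)%R by (apply pow_incr; lra).
    assert (0 <= Cmod x ^ 2)%R by (apply pow_le; lra). nra. }
  assert (L : clim (fun n => - (q * u n ^ 2)) (- (q * w ^ 2))).
  { apply (clim_ext (fun n => (- q) * (u n * u n))); [intros; ring | ].
    replace (- (q * w ^ 2)) with ((- q) * (w * w)) by ring.
    apply clim_scal. now apply clim_mult. }
  apply (clim_squeeze _ _ (fun n => exp (V ^ 2 / (1 - q ^ 2)) / (1 - q ^ 2)
     * Cmod (- (q * u n ^ 2) - - (q * w ^ 2)))%R).
  - intros n. apply qpoch_inf_lipschitz; [exact P | apply B, Vu | apply B, Vw].
  - apply (is_lim_seq_eq _ (exp (V ^ 2 / (1 - q ^ 2)) / (1 - q ^ 2) * 0)%R); [ | ring].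
    apply is_lim_seq_mult'; [apply is_lim_seq_const | exact L].
Qed.

Lemma clim_quotient (X Y Z : nat -> C) (y z : C) :
  clim Y y -> y <> 0 -> clim Z z -> (forall n, Y n <> 0 -> X n * Y n = Z n) ->
  clim X (z / y).
Proof.
  intros HY y0 HZ E.
  assert (P : (0 < Cmod y)%R) by now apply Cmod_gt_0.
  assert (P2 : (0 < Cmod y / 2)%R) by lra.
  assert (L : clim (fun n => Z n * y - z * Y n) 0).
  { replace (RtoC 0) with (z * y - z * y) by ring.
    apply clim_minus; [apply clim_mult; [exact HZ | apply clim_const] | now apply clim_scal]. }
  destruct (proj1 (filterlim_locally _ 0%R) HY (mkposreal _ P2)) as [N HN].
  unfold clim.
  apply (is_lim_seq_le_le_loc (fun _ => 0%R) _
           (fun n => Cmod (Z n * y - z * Y n - 0) * (2 / (Cmod y * Cmod y)))%R).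
  - exists N. intros n Hn. split; [apply Cmod_ge_0 | ].
    assert (B : (Rabs (Cmod (Y n - y) - 0) < Cmod y / 2)%R) by exact (HN n Hn).
    rewrite Rminus_0_r, Rabs_pos_eq in B by apply Cmod_ge_0.
    assert (T : (Cmod y <= Cmod (Y n) + Cmod (Y n - y))%R).
    { replace y with (Y n + - (Y n - y)) at 1 by ring.
      eapply Rle_trans; [apply Cmod_triangle | ]. rewrite Cmod_opp. lra. }
    assert (Y0 : Y n <> 0) by (apply Cmod_gt_0; lra).
    replace (X n - z / y) with ((Z n * y - z * Y n - 0) / (Y n * y))
      by (rewrite <- (E n Y0); field; auto).
    rewrite Cmod_div by now apply Cmult_neq_0. rewrite Cmod_mult.
    apply Rmult_le_compat_l; [apply Cmod_ge_0 | ].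
    replace (2 / (Cmod y * Cmod y))%R with (/ (Cmod y / 2 * Cmod y))%R by (field; lra).
    apply Rinv_le_contravar; [apply Rmult_lt_0_compat; lra | ].
    apply Rmult_le_compat_r; lra.
  - apply is_lim_seq_const.
  - apply (is_lim_seq_eq _ (0 * (2 / (Cmod y * Cmod y)))%R); [ | ring].
    apply is_lim_seq_mult'; [exact L | apply is_lim_seq_const].
Qed.

Lemma filterlim_sequential (f : C -> C) (w l : C) :
  (forall u : nat -> C, (forall n, u n <> w) -> clim u w -> clim (fun n => f (u n)) l) ->
  filterlim f (@locally' C_UniformSpace w) (@locally C_UniformSpace l).
Proof.
  intros H. apply filterlim_locally. intros eps.
  apply NNPP. intros N.
  assert (ex : forall n : nat, exists u : C, u <> w /\ (Cmod (u - w) < sqrt 2 * / INR (S n))%R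
     /\ ~ @ball C_UniformSpace l eps (f u)).
  { intros n. apply NNPP. intros N'. apply N.
    assert (P : (0 < / INR (S n))%R) by (apply Rinv_0_lt_compat, lt_0_INR; lia).
    exists (mkposreal _ P). intros u Hu Huw. apply NNPP. intros B. apply N'.
    exists u. split; [exact Huw | split; [ | exact B]].
    exact (C_NormedModule_mixin_compat2 w u (mkposreal _ P) Hu). }
  set (u := fun n => proj1_sig (constructive_indefinite_description _ (ex n))).
  assert (U : forall n, u n <> w /\ (Cmod (u n - w) < sqrt 2 * / INR (S n))%R
     /\ ~ @ball C_UniformSpace l eps (f (u n))).
  { intros n. exact (proj2_sig (constructive_indefinite_description _ (ex n))). }
  assert (L : clim (fun n => f (u n)) l).
  { apply H; [intros n; apply U | ].
    apply (clim_squeeze _ _ (fun n => sqrt 2 * / INR (S n))%R).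
    - intros n. left. apply U.
    - apply (is_lim_seq_eq _ (sqrt 2 * 0)%R); [ | ring].
      apply is_lim_seq_mult'; [apply is_lim_seq_const | ].
      apply (is_lim_seq_incr_1 (fun n => / INR n)%R).
      apply (is_lim_seq_inv INR p_infty); [apply is_lim_seq_INR | discriminate]. }
  apply is_lim_seq_Cmod_filterlim in L.
  destruct (proj1 (filterlim_locally _ _) L eps) as [n0 Hn0].
  apply (proj2 (proj2 (U n0))). apply Hn0. apply Nat.le_refl.
Qed.

(** * Orthogonality and norms for the bilinear pairing *)

(** The two instances of [inner_identity] are homogeneous linear equations in the
    two pairings, with determinant w^2 - w'^2 up to sign. *)
Lemma inner_orthogonal (r : R) (w w' : C) :
  (0 < r < 1)%R -> tsum r 1 w (r + / r)%R = 0 -> tsum r 1 w' (r + / r)%R = 0 ->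
  w <> w' -> w + w' <> 0 -> inner r 0 w w' = 0 /\ inner r 1 w w' = 0.
Proof.
  intros H Sw Sw' N1 N2.
  assert (I1 := inner_identity r w w' H). assert (I2 := inner_identity r w' w H).
  rewrite Sw' in I1. rewrite Sw in I2.
  rewrite !(inner_sym r _ w' w H) in I2.
  set (a := inner r 0 w w') in *. set (b := inner r 1 w w') in *.
  assert (D : (w - w') * (w + w') <> 0).
  { apply Cmult_neq_0; [ | exact N2]. intros E. apply N1.
    replace w with ((w - w') + w') by ring. rewrite E. ring. }
  split; apply (Cmult_cancel_l _ _ _ D); rewrite Cmult_0_r.
  - transitivity (w * (w * a - w' * b) - w' * (w' * a - w * b)); [ring | ].
    rewrite I1, I2. ring.
  - transitivity (w' * (w * a - w' * b) - w * (w' * a - w * b)); [ring | ].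
    rewrite I1, I2. ring.
Qed.

Lemma norm_const_neq_0 (r : R) : (0 < r < 1)%R -> norm_const r <> 0.
Proof.
  intros H. assert (Q := r4_in_01 r H). assert (R2 := r2_in_01 r H).
  assert (A : qpoch_inf (r ^ 2) (r ^ 4)%R <> 0).
  { apply qpoch_inf_disc_neq_0; [exact Q | ]. rewrite Cmod_r2 by exact H. lra. }
  assert (B : qpoch_inf (r ^ 4) (r ^ 4)%R <> 0)
    by (rewrite <- RtoC_pow; now apply qpoch_inf_qq_neq_0).
  unfold norm_const, Cdiv. apply Cmult_neq_0; [now apply Cpow_nz | ].
  now apply Cinv_neq_0, Cpow_nz.
Qed.

(** Eliminating the pairing of the sines from the two instances of
    [inner_identity] at (w, u) and (u, w) leaves an equation that determines
    S_u(eta) / (u - w) near u = w. *)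
Lemma inner_diagonal (r : R) (w : C) :
  (0 < r < 1)%R -> tsum r 1 w (r + / r)%R = 0 -> w <> 0 ->
  inner r 1 w w = inner r 0 w w /\
  forall u, (u - w) * (u + w) * inner r 0 w u
    = u * (2 * PI * norm_const r * tsum r 0 w (r + / r)%R) * tsum r 1 u (r + / r)%R.
Proof.
  intros H Sw W0. split.
  - apply (Cmult_cancel_l w); [exact W0 | ].
    assert (I := inner_identity r w w H). rewrite Sw in I.
    replace (w * inner r 1 w w) with
      (w * inner r 0 w w - (w * inner r 0 w w - w * inner r 1 w w)) by ring.
    rewrite I. ring.
  - intros u. assert (I1 := inner_identity r w u H). assert (I2 := inner_identity r u w H).
    rewrite Sw in I2. rewrite !(inner_sym r _ u w H) in I2.
    transitivity (u * (u * inner r 0 w u - w * inner r 1 w u)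
                  - w * (w * inner r 0 w u - u * inner r 1 w u)); [ring | ].
    rewrite I1, I2. ring.
Qed.

Lemma eta_eq (r : R) : (0 < r < 1)%R -> eta (r ^ 4) = ((r + / r) / 2)%R.
Proof.
  intros H. unfold eta. rewrite Rpower_Ropp, Rpower_quarter by exact H. reflexivity.
Qed.

Lemma basic_cos_eta (r : R) (w : C) :
  (0 < r < 1)%R ->
  basic_cos (r ^ 4) (eta (r ^ 4)) w = tsum r 0 w (r + / r)%R / pole_factor (r ^ 4) w.
Proof.
  intros H. rewrite eta_eq by exact H. rewrite (basic_cos_series r _ r w H).
  - f_equal. f_equal. rewrite RtoC_div by lra. field.
  - now apply r_neq_0.
  - rewrite RtoC_div, RtoC_plus, RtoC_inv by lra. reflexivity.
Qed.

Lemma basic_sin_eta (r : R) (w : C) :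
  (0 < r < 1)%R ->
  basic_sin (r ^ 4) (eta (r ^ 4)) w = tsum r 1 w (r + / r)%R / pole_factor (r ^ 4) w.
Proof.
  intros H. rewrite eta_eq by exact H. rewrite (basic_sin_series r _ r w H).
  - f_equal. f_equal. rewrite RtoC_div by lra. field.
  - now apply r_neq_0.
  - rewrite RtoC_div, RtoC_plus, RtoC_inv by lra. reflexivity.
Qed.

Lemma basic_cos_circle (r t : R) (w : C) :
  (0 < r < 1)%R ->
  basic_cos (r ^ 4) (cos t) w = tsum r 0 w (2 * cos t)%R / pole_factor (r ^ 4) w.
Proof.
  intros H. rewrite (basic_cos_series r _ (expi t) w H).
  - now rewrite RtoC_mult.
  - apply expi_neq_0.
  - rewrite <- two_cos, RtoC_mult. field.
Qed.

Lemma basic_sin_circle (r t : R) (w : C) :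
  (0 < r < 1)%R ->
  basic_sin (r ^ 4) (cos t) w = tsum r 1 w (2 * cos t)%R / pole_factor (r ^ 4) w.
Proof.
  intros H. rewrite (basic_sin_series r _ (expi t) w H).
  - now rewrite RtoC_mult.
  - apply expi_neq_0.
  - rewrite <- two_cos, RtoC_mult. field.
Qed.

(** If C(eta; w) <> 0, the identity of [inner_diagonal] writes the difference
    quotient of S(eta; .) at w as a quotient of functions continuous at w, which
    gives its limit.  If C(eta; w) = 0, both sides are 0. *)
Lemma norm_sq_inner (r : R) (w : C) :
  (0 < r < 1)%R -> w <> 0 -> pole_factor (r ^ 4) w <> 0 ->
  tsum r 1 w (r + / r)%R = 0 ->
  norm_sq (r ^ 4) w = inner r 0 w w / (pole_factor (r ^ 4) w * pole_factor (r ^ 4) w).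
Proof.
  intros H W0 P0 Sw. assert (Q := r4_in_01 r H).
  assert (K0 := norm_const_neq_0 r H).
  destruct (inner_diagonal r w H Sw W0) as [_ D].
  assert (PI0 : RtoC PI <> 0) by (apply RtoC_neq; generalize PI_RGT_0; lra).
  assert (two : RtoC 2 <> 0) by (apply RtoC_neq; lra).
  unfold norm_sq. rewrite Rpower_half, basic_cos_eta by exact H.
  replace (qpoch_inf (r ^ 2)%R (r ^ 4)%R ^ 2 / qpoch_inf (r ^ 4)%R (r ^ 4)%R ^ 2)
    with (norm_const r) by (unfold norm_const; rewrite <- !RtoC_pow; reflexivity).
  set (p := pole_factor (r ^ 4) w) in *. set (c := tsum r 0 w (r + / r)%R) in *.
  set (k := norm_const r) in *. set (i := inner r 0 w w).
  destruct (classic (c = 0)) as [C0 | C0].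
  -
    (* the right-hand side of the identity vanishes for all u, hence so does the
       inner product at u = w, by continuity *)
    assert (I0 : i = 0).
    { (* points u with u - w and u + w nonzero *)
      set (u := fun n : nat => w + w * / INR (S n)).
      assert (pos : forall n, RtoC (/ INR (S n)) <> 0).
      { intros n. apply RtoC_neq. apply Rinv_neq_0_compat, not_0_INR. lia. }
      assert (Eu : forall n, inner r 0 w (u n) = 0).
      { intros n. apply (Cmult_cancel_l ((u n - w) * (u n + w))).
        - replace (u n - w) with (w * (/ INR (S n))%R)
            by (unfold u; rewrite RtoC_inv by (apply not_0_INR; lia); ring).
          replace (u n + w) with (w * RtoC (2 + / INR (S n))).
          2:{ unfold u. rewrite RtoC_plus, RtoC_inv by (apply not_0_INR; lia). ring. }
          assert (RtoC (2 + / INR (S n)) <> 0).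
          { apply RtoC_neq. assert (0 < / INR (S n))%R by (apply Rinv_0_lt_compat, lt_0_INR; lia). lra. }
          auto using Cmult_neq_0.
        - rewrite D, C0. ring. }
      assert (Lu : clim u w).
      { replace w with (w + w * 0) at 1 by ring.
        apply clim_plus; [apply clim_const | apply clim_scal].
        apply (clim_squeeze _ _ (fun n => / INR (S n))%R).
        - intros n. rewrite <- RtoC_inv by (apply not_0_INR; lia).
          rewrite <- RtoC_minus, Cmod_R, Rminus_0_r, Rabs_pos_eq; [lra | ].
          left. apply Rinv_0_lt_compat, lt_0_INR. lia.
        - apply (is_lim_seq_incr_1 (fun n => / INR n)%R).
          apply (is_lim_seq_inv INR p_infty); [apply is_lim_seq_INR | discriminate]. }
      apply (clim_unique (fun n => inner r 0 w (u n))).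
      - now apply inner_continuous.
      - apply (clim_ext (fun _ => 0)); [intros; now rewrite Eu | apply clim_const]. }
    rewrite I0, C0. field. exact P0.
  - set (A := 2 * PI * k * c) in *.
    assert (A0 : A <> 0) by (unfold A; auto using Cmult_neq_0).
    assert (E : C_derive (basic_sin (r ^ 4) (eta (r ^ 4))) w = (w + w) * i / (A * w * p)).
    { unfold C_derive. apply is_C_lim_unique. apply filterlim_sequential.
      intros u Hu Lu.
      apply (clim_quotient _ (fun n => A * u n * pole_factor (r ^ 4) (u n))
               (fun n => (u n + w) * inner r 0 w (u n))).
      - apply clim_mult; [now apply clim_scal | now apply pole_factor_continuous].
      - auto using Cmult_neq_0.
      - apply clim_mult; [apply clim_plus; [exact Lu | apply clim_const] | ].
        now apply inner_continuous.
      - intros n Yn. rewrite !basic_sin_eta, Sw by exact H.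
        assert (U0 : u n - w <> 0).
        { intros E. apply (Hu n). replace (u n) with ((u n - w) + w) by ring. rewrite E. ring. }
        assert (Pn : pole_factor (r ^ 4) (u n) <> 0) by (intros E; apply Yn; rewrite E; ring).
        apply (Cmult_cancel_l (u n - w)); [exact U0 | ].
        transitivity ((u n - w) * (u n + w) * inner r 0 w (u n)); [ | ring].
        rewrite D. field. auto. }
    rewrite E. unfold A. field. auto.
Qed.

(** * Parity in x *)

Lemma herm_parity (q : R) (n : nat) (X : C) :
  (0 < q < 1)%R -> herm q n (- X) = (- (1)) ^ n * herm q n X.
Proof.
  intros Hq. revert n. apply nat_ind2.
  - unfold herm. simpl. ring.
  - unfold herm. simpl. field. now apply one_minus_neq_0.
  - intros n P0 P1. apply (Cmult_cancel_l (1 - q * q ^ S n)).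
    { now apply one_minus_pow_neq_0. }
    rewrite herm_S by exact Hq.
    change (herm_prev q (S n) (- X)) with (herm q n (- X)). rewrite P0, P1.
    transitivity ((- (1)) ^ S (S n) * ((1 - q * q ^ S n) * herm q (S (S n)) X)); [ | ring].
    rewrite herm_S by exact Hq. change (herm_prev q (S n) X) with (herm q n X).
    rewrite !Cpow_S. ring.
Qed.

Lemma tsum_parity (r : R) (d : nat) (v X : C) :
  (0 < r < 1)%R -> tsum r d v (- X) = (- (1)) ^ d * tsum r d v X.
Proof.
  intros H. apply (has_sum_unique (term r d v (- X))); [now apply tsum_correct | ].
  apply (has_sum_ext (fun n => (- (1)) ^ d * term r d v X n)).
  - intros n. unfold term. rewrite herm_parity by (now apply r4_in_01).
    rewrite (Cpow_add_r (- (1)) (2 * n) d), (Cpow_mult_r (- (1)) 2 n).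
    replace ((- (1)) ^ 2) with (RtoC 1) by ring. rewrite Cpow_1_l. ring.
  - apply has_sum_scal. now apply tsum_correct.
Qed.

Lemma weight_reflect (q t : R) : weight q (PI - t) = weight q t.
Proof.
  assert (E1 : expi (2 * (PI - t)) = expi (- (2 * t))).
  { replace (2 * (PI - t))%R with (2 * PI + - (2 * t))%R by ring. rewrite expi_plus.
    unfold expi at 1. rewrite cos_2PI, sin_2PI. apply Cmult_1_l. }
  unfold weight.
  replace (- (2 * (PI - t)))%R with (2 * t - 2 * PI)%R by ring.
  assert (E2 : expi (2 * t - 2 * PI) = expi (2 * t)).
  { rewrite <- (Ropp_involutive (2 * t - 2 * PI)), expi_opp.
    replace (- (2 * t - 2 * PI))%R with (2 * (PI - t))%R by ring.
    rewrite E1, expi_opp. field. apply expi_neq_0. }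
  rewrite E1, E2, (Cmult_comm (qpoch_inf (expi (- (2 * t))) q)).
  rewrite (Cmult_comm (qpoch_inf (_ * expi (- (2 * t))) q)). reflexivity.
Qed.

Lemma integral_antisymmetric (f : R -> C) (l : C) :
  is_integral_0_pi f l -> (forall t, f (PI - t)%R = - f t) -> l = 0.
Proof.
  intros Hf E.
  assert (H1 : @is_RInt C_R_NormedModule f (-1 * 0 + PI) (-1 * PI + PI) (- l)).
  { replace (-1 * 0 + PI)%R with PI by ring. replace (-1 * PI + PI)%R with 0%R by ring.
    exact (is_RInt_swap (V := C_R_NormedModule) f _ _ l Hf). }
  apply is_RInt_comp_lin in H1.
  assert (H2 : is_integral_0_pi f (- l)).
  { refine (integral_ext _ _ _ _ H1 _ eq_refl). intros t. cbv beta.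
    replace (-1 * t + PI)%R with (PI - t)%R by ring. rewrite E.
    destruct (f t) as [a b].
    apply injective_projections; [change (-1 * - a = a)%R | change (-1 * - b = b)%R]; ring. }
  assert (E2 := integral_unique _ _ _ Hf H2).
  apply (Cmult_cancel_l 2); [apply RtoC_neq; lra | ].
  transitivity (l + l); [ring | ]. rewrite E2 at 2. ring.
Qed.

(** * The orthogonality relations *)

(* The hypothesis w + w' <> 0 in (i) and (ii) excludes w' = - w: as C is even
   and S is odd in w, the cases w <> w' (for w' = - w <> 0) and w = w' = 0 of
   the printed formulas fail there. *)
Theorem mainTheorem1 (q : R) (w w' : C)
    (hq : (0 < q < 1)%R)
    (hw : boundary_condition q w) (hw' : boundary_condition q w') :
  (w + w' <> 0 ->
    (w <> w' ->
      is_integral_0_pi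
        (fun t => basic_cos q (cos t) w * basic_cos q (cos t) w' * weight q t)
        0) /\
    (w = w' ->
      is_integral_0_pi
        (fun t => basic_cos q (cos t) w * basic_cos q (cos t) w' * weight q t)
        (norm_sq q w))) /\
  (w + w' <> 0 ->
    (w <> w' ->
      is_integral_0_pi
        (fun t => basic_sin q (cos t) w * basic_sin q (cos t) w' * weight q t)
        0) /\
    (w = w' ->
      is_integral_0_pi
        (fun t => basic_sin q (cos t) w * basic_sin q (cos t) w' * weight q t)
        (norm_sq q w))) /\
  is_integral_0_pi
    (fun t => basic_cos q (cos t) w * basic_sin q (cos t) w' * weight q t)
    0.
Proof.
  destruct (fourth_root q hq) as [r [H Eq]]. subst q.
  destruct hw as [P0 B]. destruct hw' as [P0' B'].
  change (pole_factor (r ^ 4) w <> 0) in P0.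
  change (pole_factor (r ^ 4) w' <> 0) in P0'.
  assert (zero : forall v, pole_factor (r ^ 4) v <> 0 ->
     basic_sin (r ^ 4) (eta (r ^ 4)) v = 0 -> tsum r 1 v (r + / r)%R = 0).
  { intros v Pv Bv. rewrite basic_sin_eta in Bv by exact H.
    replace (tsum r 1 v (r + / r)%R) with
      (tsum r 1 v (r + / r)%R / pole_factor (r ^ 4) v * pole_factor (r ^ 4) v) by (field; exact Pv).
    rewrite Bv. ring. }
  assert (Sw := zero w P0 B). assert (Sw' := zero w' P0' B').
  assert (IC : is_integral_0_pi
      (fun t => basic_cos (r ^ 4) (cos t) w * basic_cos (r ^ 4) (cos t) w' * weight (r ^ 4) t)
      (/ (pole_factor (r ^ 4) w * pole_factor (r ^ 4) w') * inner r 0 w w')).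
  { refine (integral_ext _ _ _ _ (integral_scal _ _ _ (inner_correct r 0 w w' H)) _ eq_refl).
    intros t. rewrite !basic_cos_circle by exact H. field. auto. }
  assert (IS : is_integral_0_pi
      (fun t => basic_sin (r ^ 4) (cos t) w * basic_sin (r ^ 4) (cos t) w' * weight (r ^ 4) t)
      (/ (pole_factor (r ^ 4) w * pole_factor (r ^ 4) w') * inner r 1 w w')).
  { refine (integral_ext _ _ _ _ (integral_scal _ _ _ (inner_correct r 1 w w' H)) _ eq_refl).
    intros t. rewrite !basic_sin_circle by exact H. field. auto. }
  assert (W0 : w + w' <> 0 -> w = w' -> w <> 0).
  { intros N <- E. apply N. rewrite E. ring. }
  split; [ | split].
  - intros N. split; intros E.
    + destruct (inner_orthogonal r w w' H Sw Sw' E N) as [Z _].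
      rewrite Z, Cmult_0_r in IC. exact IC.
    + rewrite (norm_sq_inner r w H (W0 N E) P0 Sw). subst w'.
      refine (integral_ext _ _ _ _ IC (fun _ => eq_refl) _). field. exact P0.
  - intros N. split; intros E.
    + destruct (inner_orthogonal r w w' H Sw Sw' E N) as [_ Z].
      rewrite Z, Cmult_0_r in IS. exact IS.
    + rewrite (norm_sq_inner r w H (W0 N E) P0 Sw).
      destruct (inner_diagonal r w H Sw (W0 N E)) as [D _]. subst w'. rewrite D in IS.
      refine (integral_ext _ _ _ _ IS (fun _ => eq_refl) _). field. exact P0.
  - destruct (ex_integral_tsum r 0 1 w w' H) as [l Hl].
    assert (L0 : l = 0).
    { apply (integral_antisymmetric _ _ Hl). intros t.
      rewrite weight_reflect.
      replace (RtoC (2 * cos (PI - t))) with (- RtoC (2 * cos t)).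
      2:{ rewrite <- RtoC_opp. f_equal.
          replace (PI - t)%R with (- t + PI)%R by ring. rewrite neg_cos, cos_neg. ring. }
      rewrite !tsum_parity by exact H. simpl. ring. }
    rewrite L0 in Hl.
    refine (integral_ext _ _ _ _ (integral_scal (/ (pole_factor (r ^ 4) w * pole_factor (r ^ 4) w')) _ _ Hl) _ _).
    + intros t. rewrite basic_cos_circle, basic_sin_circle by exact H. field. auto.
    + ring.
Qed.
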